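(* Let $d,N\ge1$ be integers, $0<\tau_1<\cdots<\tau_N<T$, $\delta\in(0,1)$, and let $D_1,\dots,D_N\in C^{1,\delta}(\mathbb{R},\mathbb{C}^{d\times d})$ be $T$-periodic. Assume that the system $y(t)=\sum_{j=1}^N D_j(t)y(t-\tau_j)$, $t>s$, is exponentially stable. With $\Lambda(p)$, $R(p)$ and $\gamma_2$ as defined in the context, for every $p\in\mathbb{C}$ with $\Re(p)>\gamma_2$ it holds that $$\Lambda(p)\phi=R(p)^{-1}\phi,\qquad \phi\in L^2([0,T],\mathbb{C}^d).$$
   Context: $C^{1,\delta}$ means differentiable with $\delta$-Hölder continuous derivative. Put $\omega=2\pi/T$. Stability. For $s\in\mathbb{R}$, $\phi\in L^2([-\tau_N,0],\mathbb{C}^d)$ there is a unique $y\in L^2_{\rm loc}([s-\tau_N,+\infty),\mathbb{C}^d)$ with $y(s+\theta)=\phi(\theta)$ for a.e. $\theta\in[-\tau_N,0]$ and $y(t)=\sum_j D_j(t)y(t-\tau_j)$ for a.e. $t\ge s$; set $(U_2(t,s)\phi)(\theta)=y(t+\theta)$. Exponential stability means that there are $\gamma_0,K_0>0$ with $\|U_2(t,s)\phi\|_{L^2}\le K_0e^{-\gamma_0(t-s)}\|\phi\|_{L^2}$ for all $s\in\mathbb{R}$, $t\ge s$ and $\phi$ (it is known that replacing $L^2$ by $L^q$, $1\le q\le\infty$, or by continuous solutions gives an equivalent notion). Let $a$ be the spectral radius of the monodromy operator $U_2(T,0)$; under exponential stability $a<1$. Fundamental solution. $X:\mathbb{R}^2\to\mathbb{C}^{d\times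 d}$ is defined by $X(t,s)=0$ for $t<s$ and $X(t,s)=I_d+\sum_{j=1}^N D_j(t)X(t-\tau_j,s)$ for $t\ge s$. Let $\mathcal{F}=\{\sum_{\ell=1}^N n_\ell\tau_\ell:\ (n_1,\dots,n_N)\in\mathbb{N}^N\}$ (with $0\in\mathbb N$). For $t\ge s$ one has $X(t,s)=-\sum_{\mathfrak{f}\in\mathcal{F}\cap[0,t-s]}\mathfrak{C}_{\mathfrak{f}}(t)$ for uniquely determined $T$-periodic functions $\mathfrak{C}_{\mathfrak{f}}\in C^{1,\delta}(\mathbb{R},\mathbb{C}^{d\times d})$, $\mathfrak f\in\mathcal F$ (so $\mathfrak{C}_0=-I_d$). The constant $\gamma_2$. Let $\Lambda_\delta(g)$ denote the $\delta$-Hölder constant of $g$. Let $K,\gamma\ge0$ be constants (which exist) such that for all $\tau\ge0$ and $t\in\mathbb{R}$ the three sums $\sum_{\mathfrak{f}\in\mathcal{F}\cap(0,\tau]}\|\mathfrak{C}_{\mathfrak{f}}(t)\|$, $\sum_{\mathfrak{f}\in\mathcal{F}\cap(0,\tau]}\|\frac{d}{dt}\mathfrak{C}_{\mathfrak{f}}(t)\|$ and $\sum_{\mathfrak{f}\in\mathcal{F}\cap(0,\tau]}\Lambda_\delta(\frac{d}{dt}\mathfrak{C}_{\mathfrak{f}})$ are all at most $Ke^{\gamma\tau}$. Let $\gamma_1=\frac1{\tau_1}\log\bigl(\sum_{j=1}^N\sup_t\|D_j(t)\|\bigr)$, and $\gamma_2=\max\{\gamma,\gamma_1\}$. The operator $\Lambda(p)$.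 For $k\in\mathbb{N}$ let $H_{[k]}$ be the bounded operator on $L^2([0,T],\mathbb{C}^d)$ given, for a.e. $t\in[0,T]$, by $$H_{[k]}v(t)=-\int_{[0,T]}d_\tau X(kT+t,\tau)\,v(\tau)=-\sum_{\mathfrak{f}\in\mathcal{F},\ 0\le kT+t-\mathfrak{f}<T}\mathfrak{C}_{\mathfrak{f}}(kT+t)\,v(kT+t-\mathfrak{f}),$$ and let $\mathcal{L}\{\overline{H}\}(z)=\sum_{k\ge0}H_{[k]}z^{-k}$, which converges in operator norm for $|z|>a$. For $p\in\mathbb{C}$ let $E_p$ be the operator of multiplication by $t\mapsto e^{pt}$ on $L^2([0,T],\mathbb{C}^d)$. For $\Re(p)>\log a/T$ define $\Lambda(p)=E_{-p}\circ\mathcal{L}\{\overline{H}\}(e^{pT})\circ E_p$. The operator $R(p)$. It is the bounded operator on $\ell^2(\mathbb{Z},\mathbb{C}^d)$ with block matrix $$R(p)=I_\infty-\Bigl(\sum_{j=1}^N e^{-(p-i\ell\omega)\tau_j}\check D_j(\ell-k)\Bigr)_{(k,\ell)\in\mathbb{Z}^2},\qquad \check D_j(k)=\frac1T\int_0^TD_j(t)e^{-ik\omega t}\,dt,$$ with $k$ the block-row and $\ell$ the block-column index, rows and columns being ordered by increasing index; it is invertible for $\Re(p)>\gamma_2$. The operator $R(p)^{-1}$ is regarded as an operator on $L^2([0,T],\mathbb{C}^d)$ by identifying $\phi(t)=\sum_{k\in\mathbb{Z}}a_ke^{i\omega kt}$ with the sequence $(\dots,a_2,a_1,a_0,a_{-1},a_{-2},\dots)\in\ell^2(\mathbb{Z},\mathbb{C}^d)$,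 i.e. the entry of index $-k$ is the Fourier coefficient $a_k$. *)

(* Defs.v *)
From HB Require Import structures.
From mathcomp Require Import all_boot all_order all_algebra.
From mathcomp Require Import all_classical all_reals all_analysis.
From mathcomp.real_closed Require Export complex.

Set Implicit Arguments.
Unset Strict Implicit.
Unset Printing Implicit Defensive.

Import Order.TTheory GRing.Theory Num.Theory.
Import numFieldNormedType.Exports.

Local Open Scope classical_set_scope.
Local Open Scope ring_scope.
Local Open Scope complex_scope.

Local Notation Re := complex.Re.
Local Notation Im := complex.Im.

Section complex_valued_functions.
Variable R : realType.
Implicit Types (T delta t s : R) (m n d : nat).

Definition cexp (z : R[i]) : R[i] :=
  (expR (Re z))%:C * (cos (Im z) +i* sin (Im z)).

Definition cintegral (a b : R) (f : R -> R[i]) : R[i] :=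
  (\int[@lebesgue_measure R]_(t in `[a, b]) Re (f t)) +i*
  (\int[@lebesgue_measure R]_(t in `[a, b]) Im (f t)).

Definition vnorm d (x : 'cV[R[i]]_d) : R :=
  Num.sqrt (\sum_i (Re (x i 0) ^+ 2 + Im (x i 0) ^+ 2)).

(* Operator norm induced by the Hermitian norm of C^d. *)
Definition mxnorm d (A : 'M[R[i]]_d) : R :=
  sup [set vnorm (A *m x) | x in [set x : 'cV[R[i]]_d | vnorm x <= 1]].

Definition Tperiodic (V : Type) T (g : R -> V) := forall t, g (t + T) = g t.

Definition mxderivable m n (g : R -> 'M[R[i]]_(m, n)) := forall i j t,
  derivable (fun u => Re (g u i j)) t 1 /\ derivable (fun u => Im (g u i j)) t 1.

Definition mxderive m n (g : R -> 'M[R[i]]_(m, n)) (t : R) : 'M[R[i]]_(m, n) :=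
  \matrix_(i, j) (derive1 (fun u => Re (g u i j)) t +i* derive1 (fun u => Im (g u i j)) t).

Definition holder d delta (g : R -> 'M[R[i]]_d) := exists L : R,
  forall t s, mxnorm (g t - g s) <= L * `|t - s| `^ delta.

(* The real-valued supremum is only meaningful for Hoelder g. *)
Definition holder_const d delta (g : R -> 'M[R[i]]_d) : R :=
  sup [set mxnorm (g ts.1 - g ts.2) / `|ts.1 - ts.2| `^ delta
      | ts in [set ts : R * R | ts.1 != ts.2]].

Definition C1holder d delta (g : R -> 'M[R[i]]_d) :=
  mxderivable g /\ holder delta (mxderive g).

Definition omega T : R := 2 * pi / T.

Definition fourier m n T (g : R -> 'M[R[i]]_(m, n)) (k : int) :
    'M[R[i]]_(m, n) :=
  (T^-1)%:C *: \matrix_(i, j) cintegral 0 T (fun t =>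
    cexp (0 -i* (k%:~R * omega T * t)) * g t i j).

End complex_valued_functions.

(* Elements of L^2([a, b], C^d) are represented by functions on the real line  *)
(* that are Borel measurable on [a, b]; equality in L^2 is equality almost     *)
(* everywhere on [a, b], and operators act on representatives.                 *)
Section L2_l2.
Variable R : realType.
Variable d : nat.
Local Notation mu := (@lebesgue_measure R).

Definition L2norm (a b : R) (f : R -> 'cV[R[i]]_d) : \bar R :=
  ((\int[mu]_(t in `[a, b]) ((vnorm (f t)) ^+ 2)%:E) `^ (2^-1))%E.

Definition inL2 (a b : R) (f : R -> 'cV[R[i]]_d) : Prop :=
  (forall i, measurable_fun `[a, b] (fun t => Re (f t i 0)) /\
             measurable_fun `[a, b] (fun t => Im (f t i 0))) /\
  (L2norm a b f < +oo)%E.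

Definition aeeq (a b : R) (f g : R -> 'cV[R[i]]_d) : Prop :=
  {ae mu, forall t, a <= t <= b -> f t = g t}.

Definition operL2 := (R -> 'cV[R[i]]_d) -> (R -> 'cV[R[i]]_d).

Definition opnorm_cvg (a b : R) (A : nat -> operL2) (L : operL2) : Prop :=
  (forall n phi, inL2 a b phi -> inL2 a b (A n phi)) /\
  (forall phi, inL2 a b phi -> inL2 a b (L phi)) /\
  forall eps : R, 0 < eps -> \forall n \near \oo, forall phi, inL2 a b phi ->
    (L2norm a b (fun t => A n phi t - L phi t)%R <= eps%:E * L2norm a b phi)%E.

Definition inl2 (x : int -> 'cV[R[i]]_d) : Prop :=
  (\esum_(k in [set: int]) ((vnorm (x k)) ^+ 2)%:E < +oo)%E.

(* Sum over all integers, as the limit of the symmetric partial sums. *)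
Definition zsum (u : int -> R) : R :=
  limn (fun n : nat => \sum_(k < (2 * n).+1) u (k%:Z - n%:Z)).

Definition vzsum (u : int -> 'cV[R[i]]_d) : 'cV[R[i]]_d :=
  \col_i (zsum (fun k => Re (u k i 0)) +i* zsum (fun k => Im (u k i 0))).

Definition operl2 := (int -> 'cV[R[i]]_d) -> (int -> 'cV[R[i]]_d).

Definition l2_inverse (A B : operl2) : Prop := forall x, inl2 x ->
  [/\ inl2 (A x), inl2 (B x), A (B x) = x & B (A x) = x].

(* The entry of index -k is the Fourier coefficient of index k. *)
Definition L2_to_l2 (T : R) (phi : R -> 'cV[R[i]]_d) : int -> 'cV[R[i]]_d :=
  fun k => fourier T phi (- k).

Definition l2_to_L2 (T : R) (x : int -> 'cV[R[i]]_d) : R -> 'cV[R[i]]_d :=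
  xget (fun=> 0) [set psi | inL2 0 T psi /\ L2_to_l2 T psi = x].

End L2_l2.

(* The N delays of the text are indexed by 'I_N.+1: tau_1 is [tau ord0] and    *)
(* tau_N is [tau ord_max].                                                     *)
Section difference_delay_system.
Variable R : realType.
Variables d N : nat.
Variable T : R.
Variable tau : 'I_N.+1 -> R.
Variable D : 'I_N.+1 -> R -> 'M[R[i]]_d.
Local Notation mu := (@lebesgue_measure R).

Definition is_solution (s : R) (phi y : R -> 'cV[R[i]]_d) : Prop :=
  [/\ forall b, inL2 (s - tau ord_max) b y,
      aeeq (- tau ord_max) 0 (fun theta => y (s + theta)) phi &
      {ae mu, forall t, s <= t -> y t = \sum_j D j t *m y (t - tau j)}].

(* [fun theta => y (t + theta)] is U_2(t, s) phi. *)
Definition exp_stable : Prop := exists gamma0 K0 : R,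
  [/\ 0 < gamma0, 0 < K0 &
  forall (s t : R) (phi y : R -> 'cV[R[i]]_d), s <= t ->
    inL2 (- tau ord_max) 0 phi -> is_solution s phi y ->
    (L2norm (- tau ord_max) 0 (fun theta => y (t + theta)%R) <=
     (K0 * expR (- gamma0 * (t - s)))%:E * L2norm (- tau ord_max) 0 phi)%E].

Definition fundamental_solution (X : R -> R -> 'M[R[i]]_d) : Prop :=
  forall t s, (t < s -> X t s = 0) /\
    (s <= t -> X t s = 1%:M + \sum_j D j t *m X (t - tau j) s).

Definition delay_sums : set R :=
  [set f | exists n : 'I_N.+1 -> nat, f = \sum_l (n l)%:R * tau l].

(* The index sets of the finitely supported sums below are finite, since only  *)
(* finitely many elements of [delay_sums] are in a bounded interval.           *)
Definition fundamental_coefs (delta : R) (X : R -> R -> 'M[R[i]]_d)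
    (C : R -> R -> 'M[R[i]]_d) : Prop :=
  (forall f, delay_sums f -> Tperiodic T (C f) /\ C1holder delta (C f)) /\
  forall t s, s <= t ->
    X t s = - \sum_(f \in delay_sums `&` `[0, t - s]) C f t.

Definition coefs_bound (delta : R) (C : R -> R -> 'M[R[i]]_d) (K gamma : R) :
    Prop := forall x t, 0 <= x ->
  [/\ \sum_(f \in delay_sums `&` `]0, x]) mxnorm (C f t)
        <= K * expR (gamma * x),
      \sum_(f \in delay_sums `&` `]0, x]) mxnorm (mxderive (C f) t)
        <= K * expR (gamma * x) &
      \sum_(f \in delay_sums `&` `]0, x]) holder_const delta (mxderive (C f))
        <= K * expR (gamma * x)].

(* When all D_j vanish the logarithm should be -oo whereas [ln 0 = 0]; this    *)
(* does not change [gamma2], because gamma is nonnegative.                     *)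
Definition gamma1 : R :=
  (tau ord0)^-1 * ln (\sum_j sup (range (fun t => mxnorm (D j t)))).

Definition gamma2 (gamma : R) : R := Num.max gamma gamma1.

(* As a function of its second argument, X(kT + t, .) is a step function with  *)
(* jumps at the points kT + t - f, so the Stieltjes integral                   *)
(* - int_[0,T] d_tau X(kT + t, tau) v(tau) is the finite sum below.            *)
Definition Hop (C : R -> R -> 'M[R[i]]_d) (k : nat) : operL2 R d :=
  fun v t => - \sum_(f \in delay_sums `&` [set f | 0 <= k%:R * T + t - f < T])
    C f (k%:R * T + t) *m v (k%:R * T + t - f).

Definition laplace_partial (C : R -> R -> 'M[R[i]]_d) (z : R[i]) (n : nat) :
    operL2 R d :=
  fun v t => \sum_(k < n) z ^- k *: Hop C k v t.

Definition laplace (C : R -> R -> 'M[R[i]]_d) (z : R[i]) : operL2 R d :=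
  xget (fun _ => fun=> 0) [set L | opnorm_cvg 0 T (laplace_partial C z) L].

Definition Emul (p : R[i]) : operL2 R d := fun v t => cexp (p * t%:C) *: v t.

Definition Lambda (C : R -> R -> 'M[R[i]]_d) (p : R[i]) : operL2 R d :=
  Emul (- p) \o laplace C (cexp (p * T%:C)) \o Emul p.

Definition Rblock (p : R[i]) (k l : int) : 'M[R[i]]_d :=
  \sum_j cexp (- ((p - (0 +i* (l%:~R * omega T))) * (tau j)%:C)) *:
    fourier T (D j) (l - k).

Definition Rop (p : R[i]) : operl2 R d :=
  fun x k => x k - vzsum (fun l => Rblock p k l *m x l).

Definition Rinv (p : R[i]) : operl2 R d :=
  xget (fun _ => fun=> 0) [set B | l2_inverse (Rop p) B].

Definition Rinv_L2 (p : R[i]) : operL2 R d :=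
  fun phi => l2_to_L2 T (Rinv p (L2_to_l2 T phi)).

End difference_delay_system.

(* Main.v *)
Require Import Defs.
From HB Require Import structures.
From mathcomp Require Import all_boot all_order all_algebra finmap.
From mathcomp Require Import all_classical all_reals all_analysis.
From mathcomp Require Import measurable_realfun zify ring lra.

(** The statement compares two descriptions of the solution [psi] of one
    periodic equation. Let [S] be the operator
      [v |-> v(t) - sum_j e^(- p tau_j) D_j(t) v(t - tau_j)]
    on [T]-periodic functions that are square integrable over a period.

    - [R(p)] is [S] in Fourier coordinates ([Rop_fourier]): translation by
      [tau_j] multiplies the coefficient at [l] by an exponential, and
      multiplication by [D_j] is convolution with the coefficients of [D_j].
      Square integrable functions modulo null sets correspond bijectively to
      square summable sequences ([riesz_fischer_vector], [fourier_inj]), so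
      inverting [R(p)] amounts to solving [S psi = phi] uniquely.

    - Uniqueness. As [Re p] exceeds [gamma_1], there is room between the sum of
      the suprema of the norms of the [D_j] and [e^(Re p tau_1)]. Hence there
      are [beta > 0] and weights [a_j] bounding the norms of
      [e^(- p tau_j) D_j(t)] such that the sum of the [a_j e^(beta tau_j)] is
      less than 1. Translations being isometric over a period, the delayed part
      of [S] is a strict contraction ([Sop_inj]).

    - Existence, by means of [Lambda(p)]. The equation of the fundamental
      solution gives the recursion
      [C_f(t) = sum_j D_j(t) C_(f - tau_j)(t - tau_j)] for [f] nonzero
      ([coef_recursion]). Consequently the functions [H_k v] are the
      restrictions to the successive periods of the single solution [h],
      vanishing at negative times, of [h(s) = sum_j D_j(s) h(s - tau_j)] with
      the source [v] added on the first period ([causal_sum_recursion]). For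
      [v = E_p phi], the function [z(s) = e^(- p s) h(s)] satisfies the same
      equation with the coefficients of [S] and the source [phi]. Its energy
      with the weight [e^(2 beta s)] is finite, so its norm over the [k]-th
      period decreases like [e^(- beta k T)] ([energy_decay]). Therefore the
      Laplace series converges in operator norm ([laplace_cvg]),
      [psi = Lambda(p) phi] is the sum of the [z(k T + t)], and adding up the
      equation of [z] over all periods yields [S psi = phi] ([Sop_Lambda]).

    The Fourier analysis rests on three facts about one period. Removing
    Fourier components removes their energies ([pythagoras], [bessel]). Mean
    square Cauchy sequences converge ([L2_complete]). A function orthogonal to
    all exponentials vanishes almost everywhere ([fourier_uniqueness]): it is
    orthogonal to the trigonometric polynomials [(1 - y^n)^(2^n)], where
    [y] is a trigonometric polynomial that is less than 1/2 on ]0, b[ and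
    greater than 1/2 on ]b, T[; these tend to the indicator of [0, b], so every
    primitive of the function is zero. *)

Set Implicit Arguments.
Unset Strict Implicit.
Unset Printing Implicit Defensive.

Import Order.TTheory GRing.Theory Num.Theory.
Import numFieldNormedType.Exports.

Local Open Scope classical_set_scope.
Local Open Scope ring_scope.
Local Open Scope complex_scope.

Local Notation Re := complex.Re.
Local Notation Im := complex.Im.

(** * Complex numbers and their exponential *)

Section complex_numbers.
Variable R : realType.
Implicit Types (x y z : R[i]).

Definition absq z : R := Re z ^+ 2 + Im z ^+ 2.

Lemma cReD x y : Re (x + y) = Re x + Re y. Proof. by case: x; case: y. Qed.
Lemma cImD x y : Im (x + y) = Im x + Im y. Proof. by case: x; case: y. Qed.
Lemma cReN x : Re (- x) = - Re x. Proof. by case: x. Qed.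
Lemma cImN x : Im (- x) = - Im x. Proof. by case: x. Qed.
Lemma cReM x y : Re (x * y) = Re x * Re y - Im x * Im y.
Proof. by case: x; case: y. Qed.
Lemma cImM x y : Im (x * y) = Re x * Im y + Im x * Re y.
Proof. by case: x; case: y. Qed.

Lemma complex_eqP x y : Re x = Re y -> Im x = Im y -> x = y.
Proof. by case: x; case: y => a b c d /= -> ->. Qed.

Lemma Re_sum (I : Type) (r : seq I) (P : pred I) (F : I -> R[i]) :
  Re (\sum_(i <- r | P i) F i) = \sum_(i <- r | P i) Re (F i).
Proof. by elim/big_rec2: _ => //= i a b _ <-; rewrite cReD. Qed.

Lemma Im_sum (I : Type) (r : seq I) (P : pred I) (F : I -> R[i]) :
  Im (\sum_(i <- r | P i) F i) = \sum_(i <- r | P i) Im (F i).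
Proof. by elim/big_rec2: _ => //= i a b _ <-; rewrite cImD. Qed.

Lemma absq_ge0 z : 0 <= absq z.
Proof. by rewrite addr_ge0 ?sqr_ge0. Qed.

Lemma absq0 : absq 0 = 0.
Proof. by rewrite /absq /= expr0n /= addr0. Qed.

Lemma absqN z : absq (- z) = absq z.
Proof. by rewrite /absq cReN cImN !sqrrN. Qed.

Lemma absqM x y : absq (x * y) = absq x * absq y.
Proof. by rewrite /absq cReM cImM; ring. Qed.

Lemma absqD x y : absq (x + y) <= 2 * absq x + 2 * absq y.
Proof.
have := sqr_ge0 (Re x - Re y); have := sqr_ge0 (Im x - Im y).
by rewrite /absq cReD cImD; nra.
Qed.

Lemma absq_eq0 z : absq z = 0 -> z = 0.
Proof.
move=> /eqP; rewrite paddr_eq0 ?sqr_ge0// !sqrf_eq0 => /andP[/eqP a /eqP b].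
exact: complex_eqP.
Qed.

Lemma Re_sqr_le z : Re z ^+ 2 <= absq z.
Proof. by rewrite lerDl sqr_ge0. Qed.

Lemma Im_sqr_le z : Im z ^+ 2 <= absq z.
Proof. by rewrite lerDr sqr_ge0. Qed.

Lemma cexpD x y : cexp (x + y) = cexp x * cexp y.
Proof.
rewrite /cexp; case: x y => [a b] [c d] /=.
by apply: complex_eqP; rewrite /= expRD cosD sinD; ring.
Qed.

Lemma cexp0 : cexp 0 = 1 :> R[i].
Proof.
by apply: complex_eqP; rewrite /cexp /= expR0 cos0 sin0; ring.
Qed.

Lemma cexpN z : cexp z * cexp (- z) = 1.
Proof. by rewrite -cexpD subrr cexp0. Qed.

Lemma cexpX z n : cexp z ^+ n = cexp (n%:R * z).
Proof.
elim: n => [|n IH]; first by rewrite mul0r cexp0.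
by rewrite exprS IH -cexpD -natr1; congr cexp; ring.
Qed.

Lemma absq_cexp z : absq (cexp z) = expR (2 * Re z).
Proof.
rewrite /absq /cexp /= mulr2n mulrDl mul1r expRD.
have := cos2Dsin2 (Im z); set c := cos _; set s := sin _ => cs.
rewrite -[RHS]mulr1 -cs; ring.
Qed.

Lemma cexp_imag (a : R) : cexp (0 +i* a) = cos a +i* sin a.
Proof. by rewrite /cexp /= expR0 mul1r. Qed.

End complex_numbers.

(** * Square integrable complex functions *)

Section complex_functions.
Variable R : realType.
Local Notation mu := (@lebesgue_measure R).
Implicit Types (D : set R) (f g : R -> R[i]).

Lemma aeS (P Q : R -> Prop) : (forall t, P t -> Q t) ->
  {ae mu, forall t, P t} -> {ae mu, forall t, Q t}.
Proof. by move=> PQ; exact: (@filterS _ _ (ae_filter_ringOfSetsType mu)). Qed.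

Lemma aeI (P Q : R -> Prop) : {ae mu, forall t, P t} ->
  {ae mu, forall t, Q t} -> {ae mu, forall t, P t /\ Q t}.
Proof.
move=> aP aQ; have F := ae_filter_ringOfSetsType mu.
exact: (@filterI _ _ F _ _ aP aQ).
Qed.

Lemma ae_forall (I : finType) (P : I -> R -> Prop) :
  (forall i, {ae mu, forall t, P i t}) -> {ae mu, forall t, forall i, P i t}.
Proof.
move=> aP; have : {ae mu, forall t, forall i, i \in enum I -> P i t}.
  elim: (enum I) => [|i s IH]; first exact: aeW.
  apply: aeS (aeI (aP i) IH) => t [Pi Ps] j; rewrite inE => /predU1P[->//|].
  exact: Ps.
by apply: aeS => t Pt i; apply: Pt; rewrite mem_enum.
Qed.

Definition cmeas D f :=
  measurable_fun D (fun t => Re (f t)) /\ measurable_fun D (fun t => Im (f t)).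

Lemma cmeas_eq D f g : {in D, f =1 g} -> cmeas D f -> cmeas D g.
Proof.
move=> fg [mf1 mf2]; split.
  by apply: eq_measurable_fun mf1 => t tD; rewrite fg.
by apply: eq_measurable_fun mf2 => t tD; rewrite fg.
Qed.

Lemma cmeas_cst D z : cmeas D (fun=> z).
Proof. by split; exact: measurable_cst. Qed.

Lemma cmeasD D f g : cmeas D f -> cmeas D g -> cmeas D (fun t => f t + g t).
Proof.
move=> [f1 f2] [g1 g2]; split.
  under eq_fun do rewrite cReD; exact: measurable_funD.
under eq_fun do rewrite cImD; exact: measurable_funD.
Qed.

Lemma cmeasM D f g : cmeas D f -> cmeas D g -> cmeas D (fun t => f t * g t).
Proof.
move=> [f1 f2] [g1 g2]; split.
  under eq_fun do rewrite cReM.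
  by apply: measurable_funB; exact: measurable_funM.
under eq_fun do rewrite cImM.
by apply: measurable_funD; exact: measurable_funM.
Qed.

Lemma cmeasN D f : cmeas D f -> cmeas D (fun t => - f t).
Proof.
move=> mf; apply: cmeas_eq (cmeasM (cmeas_cst D (-1)) mf) => t _.
by rewrite mulN1r.
Qed.

Lemma cmeasB D f g : cmeas D f -> cmeas D g -> cmeas D (fun t => f t - g t).
Proof. by move=> mf mg; apply: cmeasD => //; exact: cmeasN. Qed.

Lemma cmeas_sum D (I : Type) (r : seq I) (P : pred I) (F : I -> R -> R[i]) :
  (forall i, P i -> cmeas D (F i)) ->
  cmeas D (fun t => \sum_(i <- r | P i) F i t).
Proof.
move=> mF; elim: r => [|i r IH].
  under eq_fun do rewrite big_nil; exact: cmeas_cst.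
under eq_fun do rewrite big_cons; case: (boolP (P i)) => Pi //.
exact: cmeasD (mF _ Pi) IH.
Qed.

Lemma cmeasS D E f : measurable D -> E `<=` D -> cmeas D f -> cmeas E f.
Proof.
by move=> mD ED [f1 f2]; split; [move: f1|move: f2]; exact: measurable_funS.
Qed.

Lemma measurable_absq D f :
  cmeas D f -> measurable_fun D (fun t => absq (f t)).
Proof.
move=> [f1 f2]; rewrite /absq.
by apply: measurable_funD; exact: measurable_funX.
Qed.

Lemma measurable_Eabsq D f :
  cmeas D f -> measurable_fun D (fun t => (absq (f t))%:E).
Proof. by move=> mf; apply/measurable_EFinP; exact: measurable_absq. Qed.

(** Squared norms with values in the extended reals: no integrability has to
    be known beforehand, and [nsqD_le] stands in for the triangle inequality. *)
Definition nsq D f : \bar R := (\int[mu]_(t in D) (absq (f t))%:E)%E.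

Lemma nsq_ge0 D f : (0 <= nsq D f)%E.
Proof. by apply: integral_ge0 => t _; rewrite lee_fin absq_ge0. Qed.
Hint Resolve nsq_ge0 : core.

Lemma eq_nsq D f g : {in D, f =1 g} -> nsq D f = nsq D g.
Proof. by move=> fg; apply: eq_integral => t tD; rewrite fg. Qed.

Lemma nsqN D f : nsq D (fun t => - f t) = nsq D f.
Proof. by apply: eq_integral => t tD; rewrite absqN. Qed.

Lemma nsqM_le D f g (B : R) : measurable D -> cmeas D f -> cmeas D g ->
  0 <= B -> (forall t, D t -> absq (g t) <= B) ->
  (nsq D (fun t => g t * f t)%R <= B%:E * nsq D f)%E.
Proof.
move=> mD mf mg B0 gB; rewrite /nsq -ge0_integralZl_EFin//; last 2 first.
  - by move=> t _; rewrite lee_fin absq_ge0.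
  - exact: measurable_Eabsq.
apply: ge0_le_integral => //.
- by move=> t _; rewrite lee_fin absq_ge0.
- by apply: measurable_Eabsq; exact: cmeasM.
- by apply/measurable_EFinP/measurable_funM => //; exact: measurable_absq.
- by move=> t Dt; rewrite lee_fin absqM ler_wpM2r ?absq_ge0// gB.
Qed.

Lemma nsqD_le D f g : measurable D -> cmeas D f -> cmeas D g ->
  (nsq D (fun t => f t + g t)%R <= 2%:E * nsq D f + 2%:E * nsq D g)%E.
Proof.
move=> mD mf mg; have m2 h : cmeas D h ->
    measurable_fun D (fun t => (2%:E * (absq (h t))%:E)%E).
  by move=> mh; apply/measurable_EFinP/measurable_funM => //;
    exact: measurable_absq.
have p2 h t : D t -> (0 <= 2%:E * (absq (h t))%:E)%E.
  by rewrite lee_fin mulr_ge0 ?absq_ge0.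
rewrite /nsq -!ge0_integralZl_EFin//;
  do ?[exact: measurable_Eabsq | by move=> t _; rewrite lee_fin absq_ge0].
rewrite -ge0_integralD//; do ?[exact: m2|exact: p2].
apply: ge0_le_integral => //.
- by move=> t _; rewrite lee_fin absq_ge0.
- by apply: measurable_Eabsq; exact: cmeasD.
- by apply: emeasurable_funD; exact: m2.
- by move=> t Dt; rewrite lee_fin absqD.
Qed.

Definition sqint D f := cmeas D f /\ (nsq D f < +oo)%E.

Lemma sqint_eq D f g : {in D, f =1 g} -> sqint D f -> sqint D g.
Proof.
by move=> fg [mf nf]; split; [exact: cmeas_eq mf|rewrite -(eq_nsq fg)].
Qed.

Lemma sqintM D f g (B : R) : measurable D -> cmeas D g ->
  (forall t, D t -> absq (g t) <= B) -> sqint D f ->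
  sqint D (fun t => g t * f t).
Proof.
move=> mD mg gB [mf nf]; split; first exact: cmeasM.
have gB' t : D t -> absq (g t) <= Num.max B 0 by move=> Dt; rewrite le_max gB.
apply: (le_lt_trans (nsqM_le mD mf mg _ gB')); first by rewrite le_max lexx orbT.
by rewrite lte_mul_pinfty// lee_fin le_max lexx orbT.
Qed.

Lemma sqintZ D f z : measurable D -> sqint D f -> sqint D (fun t => z * f t).
Proof. by move=> mD; apply: sqintM => //; exact: cmeas_cst. Qed.

Lemma sqintN D f : measurable D -> sqint D f -> sqint D (fun t => - f t).
Proof. by move=> mD [mf nf]; split; [exact: cmeasN|rewrite nsqN]. Qed.

Lemma sqintD D f g : measurable D -> sqint D f -> sqint D g ->
  sqint D (fun t => f t + g t).
Proof.
move=> mD [mf nf] [mg ng]; split; first exact: cmeasD.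
apply: (le_lt_trans (nsqD_le mD mf mg)).
by apply: lte_add_pinfty; rewrite lte_mul_pinfty.
Qed.

Lemma sqintB D f g : measurable D -> sqint D f -> sqint D g ->
  sqint D (fun t => f t - g t).
Proof. by move=> mD sf sg; apply: sqintD => //; exact: sqintN. Qed.

Lemma sqint0 D : sqint D (fun=> 0).
Proof.
split; first exact: cmeas_cst.
rewrite /nsq; under eq_integral do rewrite absq0; by rewrite integral0.
Qed.

Lemma sqint_sum D (I : Type) (r : seq I) (P : pred I) (F : I -> R -> R[i]) :
  measurable D -> (forall i, P i -> sqint D (F i)) ->
  sqint D (fun t => \sum_(i <- r | P i) F i t).
Proof.
move=> mD mF; elim: r => [|i r IH].
  under eq_fun do rewrite big_nil; exact: sqint0.
under eq_fun do rewrite big_cons; case: (boolP (P i)) => Pi //.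
exact: sqintD (mF _ Pi) IH.
Qed.

Lemma nsqD_fin D f : sqint D f -> nsq D f \is a fin_num.
Proof. by move=> [_ nf]; rewrite ge0_fin_numE. Qed.

Lemma nsq0_ae D f : measurable D -> cmeas D f -> nsq D f = 0%E ->
  {ae mu, forall t, D t -> f t = 0}.
Proof.
move=> mD mf n0; have : (\int[mu]_(t in D) `|(absq (f t))%:E| = 0)%E.
  by under eq_integral do rewrite gee0_abs ?lee_fin ?absq_ge0//.
move/ae_eq_integral_abs => /(_ mD (measurable_Eabsq mf)).
apply: aeS => t ft Dt; apply: absq_eq0.
by have := ft Dt => -[].
Qed.

End complex_functions.
#[global] Hint Resolve nsq_ge0 : core.

(** * Fourier coefficients *)

Section fourier_coefficients.
Variable R : realType.
Variable T : R.
Hypothesis T0 : 0 < T.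
Local Notation mu := (@lebesgue_measure R).
Local Notation D := (`[0%R, T]%classic : set R).
Implicit Types (f g : R -> R[i]) (k l : int).

Lemma period_itvE : mu D = T%:E.
Proof. by rewrite lebesgue_measure_itv/= lte_fin T0 -EFinB subr0. Qed.

Lemma period_itv_lty : (mu D < +oo)%E.
Proof. by rewrite period_itvE ltry. Qed.

Definition cintble f := mu.-integrable D (EFin \o (fun t => Re (f t))) /\
  mu.-integrable D (EFin \o (fun t => Im (f t))).

(** On an interval of finite length, [`|u| <= 1 + u ^+ 2] suffices. *)
Lemma sqint_integrable f : sqint D f -> cintble f.
Proof.
move=> [[mf1 mf2] nf].
have i1 : mu.-integrable D (EFin \o (fun t => 1 + absq (f t))).
  have i2 : mu.-integrable D (EFin \o (fun t => absq (f t))).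
    apply/integrableP; split; first exact: measurable_Eabsq.
    by under eq_integral do rewrite /= ger0_norm ?absq_ge0//.
  have i3 : mu.-integrable D (EFin \o cst 1%R).
    apply: measurable_bounded_integrable => //; first exact: period_itv_lty.
    exact: bounded_cst.
  by apply: eq_integrable (integrableD _ i3 i2).
have le u : u ^+ 2 <= 1 + u ^+ 2 :> R by rewrite lerDr.
have lea (u v : R) : u ^+ 2 <= v -> `|u| <= 1 + v.
  move=> uv; have := sqr_ge0 (`|u| - 1); have := normr_ge0 u.
  by rewrite sqrrB1 real_normK ?num_real//; nra.
split; apply: le_integrable i1 => //; do ?exact/measurable_EFinP.
- move=> t _ /=; rewrite lee_fin (le_trans (lea _ _ (Re_sqr_le _)))//.
  exact: ler_norm.
- move=> t _ /=; rewrite lee_fin (le_trans (lea _ _ (Im_sqr_le _)))//.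
  exact: ler_norm.
Qed.

Lemma Re_cintegral f :
  Re (cintegral 0 T f) = \int[mu]_(t in D) Re (f t).
Proof. by []. Qed.

Lemma Im_cintegral f :
  Im (cintegral 0 T f) = \int[mu]_(t in D) Im (f t).
Proof. by []. Qed.

Lemma cintegralD f g : cintble f -> cintble g ->
  cintegral 0 T (fun t => f t + g t) = cintegral 0 T f + cintegral 0 T g.
Proof.
move=> [f1 f2] [g1 g2]; apply: complex_eqP; rewrite ?cReD ?cImD /=.
  under eq_Rintegral do rewrite cReD; exact: RintegralD.
under eq_Rintegral do rewrite cImD; exact: RintegralD.
Qed.

Lemma cintegralZ f z : cintble f ->
  cintegral 0 T (fun t => z * f t) = z * cintegral 0 T f.
Proof.
move=> [f1 f2]; have iZ r (u : R -> R) : mu.-integrable D (EFin \o u) ->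
    mu.-integrable D (EFin \o (fun t => r * u t)).
  by move=> iu; apply: eq_integrable (integrableZl _ r iu).
apply: complex_eqP; rewrite ?cReM ?cImM /=.
  under eq_Rintegral do rewrite cReM.
  by rewrite RintegralB ?RintegralZl//; exact: iZ.
under eq_Rintegral do rewrite cImM.
by rewrite RintegralD ?RintegralZl//; exact: iZ.
Qed.

Lemma eq_cintegral f g : {in D, f =1 g} -> cintegral 0 T f = cintegral 0 T g.
Proof.
move=> fg; apply: complex_eqP => /=.
  by apply: eq_Rintegral => t tD; rewrite fg.
by apply: eq_Rintegral => t tD; rewrite fg.
Qed.

Lemma ae_eq_cintegral f g : cmeas D f -> cmeas D g ->
  {ae mu, forall t, D t -> f t = g t} -> cintegral 0 T f = cintegral 0 T g.
Proof.
move=> [f1 f2] [g1 g2] fg; apply: complex_eqP => /=; congr fine;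
  apply: ae_eq_integral => //; do ?exact/measurable_EFinP;
  by apply: aeS fg => t ft Dt; rewrite ft.
Qed.

Definition cis k (t : R) : R[i] := cexp (0 +i* (k%:~R * omega T * t)).
Arguments cis : simpl never.
Definition fcoef f k : R[i] :=
  (T^-1)%:C * cintegral 0 T (fun t => cis (- k) t * f t).

Lemma cisE k t :
  cis k t = cos (k%:~R * omega T * t) +i* sin (k%:~R * omega T * t).
Proof. by rewrite /cis cexp_imag. Qed.

Lemma fcoefE f k : fcoef f k = (T^-1)%:C *
  cintegral 0 T (fun t => cexp (0 -i* (k%:~R * omega T * t)) * f t).
Proof.
by congr (_ * _); apply: eq_cintegral => t _; rewrite /cis intrN !mulNr.
Qed.

Lemma cisD k l t : cis (k + l) t = cis k t * cis l t.
Proof.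
rewrite -cexpD; congr cexp; apply: complex_eqP => /=; first by rewrite addr0.
by rewrite intrD !mulrDl.
Qed.

Lemma cis0 t : cis 0 t = 1.
Proof. by rewrite cisE !mul0r cos0 sin0. Qed.

Lemma cis_shift k t s : cis k (t + s) = cis k t * cis k s.
Proof.
rewrite -cexpD; congr cexp; apply: complex_eqP => /=; first by rewrite addr0.
by rewrite mulrDr.
Qed.

Lemma absq_cis k t : absq (cis k t) = 1.
Proof. by rewrite cisE /absq /= cos2Dsin2. Qed.

Lemma cisT k : cis k T = 1.
Proof.
have H (n : nat) : cis n T = 1.
  rewrite cisE /omega; have -> : n%:~R * (2 * pi / T) * T = 0 + pi *+ 2 *+ n :> R.
    rewrite add0r -mulrnA -[RHS]mulr_natr natrM -pmulrn; field.
    exact: lt0r_neq0.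
  by rewrite (periodicn (@cosD2pi R)) (periodicn (@sinD2pi R)) cos0 sin0.
case: k => n; first exact: H.
rewrite NegzE; have := cisD (- n.+1%:Z) n.+1 T.
by rewrite H mulr1 addNr cis0 => <-.
Qed.

Lemma continuous_cis_Re k : continuous (fun t => Re (cis k t)).
Proof.
under [fun t => _]eq_fun do rewrite cisE /=.
move=> t; apply: continuous_comp; last exact: continuous_cos.
exact: mulrl_continuous.
Qed.

Lemma continuous_cis_Im k : continuous (fun t => Im (cis k t)).
Proof.
under [fun t => _]eq_fun do rewrite cisE /=.
move=> t; apply: continuous_comp; last exact: continuous_sin.
exact: mulrl_continuous.
Qed.

Lemma cmeas_cis E k : cmeas E (cis k).
Proof.
split; apply: measurable_funTS; apply: continuous_measurable_fun.
  exact: continuous_cis_Re.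
exact: continuous_cis_Im.
Qed.

Lemma sqint_cst z : sqint D (fun=> z).
Proof.
split; first exact: cmeas_cst.
rewrite /nsq integral_cst//.
by rewrite lte_mul_pinfty ?period_itv_lty// lee_fin absq_ge0.
Qed.

Lemma sqintM_cis f k : sqint D f -> sqint D (fun t => cis k t * f t).
Proof.
move=> sf; apply: (@sqintM _ _ _ _ 1) => //; first exact: cmeas_cis.
by move=> t _; rewrite absq_cis.
Qed.

Lemma sqint_cis k : sqint D (cis k).
Proof.
have := sqintM_cis k (sqint_cst 1).
by apply: sqint_eq => t _; rewrite mulr1.
Qed.

Lemma fcoefD f g k : sqint D f -> sqint D g ->
  fcoef (fun t => f t + g t) k = fcoef f k + fcoef g k.
Proof.
move=> sf sg; rewrite /fcoef.
under [X in cintegral _ _ X]eq_fun do rewrite mulrDr.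
by rewrite cintegralD ?mulrDr//; apply: sqint_integrable; exact: sqintM_cis.
Qed.

Lemma fcoefZ f z k : sqint D f -> fcoef (fun t => z * f t) k = z * fcoef f k.
Proof.
move=> sf; rewrite /fcoef.
under [X in cintegral _ _ X]eq_fun do rewrite mulrCA.
by rewrite cintegralZ 1?mulrCA//; apply: sqint_integrable; exact: sqintM_cis.
Qed.

Lemma fcoefB f g k : sqint D f -> sqint D g ->
  fcoef (fun t => f t - g t) k = fcoef f k - fcoef g k.
Proof.
move=> sf sg.
have -> : (fun t => f t - g t) = (fun t => f t + (- 1) * g t).
  by apply/funext => t; rewrite mulN1r.
rewrite fcoefD//; last exact: sqintZ.
by rewrite fcoefZ// mulN1r.
Qed.

Lemma fcoef_sum (I : Type) (r : seq I) (P : pred I) (F : I -> R -> R[i]) k :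
  (forall i, P i -> sqint D (F i)) ->
  fcoef (fun t => \sum_(i <- r | P i) F i t) k =
  \sum_(i <- r | P i) fcoef (F i) k.
Proof.
move=> mF; elim: r => [|i r IH].
  under [X in fcoef X]eq_fun do rewrite big_nil -(mul0r 0).
  by rewrite fcoefZ ?mul0r ?big_nil//; exact: sqint_cst.
under [X in fcoef X]eq_fun do rewrite big_cons.
rewrite big_cons; case: (boolP (P i)) => Pi //.
by rewrite fcoefD ?IH//; [exact: mF|exact: sqint_sum].
Qed.

Lemma ae_eq_fcoef f g k : cmeas D f -> cmeas D g ->
  {ae mu, forall t, D t -> f t = g t} -> fcoef f k = fcoef g k.
Proof.
move=> mf mg fg; congr (_ * _); apply: ae_eq_cintegral.
- by apply: cmeasM => //; exact: cmeas_cis.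
- by apply: cmeasM => //; exact: cmeas_cis.
- by apply: aeS fg => t ft Dt; rewrite ft.
Qed.

Lemma Rintegral_primitive (F f : R -> R) :
  (forall t : R, is_derive t (1 : R) F (f t)) -> continuous f ->
  \int[mu]_(t in D) f t = F T - F 0.
Proof.
move=> dF cf; rewrite /Rintegral.
have cF t : {for t, continuous F}.
  by apply: differentiable_continuous; apply/derivable1_diffP; case: (dF t).
rewrite (@continuous_FTC2 _ _ F)//.
- exact: continuous_subspaceT.
- split.
  + by move=> t _; case: (dF t).
  + exact/cvg_at_right_filter/cF.
  + exact/cvg_at_left_filter/cF.
- by move=> t _; rewrite derive1E; case: (dF t).
Qed.

Lemma cintegral_cis k : k != 0 -> cintegral 0 T (cis k) = 0.
Proof.
move=> k0; pose w := k%:~R * omega T.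
have w0 : w != 0.
  rewrite mulf_neq0 ?intr_eq0// /omega mulf_neq0 ?invr_eq0 ?lt0r_neq0//.
  by rewrite mulr_gt0 ?pi_gt0.
have := cisT k; rewrite cisE -/w => -[cT sT].
have dw (t : R) : is_derive t (1 : R) (w \*: (id : R -> R)) (w *: (1 : R)).
  exact: is_deriveZ.
apply: complex_eqP; rewrite ?Re_cintegral ?Im_cintegral.
  under eq_Rintegral do rewrite cisE /= -/w.
  have dF (t : R) : is_derive t (1 : R) (fun t => w^-1 * sin (w * t)) (cos (w * t)).
    have := is_deriveZ w^-1 (is_derive1_comp (is_derive_sin (w * t)) (dw t)).
    by move/is_derive_eq; apply; rewrite /GRing.scale /= mulr1; field.
  have cc : continuous (fun t : R => cos (w * t)).
    have := @continuous_cis_Re k.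
    by under [X in continuous X]eq_fun do rewrite cisE /= -/w.
  by rewrite (Rintegral_primitive dF cc) sT !mulr0 sin0 mulr0 subrr.
under eq_Rintegral do rewrite cisE /= -/w.
have dF (t : R) : is_derive t (1 : R) (fun t => - w^-1 * cos (w * t)) (sin (w * t)).
  have := is_deriveZ (- w^-1) (is_derive1_comp (is_derive_cos (w * t)) (dw t)).
  by move/is_derive_eq; apply; rewrite /GRing.scale /= mulr1; field.
have cc : continuous (fun t : R => sin (w * t)).
  have := @continuous_cis_Im k.
  by under [X in continuous X]eq_fun do rewrite cisE /= -/w.
by rewrite (Rintegral_primitive dF cc) cT mulr0 cos0 subrr.
Qed.

Lemma cintegral_cst z : cintegral 0 T (fun=> z) = T%:C * z.
Proof.
have E (r : R) : \int[mu]_(t in D) r = r * T.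
  by rewrite Rintegral_cst// [X in fine X]period_itvE.
by apply: complex_eqP; rewrite ?cReM ?cImM /= E; ring.
Qed.

Lemma fcoef_cis k l : fcoef (cis k) l = (k == l)%:R.
Proof.
rewrite /fcoef; under [X in cintegral _ _ X]eq_fun do rewrite -cisD.
have [->|kl] := eqVneq k l.
  under [X in cintegral _ _ X]eq_fun do rewrite addNr cis0.
  rewrite cintegral_cst mulr1 -rmorphM mulVf ?rmorph1//; exact: lt0r_neq0.
by rewrite cintegral_cis ?mulr0// addrC subr_eq0.
Qed.

End fourier_coefficients.
#[global] Arguments cis {R} T k t : simpl never.

(** * Pythagoras' identity and Bessel's inequality *)

Section bessel.
Variable R : realType.
Variable T : R.
Hypothesis T0 : 0 < T.
Local Notation mu := (@lebesgue_measure R).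
Local Notation D := (`[0%R, T]%classic : set R).
Implicit Types (f g : R -> R[i]) (k l : int).

(** Removing the component along one exponential removes exactly its energy:
    the cross term is twice this energy, as the coefficient is the mean of [f]
    against the conjugate exponential. *)
Lemma fine_nsqB_cis f k : sqint D f ->
  fine (nsq D (fun t => f t - fcoef T f k * cis T k t)) =
  fine (nsq D f) - T * absq (fcoef T f k).
Proof.
move=> sf; set c := fcoef T f k.
have sh : sqint D (fun t => cis T (- k) t * f t) by exact: sqintM_cis.
have cE : cintegral 0 T (fun t => cis T (- k) t * f t) = T%:C * c.
  rewrite /c /fcoef mulrA -rmorphM mulfV ?lt0r_neq0// rmorph1 mul1r//.
clearbody c; have [hR hI] := sqint_integrable T0 sh.
have absq_int g : sqint D g -> mu.-integrable D (EFin \o (fun t => absq (g t))).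
  move=> [mg ng]; apply/integrableP; split; first exact: measurable_Eabsq.
  by under eq_integral do rewrite /= ger0_norm ?absq_ge0//.
have iZ r (u : R -> R) : mu.-integrable D (EFin \o u) ->
    mu.-integrable D (EFin \o (fun t => r * u t)).
  by move=> iu; apply: eq_integrable (integrableZl _ r iu).
have E t : absq (f t - c * cis T k t) = absq (f t)
    - 2 * (Re c * Re (cis T (- k) t * f t) + Im c * Im (cis T (- k) t * f t))
    + absq c.
  rewrite !cisE intrN !mulNr cosN sinN.
  have := cos2Dsin2 (k%:~R * omega T * t).
  set x := k%:~R * omega T * t; set C := cos x; set S := sin x => CS.
  case: (f t) (c) => [u v] [a b]; rewrite /absq /=.
  transitivity (u ^+ 2 + v ^+ 2 - 2 * (a * (C * u - - S * v) +
    b * (C * v + - S * u)) + (a ^+ 2 + b ^+ 2) * (C ^+ 2 + S ^+ 2)); first ring.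
  by rewrite CS mulr1.
rewrite /nsq; under eq_integral do rewrite E.
rewrite -/(Rintegral _ _ _) RintegralD//; last 2 first.
- apply: eq_integrable (integrableB _ (absq_int _ sf)
    (integrableZl _ 2 (integrableD _ (integrableZl _ (Re c) hR)
    (integrableZl _ (Im c) hI)))) => //.
- exact: (absq_int (fun=> c) (sqint_cst T0 c)).
rewrite RintegralB//; last 2 first.
- exact: absq_int.
- exact: (integrableZl _ 2 (integrableD _ (integrableZl _ (Re c) hR)
    (integrableZl _ (Im c) hI))).
rewrite RintegralZl//; last first.
  exact: (integrableD _ (integrableZl _ (Re c) hR) (integrableZl _ (Im c) hI)).
rewrite [X in 2 * X]RintegralD//; last 2 first.
- exact: iZ.
- exact: iZ.
rewrite !RintegralZl// -Re_cintegral -Im_cintegral cE.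
rewrite Rintegral_cst// [X in fine X](period_itvE T0) /=.
rewrite /Rintegral; move: (fine _) => I; case: (c) => a b; rewrite /absq /=; ring.
Qed.

Lemma fcoef_trig (a : int -> R[i]) s k : uniq s ->
  fcoef T (fun t => \sum_(l <- s) a l * cis T l t) k =
  if k \in s then a k else 0.
Proof.
move=> us; rewrite (fcoef_sum T0); last first.
  by move=> l _; apply: sqintZ => //; exact: sqint_cis.
rewrite (eq_bigr (fun l => if l == k then a l else 0)); last first.
  move=> l _; rewrite fcoefZ ?fcoef_cis//; last exact: sqint_cis.
  by case: eqP => _; rewrite ?mulr1 ?mulr0.
rewrite -big_mkcond /=; case: ifPn => ks.
  by rewrite -big_filter (filter_pred1_uniq us ks) big_seq1.
rewrite big_seq_cond big_pred0// => l.
by apply/negP => /andP[+ /eqP lk]; rewrite lk (negPf ks).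
Qed.

Lemma fcoefB_trig f (a : int -> R[i]) s k : sqint D f -> uniq s ->
  fcoef T (fun t => f t - \sum_(l <- s) a l * cis T l t) k =
  fcoef T f k - (if k \in s then a k else 0).
Proof.
move=> sf us; rewrite fcoefB ?fcoef_trig//.
by apply: sqint_sum => // l _; apply: sqintZ => //; exact: sqint_cis.
Qed.

(** After the removal of some components the coefficients at the other
    frequencies are unchanged, so the frequencies can be removed one at a
    time. *)
Lemma pythagoras f s : sqint D f -> uniq s ->
  fine (nsq D (fun t => f t - \sum_(k <- s) fcoef T f k * cis T k t)) =
  fine (nsq D f) - T * \sum_(k <- s) absq (fcoef T f k).
Proof.
move=> sf; elim: s => [_|k s IH /= /andP[ks us]].
  rewrite big_nil mulr0 subr0; congr fine; apply: eq_nsq => t _.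
  by rewrite big_nil subr0.
set g := fun t => f t - \sum_(k <- s) fcoef T f k * cis T k t.
have sg : sqint D g.
  apply: sqintB => //; apply: sqint_sum => // l _.
  by apply: sqintZ => //; exact: sqint_cis.
have gk : fcoef T g k = fcoef T f k.
  by rewrite fcoefB_trig// (negPf ks) subr0.
have -> : nsq D (fun t => f t - \sum_(k <- k :: s) fcoef T f k * cis T k t) =
    nsq D (fun t => g t - fcoef T g k * cis T k t).
  by apply: eq_nsq => t _; rewrite big_cons gk /g; ring.
by rewrite fine_nsqB_cis// gk IH// big_cons; ring.
Qed.

Lemma bessel f s : sqint D f -> uniq s ->
  T * \sum_(k <- s) absq (fcoef T f k) <= fine (nsq D f).
Proof.
move=> sf us; rewrite -subr_ge0 -pythagoras//.
by rewrite fine_ge0// nsq_ge0.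
Qed.

Lemma absq_fcoef_le f k : sqint D f ->
  T * absq (fcoef T f k) <= fine (nsq D f).
Proof. by move=> sf; have := @bessel f [:: k] sf isT; rewrite big_seq1. Qed.

(** A trigonometric polynomial has no energy left once its own components are
    removed, so Pythagoras' identity becomes Parseval's. *)
Lemma nsq_trig (a : int -> R[i]) s : uniq s ->
  fine (nsq D (fun t => \sum_(k <- s) a k * cis T k t)) =
  T * \sum_(k <- s) absq (a k).
Proof.
move=> us; set f := fun t => \sum_(k <- s) a k * cis T k t.
have sf : sqint D f.
  apply: sqint_sum => // l _; apply: sqintZ => //; exact: sqint_cis.
have fa k : k \in s -> fcoef T f k = a k by move=> ks; rewrite fcoef_trig// ks.
have := pythagoras sf us; rewrite (_ : nsq _ _ = 0%E); last first.
  rewrite /nsq integral0_eq// => t _.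
  rewrite [X in _ - X](_ : _ = f t) ?subrr ?absq0//.
  by apply: eq_big_seq => k ks; rewrite fa.
move=> /esym/eqP; rewrite subr_eq0 => /eqP ->; congr (_ * _).
by apply: eq_big_seq => k ks; rewrite fa.
Qed.

End bessel.

(** * Uniqueness of Fourier coefficients *)

Section uniqueness.
Variable R : realType.
Variable T : R.
Hypothesis T0 : 0 < T.
Local Notation mu := (@lebesgue_measure R).
Local Notation D := (`[0%R, T]%classic : set R).
Implicit Types (f g : R -> R[i]) (k l : int).

Lemma ae_neq (c : R) : {ae mu, forall t : R, t <> c}.
Proof.
exists [set c]; split => //; first exact: lebesgue_measure_set1.
by move=> t /= /contrapT.
Qed.

(** Lebesgue's differentiation theorem: almost everywhere the value of [u] is
    the derivative of its primitive, which vanishes identically. *)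
Lemma ae_eq0_of_primitive (u : R -> R) : mu.-integrable D (EFin \o u) ->
  (forall b, 0 < b < T -> \int[mu]_(t in `[0, b]) u t = 0) ->
  {ae mu, forall t, D t -> u t = 0}.
Proof.
move=> iu u0; pose v := u \_ D.
have iv : mu.-integrable setT (EFin \o v).
  rewrite /v -restrict_EFin; apply/integrable_restrict => //.
  by rewrite setTI.
have := @FTC1 R v (BLeft 0) _ (integrable_locally _ iu).
have /[swap] /[apply] : forall y : R, mu.-integrable
    [set` Interval (BLeft 0) (BRight y)] (EFin \o v).
  by move=> y; exact: integrableS iv.
move=> /(_ (measurable_itv _)) /= F; have := aeI F (aeI (ae_neq 0) (ae_neq T)).
apply: aeS => x [Fx [x0 xT]] /=; rewrite in_itv/= => /andP[x0' xT'].
have {}x0 : 0 < x by rewrite lt_neqAle x0' andbT eq_sym; apply/eqP.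
have {}xT : x < T by rewrite lt_neqAle xT' andbT; apply/eqP.
have [] := Fx _; first by rewrite lte_fin.
move=> _; rewrite /v patchE mem_set/= ?in_itv/= ?x0' ?xT'// => <-.
rewrite derive1E.
transitivity ('D_1 (cst (0 : R)) x); last exact: derive_cst.
apply: near_eq_derive.
near=> y; transitivity (\int[mu]_(t in `[0, y]) u t); last first.
  by apply: u0; apply/andP; split; near: y; [exact: lt_nbhsr|exact: lt_nbhsl].
apply: eq_Rintegral => t /=; rewrite inE/= in_itv/= => /andP[t0 ty].
rewrite patchE mem_set//= in_itv/= t0/= (le_trans ty)// ltW//.
near: y; exact: lt_nbhsl.
Unshelve. all: by end_near. Qed.

(** Together with [step_cvg0], this turns powers of [y] into the indicator of
    [y < 1/2]. By Bernoulli's inequality the value is at least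
    [1 - (2 * y) ^+ n]. *)
Lemma step_cvg1 (y : R) : 0 <= y -> y < 2^-1 ->
  (fun n => (1 - y ^+ n) ^+ (2 ^ n)) @ \oo --> (1 : R).
Proof.
move=> y0 y2.
have yn1 n : 0 <= y ^+ n <= 1.
  by rewrite exprn_ge0//= exprn_ile1//; lra.
have bern (x : R) m : 0 <= x <= 1 -> 1 - m%:R * x <= (1 - x) ^+ m.
  move=> /andP[x0 x1]; elim: m => [|m IH]; first by rewrite mul0r subr0.
  rewrite exprS; apply: le_trans (ler_wpM2l _ IH); last by lra.
  rewrite -natr1; have : 0 <= m%:R :> R by []. nra.
apply: (@squeeze_cvgr _ _ _ _ (fun n => 1 - (2 * y) ^+ n) (fun=> 1)).
- apply: nearW => n; rewrite exprn_ile1 ?andbT//; last 2 first.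
  + by have := yn1 n; lra.
  + by have := yn1 n; lra.
  by apply: le_trans (bern _ _ (yn1 n)); rewrite exprMn natrX.
- rewrite -[X in _ --> X]subr0; apply: cvgB; first exact: cvg_cst.
  by apply: cvg_expr; rewrite ger0_norm; lra.
- exact: cvg_cst.
Qed.

(** As [(1 - x) ^+ m * (1 + x) ^+ m <= 1], Bernoulli's inequality for
    [1 + y ^+ n] bounds the value by [(2 * y)^-1 ^+ n]. *)
Lemma step_cvg0 (y : R) : 2^-1 < y -> y <= 1 ->
  (fun n => (1 - y ^+ n) ^+ (2 ^ n)) @ \oo --> (0 : R).
Proof.
move=> y2 y1.
have yn1 n : 0 <= y ^+ n <= 1.
  by rewrite exprn_ge0//= ?exprn_ile1//; lra.
have bern (x : R) m : 0 <= x -> 1 + m%:R * x <= (1 + x) ^+ m.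
  move=> x0; elim: m => [|m IH]; first by rewrite mul0r addr0.
  rewrite exprS; apply: le_trans (ler_wpM2l _ IH); last by lra.
  by rewrite -natr1; have : 0 <= m%:R :> R by []; nra.
have y0 : 0 < y by lra.
apply: (@squeeze_cvgr _ _ _ _ (fun=> 0) (fun n => (2 * y)^-1 ^+ n)).
- apply: nearW => n; have /andP[x0 x1] := yn1 n.
  rewrite exprn_ge0/=; last by lra.
  rewrite exprVn -[leRHS]mul1r ler_pdivlMr ?exprn_gt0//; last by lra.
  rewrite exprMn -natrX.
  apply: (@le_trans _ _ ((1 - y ^+ n) ^+ (2 ^ n) * (1 + y ^+ n) ^+ (2 ^ n))).
    apply: ler_wpM2l; first by rewrite exprn_ge0//; lra.
    by apply: le_trans (bern _ _ x0); rewrite lerDr.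
  rewrite -exprMn exprn_ile1//; nra.
- exact: cvg_cst.
- apply: cvg_expr; rewrite ger0_norm ?invr_ge0; last by lra.
  by rewrite invf_lt1; lra.
Qed.

(** The functions orthogonal to all exponentials. This class is stable under
    multiplication by trigonometric polynomials, which makes it possible to
    replace the exponentials by approximate indicators of intervals. *)
Definition zero_fourier f := sqint D f /\ forall k, fcoef T f k = 0.

Lemma zero_fourierD f g : zero_fourier f -> zero_fourier g ->
  zero_fourier (fun t => f t + g t).
Proof.
move=> [sf f0] [sg g0]; split; first exact: sqintD.
by move=> k; rewrite fcoefD// f0 g0 addr0.
Qed.

Lemma zero_fourierZ f z : zero_fourier f -> zero_fourier (fun t => z * f t).
Proof.
move=> [sf f0]; split; first exact: sqintZ.
by move=> k; rewrite fcoefZ// f0 mulr0.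
Qed.

Lemma zero_fourier_cis f k : zero_fourier f ->
  zero_fourier (fun t => cis T k t * f t).
Proof.
move=> [sf f0]; split; first exact: sqintM_cis.
move=> l; rewrite -(f0 (l - k)); congr (_ * _); apply: eq_cintegral => t _.
by rewrite mulrA -cisD; congr (cis T _ t * _); rewrite opprB addrC.
Qed.

(** Euler's formula: the multiplier is a combination of the shifts of the
    frequencies by [1] and by [-1]. *)
Lemma zero_fourier_cos f (x : R) : zero_fourier f ->
  zero_fourier (fun t => (cos (omega T * (t - x)))%:C * f t).
Proof.
move=> zf.
have -> : (fun t => (cos (omega T * (t - x)))%:C * f t) =
  (fun t => (2^-1)%:C * (cis T (-1) x * (cis T 1 t * f t) +
                         cis T 1 x * (cis T (-1) t * f t))).
  have c1 t : cis T 1 t = cos (omega T * t) +i* sin (omega T * t).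
    by rewrite cisE mulr1z mul1r.
  have cN1 t : cis T (-1) t = cos (omega T * t) -i* sin (omega T * t).
    by rewrite cisE intrN mulr1z !mulNr mul1r cosN sinN.
  apply/funext => t; rewrite mulrBr cosB !c1 !cN1.
  set a := cos _; set b := cos _; set c := sin _; set e := sin _.
  rewrite (_ : (_ + _)%:C =
    (2^-1)%:C * ((b -i* e) * (a +i* c) + (b +i* e) * (a -i* c))); first ring.
  by apply: complex_eqP => /=; field.
apply: zero_fourierZ; apply: zero_fourierD; apply: zero_fourierZ;
  exact: zero_fourier_cis.
Qed.

Lemma zero_fourier_step f (h x : R) n m : zero_fourier f ->
  zero_fourier (fun t => ((1 - (2^-1 + (h - cos (omega T * (t - x))) / 4) ^+ n)
    ^+ m)%:C * f t).
Proof.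
pose y t := 2^-1 + (h - cos (omega T * (t - x))) / 4.
have zy g : zero_fourier g -> zero_fourier (fun t => (y t)%:C * g t).
  move=> zg; have -> : (fun t => (y t)%:C * g t) = (fun t =>
    (2^-1 + h / 4)%:C * g t + (- 4^-1)%:C * ((cos (omega T * (t - x)))%:C * g t)).
    apply/funext => t; rewrite mulrA -mulrDl -rmorphM -rmorphD; congr (_%:C * _).
    by rewrite /y; field.
  apply: zero_fourierD; first exact: zero_fourierZ.
  by apply: zero_fourierZ; exact: zero_fourier_cos.
have zyn g i : zero_fourier g -> zero_fourier (fun t => (y t ^+ i)%:C * g t).
  move=> zg; elim: i => [|i IH].
    by under eq_fun do rewrite expr0 mul1r.
  by under eq_fun do rewrite exprS rmorphM -mulrA; exact: zy.
move=> zf; elim: m => [|m IH]; first by under eq_fun do rewrite expr0 mul1r.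
have -> : (fun t => ((1 - y t ^+ n) ^+ m.+1)%:C * f t) = (fun t =>
  ((1 - y t ^+ n) ^+ m)%:C * f t + (- 1)%:C * ((y t ^+ n)%:C * (((1 - y t ^+ n) ^+ m)%:C * f t))).
  apply/funext => t; rewrite exprS !mulrA -mulrDl -!rmorphM -rmorphD.
  by congr (_%:C * _); ring.
by apply: zero_fourierD => //; apply: zero_fourierZ; exact: zyn.
Qed.

End uniqueness.

Section uniqueness_theorem.
Variable R : realType.
Variable T : R.
Hypothesis T0 : 0 < T.
Local Notation mu := (@lebesgue_measure R).
Local Notation D := (`[0%R, T]%classic : set R).
Implicit Types (f g : R -> R[i]) (k l : int).

(** As a function of [t], a trigonometric polynomial with values between [0]
    and [1], equal to [1/2] at [0] and [b]: over one period it is below [1/2]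
    on ]0, b[ and above it on ]b, T[, because the cosine centred at [b / 2]
    exceeds its value at the two ends exactly in between. *)
Definition step_arg (b t : R) : R :=
  2^-1 + (cos (omega T * (b / 2)) - cos (omega T * (t - b / 2))) / 4.

Lemma step_arg_itv b t : 0 <= step_arg b t <= 1.
Proof.
rewrite /step_arg; set u := omega T * _; set v := omega T * _.
have := cos_geN1 u; have := cos_le1 u; have := cos_geN1 v; have := cos_le1 v.
by lra.
Qed.

Lemma step_argE b t : step_arg b t =
  2^-1 - sin (omega T * t / 2) * sin (omega T * (b - t) / 2) / 2.
Proof.
rewrite /step_arg.
rewrite [in cos (_ * (b / 2))](_ : omega T * (b / 2) =
  omega T * t / 2 + omega T * (b - t) / 2); last by field.
rewrite [in cos (_ * (t - _))](_ : omega T * (t - b / 2) =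
  omega T * t / 2 - omega T * (b - t) / 2); last by field.
by rewrite cosB cosD; field.
Qed.

Lemma sin_half_gt0 t : 0 < t < T -> 0 < sin (omega T * t / 2).
Proof.
move=> /andP[t0 tT]; apply: sin_gt0_pi.
have p0 := @pi_gt0 R.
have -> : omega T * t / 2 = pi * (t / T).
  by rewrite /omega; field; rewrite lt0r_neq0.
by rewrite mulr_gt0 ?divr_gt0//= gtr_pMr// ltr_pdivrMr// mul1r.
Qed.

Lemma step_arg_lt b t : 0 < b < T -> 0 < t < b -> step_arg b t < 2^-1.
Proof.
move=> /andP[b0 bT] /andP[t0 tb]; rewrite step_argE.
have s1 : 0 < sin (omega T * t / 2) by apply: sin_half_gt0; lra.
have s2 : 0 < sin (omega T * (b - t) / 2) by apply: sin_half_gt0; lra.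
by have := mulr_gt0 s1 s2; lra.
Qed.

Lemma step_arg_gt b t : 0 < b < T -> b < t < T -> 2^-1 < step_arg b t.
Proof.
move=> /andP[b0 bT] /andP[t0 tb]; rewrite step_argE -(opprB t b).
rewrite mulrN mulNr sinN.
have s1 : 0 < sin (omega T * t / 2) by apply: sin_half_gt0; lra.
have s2 : 0 < sin (omega T * (t - b) / 2) by apply: sin_half_gt0; lra.
by have := mulr_gt0 s1 s2; lra.
Qed.

Lemma measurable_step_arg E b : measurable_fun E (step_arg b).
Proof.
apply: measurable_funTS; apply: measurable_funD => //.
apply: measurable_funM => //; apply: measurable_funB => //.
apply: continuous_measurable_fun => t.
apply: continuous_comp; last exact: continuous_cos.
apply: continuousM; first exact: cst_continuous.
by apply: continuousB; [exact: id|exact: cst_continuous].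
Qed.

(** The multipliers converge boundedly to the indicator of [0, b], except at
    [0], [b] and [T], where the argument is [1/2]. *)
Lemma primitive_eq0_of_step (u : R -> R) b : 0 < b < T ->
  mu.-integrable D (EFin \o u) ->
  (forall n, \int[mu]_(t in D) ((1 - step_arg b t ^+ n) ^+ (2 ^ n) * u t) = 0) ->
  \int[mu]_(t in `[0, b]) u t = 0.
Proof.
move=> b0T iu u0.
have mu_ : measurable_fun D u by have /measurable_EFinP := measurable_int _ iu.
pose G n t := (1 - step_arg b t ^+ n) ^+ (2 ^ n).
have mG n : measurable_fun D (G n).
  apply: measurable_funX; apply: measurable_funB => //.
  by apply: measurable_funX; exact: measurable_step_arg.
have G1 n t : 0 <= G n t <= 1.
  have /andP[y0 y1] := step_arg_itv b t.
  have ? : 0 <= step_arg b t ^+ n by rewrite exprn_ge0.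
  have ? : step_arg b t ^+ n <= 1 by rewrite exprn_ile1.
  by apply/andP; split; [rewrite exprn_ge0|rewrite exprn_ile1]; lra.
have iG n : mu.-integrable D (EFin \o (fun t => G n t * u t)).
  apply: le_integrable iu => //.
    by apply/measurable_EFinP/measurable_funM => //; exact: mG.
  move=> t _ /=; rewrite lee_fin normrM ler_piMl//.
  by have /andP[g0 g1] := G1 n t; rewrite ger0_norm.
have := @dominated_convergence _ _ R mu D (measurable_itv _)
  (fun n => EFin \o (fun t => G n t * u t)) (EFin \o (u \_ `[0, b]))
  (EFin \o (fun t => `|u t|)).
case.
- by move=> n; exact: measurable_int (iG n).
- apply/measurable_EFinP; apply/measurable_restrict => //.
  by apply: measurable_funS mu_ => //; apply: subIsetl.
- have := aeI (ae_neq 0) (aeI (ae_neq b) (ae_neq T)).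
  apply: aeS => t [t0 [tb tT]] /=; rewrite in_itv/= => /andP[t0' tT'].
  have {}t0 : 0 < t by rewrite lt_neqAle t0' andbT eq_sym; apply/eqP.
  have {}tT : t < T by rewrite lt_neqAle tT' andbT; apply/eqP.
  apply: cvg_EFin; first exact: nearW.
  rewrite /comp /= patchE /=.
  have /andP[y0 y1] := step_arg_itv b t.
  case: ifPn; rewrite (inE, notin_setE)/= in_itv/= t0'/= => tb'.
    rewrite -[X in _ --> X]mul1r; apply: cvgMl; apply: step_cvg1 => //.
    apply: step_arg_lt => //; rewrite t0/= lt_neqAle tb' andbT.
    exact/eqP.
  rewrite -[X in _ --> X](mul0r (u t)); apply: cvgMl; apply: step_cvg0 => //.
  apply: step_arg_gt => //; rewrite tT andbT ltNge.
  exact/negP.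
- exact: integrable_norm.
- apply: aeW => t n Dt /=; rewrite lee_fin normrM ler_piMl//.
  by have /andP[g0 g1] := G1 n t; rewrite ger0_norm.
move=> _ _ cv.
have E0 n : (\int[mu]_(t in D) ((G n t * u t)%R)%:E)%E = 0%E.
  by rewrite -[LHS]fineK ?(integrable_fin_num _ (iG n))// [X in X%:E]u0.
have I0 : (\int[mu]_(t in D) ((u \_ `[0%R, b]) t)%:E)%E = 0%E.
  rewrite -(cvg_lim _ cv)//.
  under eq_fun do rewrite E0.
  exact: lim_cst.
have -> : `[0, b]%classic = D `&` `[0, b]%classic.
  apply/seteqP; split => t /=; rewrite !in_itv/=; last by case.
  by move=> /andP[-> tb]; split => //=; have /andP[_ ?] := b0T; lra.
by rewrite Rintegral_mkcondr /Rintegral -[RHS]/(fine 0%E) I0.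
Qed.

(** The integral of [f] against an approximate indicator is, up to the factor
    [T], the coefficient of index 0 of their product, which is again orthogonal
    to all exponentials. In the limit all primitives of [f] vanish. *)
Theorem fourier_uniqueness f : sqint D f -> (forall k, fcoef T f k = 0) ->
  {ae mu, forall t, D t -> f t = 0}.
Proof.
move=> sf f0; have [iR iI] := sqint_integrable T0 sf.
have cG b n : cintegral 0 T
    (fun t => ((1 - step_arg b t ^+ n) ^+ (2 ^ n))%:C * f t) = 0.
  have [_ /(_ 0)] := zero_fourier_step T0 (cos (omega T * (b / 2))) (b / 2) n
    (2 ^ n) (conj sf f0).
  rewrite /fcoef; under [X in cintegral _ _ X]eq_fun do rewrite oppr0 cis0 mul1r.
  move/eqP; rewrite mulf_eq0 => /orP[/eqP/(congr1 (@complex.Re R))/=/eqP|/eqP//].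
  by rewrite invr_eq0 gt_eqF.
have aR : {ae mu, forall t, D t -> Re (f t) = 0}.
  apply: ae_eq0_of_primitive => // b b0T.
  apply: primitive_eq0_of_step => // n.
  transitivity (Re (cintegral 0 T
    (fun t => ((1 - step_arg b t ^+ n) ^+ (2 ^ n))%:C * f t))).
    by rewrite Re_cintegral; apply: eq_Rintegral => t _; rewrite cReM /=; ring.
  by rewrite cG.
have aI : {ae mu, forall t, D t -> Im (f t) = 0}.
  apply: ae_eq0_of_primitive => // b b0T.
  apply: primitive_eq0_of_step => // n.
  transitivity (Im (cintegral 0 T
    (fun t => ((1 - step_arg b t ^+ n) ^+ (2 ^ n))%:C * f t))).
    by rewrite Im_cintegral; apply: eq_Rintegral => t _; rewrite cImM /=; ring.
  by rewrite cG.
apply: aeS (aeI aR aI) => t [r i] Dt; apply: complex_eqP; [exact: r|exact: i].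
Qed.

End uniqueness_theorem.

(** * Completeness of the space of square integrable functions *)

Section completeness.
Variable R : realType.
Local Notation mu := (@lebesgue_measure R).

(** The Cauchy-Schwarz inequality with the weights [2 ^- i.+1], of sum at most
    [1]. *)
Lemma sqr_sum_le (a : nat -> R) m :
  (\sum_(i < m) a i) ^+ 2 <= \sum_(i < m) 2 ^+ i.+1 * a i ^+ 2.
Proof.
elim: m a => [|m IH] a; first by rewrite !big_ord0 expr0n.
rewrite !big_ord_recl /=; have := IH (a \o S).
rewrite [leRHS](_ : _ = 2^-1 * \sum_(i < m) 2 ^+ i.+2 * a i.+1 ^+ 2); last first.
  rewrite mulr_sumr; apply: eq_bigr => i _ /=.
  by rewrite [2 ^+ i.+2]exprS !mulrA mulVf ?mul1r// pnatr_eq0.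
rewrite /bump /=; under [X in _ <= _ + X]eq_bigr do rewrite add1n.
under [X in X ^+ 2 <= _ -> _]eq_bigr do rewrite /=.
under [X in (_ + X) ^+ 2]eq_bigr do rewrite add1n.
set S := \sum_(i < m) a _; set Q := \sum_(i < m) _ => SQ.
have := sqr_ge0 (a 0%N - S); rewrite expr1; nra.
Qed.

Lemma absq_sum_le (a : nat -> R[i]) m :
  absq (\sum_(i < m) a i) <= \sum_(i < m) 2 ^+ i.+1 * absq (a i).
Proof.
rewrite /absq Re_sum Im_sum; under [leRHS]eq_bigr do rewrite mulrDr.
rewrite big_split /=; apply: lerD.
  exact: (sqr_sum_le (fun i => Re (a i))).
exact: (sqr_sum_le (fun i => Im (a i))).
Qed.

Lemma geometric_cauchy_cvg (u : nat -> R) (c : R) :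
  (forall n m, (u (n + m)%N - u n) ^+ 2 <= c / 2 ^+ n) -> cvgn u.
Proof.
move=> uc; apply/cauchy_cvgP/cauchy_exP => e e0.
have : (fun n => c * (2^-1) ^+ n) @ \oo --> c * 0.
  by apply: cvgMr; apply: cvg_expr; rewrite ger0_norm; lra.
rewrite mulr0 => /cvgrPdist_lt /(_ (e ^+ 2)); rewrite exprn_gt0// => /(_ isT).
move=> [n _ /(_ n (leqnn n))] /=; rewrite sub0r normrN => cn.
exists (u n); exists n => // m /= nm; rewrite -(subnKC nm).
rewrite /ball/= distrC -(ltr_pXn2r (n := 2))// ?nnegrE ?ltW// real_normK ?num_real//.
apply: le_lt_trans (uc _ _) _; rewrite -exprVn.
by apply: le_lt_trans cn; exact: ler_norm.
Qed.

Variable D : set R.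
Hypothesis mD : measurable D.

Section fast_cauchy.
Variable F : nat -> R -> R[i].
Hypothesis sF : forall n, sqint D (F n).
Hypothesis F_fast : forall n,
  (nsq D (fun t => F n.+1 t - F n t)%R <= ((4 ^+ n.+1)^-1)%:E)%E.

(* [W] bounds [2 ^+ n] times the squared increments from the rank [n] on; the
   factor [4 ^- n.+1] in [F_fast] is what makes its integral finite. *)
Let w n t : \bar R := (2 ^+ n.+1 * absq (F n.+1 t - F n t))%:E.
Let W t : \bar R := (\sum_(n <oo) w n t)%E.

Let w_ge0 n t : (0 <= w n t)%E.
Proof. by rewrite lee_fin mulr_ge0 ?exprn_ge0 ?absq_ge0. Qed.

Let mdiff n : cmeas D (fun t => F n.+1 t - F n t).
Proof. by apply: cmeasB; [case: (sF n.+1)|case: (sF n)]. Qed.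

Let mw n : measurable_fun D (w n).
Proof.
apply/measurable_EFinP; apply: measurable_funM => //.
exact: measurable_absq (mdiff n).
Qed.

Let mW : measurable_fun D W.
Proof. by apply: ge0_emeasurable_sum => // n x _ _. Qed.

Let W_ge0 t : (0 <= W t)%E.
Proof. by apply: nneseries_ge0. Qed.

Let int_W : (\int[mu]_(t in D) W t <= 1%:E)%E.
Proof.
rewrite /W integral_nneseries//.
apply: le_trans (epsilon_trick0 xpredT (@ler01 R)).
apply: lee_nneseries => [n _ _|n _]; first by apply: integral_ge0.
rewrite /w; under eq_integral do rewrite EFinM.
rewrite ge0_integralZl_EFin//; last 2 first.
- by move=> t _; rewrite lee_fin absq_ge0.
- exact: measurable_Eabsq (mdiff n).
apply: le_trans (lee_wpmul2l _ (F_fast n)) _.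
  by rewrite lee_fin exprn_ge0.
rewrite -EFinM lee_fin natrX mul1r (_ : 4 = 2 * 2 :> R); last by ring.
by rewrite exprMn invfM mulrA mulfV ?mul1r// expf_neq0.
Qed.

(** Almost everywhere [W] is finite; there it forces convergence and bounds the
    squared error at rank [n] by [W t / 2 ^+ n], which is then integrated. *)
Lemma fast_cauchy_cvg : exists2 g, cmeas D g &
  forall n, (nsq D (fun t => F n t - g t)%R <= ((2 ^+ n)^-1)%:E)%E.
Proof.
have W_fin : {ae mu, forall t, D t -> W t \is a fin_num}.
  apply: integrable_ae => //; apply/integrableP; split => //.
  under eq_integral do rewrite gee0_abs//.
  by apply: le_lt_trans int_W _; rewrite ltry.
have absq_tail t n m : W t \is a fin_num ->
    absq (F (n + m)%N t - F n t) <= fine (W t) / 2 ^+ n.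
  move=> Wt; have -> : F (n + m)%N t - F n t =
      \sum_(i < m) (F (n + i).+1 t - F (n + i)%N t).
    have := @telescope_sumr _ 0 m (fun i => F (n + i)%N t) (leq0n m).
    by rewrite addn0 big_mkord => <-; apply: eq_bigr => i _; rewrite addnS.
  apply: le_trans (absq_sum_le (fun i => F (n + i).+1 t - F (n + i)%N t) m) _.
  rewrite ler_pdivlMr ?exprn_gt0// mulr_suml.
  rewrite (eq_bigr (fun i : 'I_m => fine (w (n + i) t))); last first.
    by move=> i _; rewrite /w /= -addnS exprD; ring.
  rewrite -lee_fin fineK// -sumEFin.
  under eq_bigr do rewrite fineK//.
  apply: (@le_trans _ _ (\sum_(0 <= i < n + m) w i t)%E); last first.
    exact: nneseries_lim_ge.
  rewrite (@big_cat_nat _ _ _ n) ?leq_addr//=.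
  rewrite (_ : \sum_(n <= i < n + m) w i t = \sum_(i < m) w (n + i)%N t)%E.
    by rewrite leeDr// sume_ge0.
  rewrite -{1}[n]add0n big_addn addKn big_mkord.
  by apply: eq_bigr => i _; rewrite addnC.
have ReB (x y : R[i]) : Re (x - y) = Re x - Re y by rewrite cReD cReN.
have ImB (x y : R[i]) : Im (x - y) = Im x - Im y by rewrite cImD cImN.
have cvR t : W t \is a fin_num -> cvgn (fun n => Re (F n t)).
  move=> Wt; apply: (@geometric_cauchy_cvg _ (fine (W t))) => n m.
  by rewrite -ReB; apply: le_trans (Re_sqr_le _) (absq_tail _ _ _ Wt).
have cvI t : W t \is a fin_num -> cvgn (fun n => Im (F n t)).
  move=> Wt; apply: (@geometric_cauchy_cvg _ (fine (W t))) => n m.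
  by rewrite -ImB; apply: le_trans (Im_sqr_le _) (absq_tail _ _ _ Wt).
(* The superior limit is measurable even where the sequence diverges. *)
pose lim_fun (u : nat -> R -> R) t := fine (limn_esup (fun n => (u n t)%:E)).
have lim_funE u t : cvgn (u ^~ t) -> u ^~ t @ \oo --> lim_fun u t.
  move=> cu.
  have cE : (fun n => (u n t)%:E) @ \oo --> (limn (u ^~ t))%:E.
    by apply: cvg_EFin => //; exact: nearW.
  by have [_ E] := cvg_limn_einf_sup cE; rewrite /lim_fun E.
have mlim u : (forall n, measurable_fun D (u n)) ->
    measurable_fun D (lim_fun u).
  move=> mu_; apply: measurableT_comp => //.
  by apply: measurable_fun_limn_esup => n; exact/measurable_EFinP.
pose g t := lim_fun (fun n t => Re (F n t)) t +i*
            lim_fun (fun n t => Im (F n t)) t.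
have mg : cmeas D g by split => /=; apply: mlim => k; have [[mR mI] _] := sF k.
exists g => // n.
have mFg : cmeas D (fun t => F n t - g t).
  by apply: cmeasB => //; case: (sF n).
have tail : {ae mu, forall t, D t ->
    ((absq (F n t - g t))%:E <= ((2 ^+ n)^-1)%:E * W t)%E}.
  apply: aeS W_fin => t Wt /Wt {}Wt; rewrite -(fineK Wt) -EFinM lee_fin mulrC.
  rewrite -opprB absqN.
  have cR := lim_funE (fun n t => Re (F n t)) _ (cvR _ Wt).
  have cI := lim_funE (fun n t => Im (F n t)) _ (cvI _ Wt).
  have cRn : (fun m => Re (F m t) - Re (F n t)) @ \oo --> Re (g t) - Re (F n t).
    by apply: cvgB => //; exact: cvg_cst.
  have cIn : (fun m => Im (F m t) - Im (F n t)) @ \oo --> Im (g t) - Im (F n t).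
    by apply: cvgB => //; exact: cvg_cst.
  have cv : (fun m => absq (F m t - F n t)) @ \oo --> absq (g t - F n t).
    rewrite /absq; under eq_fun do rewrite ReB ImB.
    rewrite ReB ImB.
    by apply: cvgD; rewrite expr2; under eq_fun do rewrite expr2; exact: cvgM.
  apply: (cvgr_to_le cv); exists n => // m /= nm.
  by rewrite -(subnKC nm); exact: absq_tail.
apply: le_trans (ae_ge0_le_integral _ _ _ _ _ tail) _ => //.
- by move=> t _; rewrite lee_fin absq_ge0.
- exact: measurable_Eabsq.
- by move=> t _; rewrite mule_ge0// lee_fin invr_ge0 exprn_ge0.
- exact: emeasurable_funM.
rewrite ge0_integralZl_EFin ?invr_ge0 ?exprn_ge0//.
rewrite -[leRHS]mule1 lee_wpmul2l// lee_fin invr_ge0 exprn_ge0//.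
Qed.

End fast_cauchy.

(** A subsequence whose consecutive squared differences have integrals at most
    [4 ^- k.+1] converges in mean square; a Cauchy sequence follows its
    subsequences. *)
Theorem L2_complete (f : nat -> R -> R[i]) : (forall n, sqint D (f n)) ->
  (forall e : R, 0 < e -> exists N, forall n m, (N <= n)%N -> (N <= m)%N ->
    (nsq D (fun t => f n t - f m t)%R <= e%:E)%E) ->
  exists2 g, sqint D g & forall e : R, 0 < e -> exists N, forall n, (N <= n)%N ->
    (nsq D (fun t => f n t - g t)%R <= e%:E)%E.
Proof.
move=> sf cf.
have /choice[N0 N0P] : forall k, exists N, forall n m, (N <= n)%N -> (N <= m)%N ->
    (nsq D (fun t => f n t - f m t)%R <= ((4 ^+ k.+1)^-1)%:E)%E.
  by move=> k; apply: cf; rewrite invr_gt0 exprn_gt0.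
(* [Phi] is nondecreasing, with [N0 k <= Phi k] and [k <= Phi k]. *)
pose Phi k := (\sum_(i < k.+1) N0 i + k)%N.
have PhiN k : (N0 k <= Phi k)%N by rewrite /Phi big_ord_recr /= addnAC leq_addl.
have PhiS k : (Phi k <= Phi k.+1)%N by rewrite [leqRHS]/Phi big_ord_recr /= leq_add ?leq_addr.
have [g mg gP] := @fast_cauchy_cvg (fun k => f (Phi k)) (fun k => sf _)
  (fun k => N0P k _ _ (leq_trans (PhiN k) (PhiS k)) (PhiN k)).
have mfg n : cmeas D (fun t => f n t - g t).
  by apply: cmeasB => //; case: (sf n).
have lim e : 0 < e -> exists N, forall n, (N <= n)%N ->
    (nsq D (fun t => f n t - g t)%R <= e%:E)%E.
  move=> e0; have e4 : 0 < e / 4 by rewrite divr_gt0.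
  have [N NP] := cf _ e4; exists N => n Nn.
  have [k0 k0P] : exists k0, forall k, (k0 <= k)%N -> (2 ^+ k)^-1 <= e / 4.
    have : (fun k => (2^-1 : R) ^+ k) @ \oo --> (0 : R).
      by apply: cvg_expr; rewrite ger0_norm; lra.
    move/cvgrPdist_le => /(_ _ e4)[k0 _ k0P]; exists k0 => k /k0P /=.
    by rewrite sub0r normrN exprVn ger0_norm// invr_ge0 exprn_ge0.
  pose k := maxn k0 N.
  have Nk : (N <= Phi k)%N.
    by rewrite (leq_trans (leq_maxr k0 N))// leq_addl.
  have -> : nsq D (fun t => f n t - g t) =
      nsq D (fun t => (f n t - f (Phi k) t) + (f (Phi k) t - g t)).
    by apply: eq_nsq => t _; rewrite addrA subrK.
  have mfn : cmeas D (fun t => f n t - f (Phi k) t).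
    by apply: cmeasB; [case: (sf n)|case: (sf (Phi k))].
  apply: le_trans (nsqD_le mD mfn (mfg _)) _.
  apply: (@le_trans _ _ (2%:E * (e / 4)%:E + 2%:E * (e / 4)%:E)%E); last first.
    by rewrite -!EFinM -EFinD lee_fin; lra.
  apply: leeD; apply: lee_wpmul2l => //; first exact: NP.
  by apply: le_trans (gP k) _; rewrite lee_fin k0P// leq_maxl.
exists g => //; have [N NP] := lim 1 ltr01.
apply: sqint_eq (sqintB mD (sf N) (conj (mfg N) (le_lt_trans (NP N (leqnn N)) (ltry 1)))).
by move=> t _; rewrite opprB addrC subrK.
Qed.

End completeness.

(** * Mean square convergence of Fourier series *)

Definition sym_range (n : nat) : seq int :=
  [seq i%:Z - n%:Z | i <- iota 0 (2 * n).+1].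

Lemma sym_range_uniq n : uniq (sym_range n).
Proof. by rewrite map_inj_uniq ?iota_uniq// => i j /addIr[]. Qed.

Lemma mem_sym_range n (k : int) : (k \in sym_range n) = (absz k <= n)%N.
Proof.
apply/mapP/idP => [[i + ->]|kn].
  by rewrite mem_iota add0n => /andP[_ i2]; lia.
exists (absz (k + n%:Z)); last by lia.
by rewrite mem_iota add0n; lia.
Qed.

Lemma big_sym_range (V : nmodType) n (u : int -> V) :
  \sum_(k <- sym_range n) u k = \sum_(i < (2 * n).+1) u (i%:Z - n%:Z).
Proof. by rewrite big_map -[iota _ _]/(index_iota 0 (2 * n).+1) big_mkord. Qed.

Section riesz_fischer.
Variable R : realType.
Variable T : R.
Hypothesis T0 : 0 < T.
Local Notation mu := (@lebesgue_measure R).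
Local Notation D := (`[0%R, T]%classic : set R).
Implicit Types (f g : R -> R[i]) (k l : int).

Definition partial_sum (a : int -> R[i]) n t : R[i] :=
  \sum_(k <- sym_range n) a k * cis T k t.

Lemma sqint_partial_sum a n : sqint D (partial_sum a n).
Proof.
apply: sqint_sum => // l _; apply: sqintZ => //; exact: sqint_cis.
Qed.

Lemma fcoef_partial_sum a n k :
  fcoef T (partial_sum a n) k = if (absz k <= n)%N then a k else 0.
Proof. by rewrite fcoef_trig ?sym_range_uniq// mem_sym_range. Qed.

Lemma sqint_fineK f : sqint D f -> nsq D f = (fine (nsq D f))%:E.
Proof. by move=> sf; rewrite fineK// nsqD_fin. Qed.

Lemma nsq_partial_sumB a n m : (m <= n)%N ->
  nsq D (fun t => partial_sum a n t - partial_sum a m t) =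
  (T * (\sum_(k <- sym_range n) absq (a k) -
        \sum_(k <- sym_range m) absq (a k)))%:E.
Proof.
move=> mn; rewrite sqint_fineK; last first.
  by apply: sqintB => //; exact: sqint_partial_sum.
congr _%:E; have := pythagoras T0 (sqint_partial_sum a n) (sym_range_uniq m).
have E (F : int -> R[i] -> R) : \sum_(k <- sym_range m)
  F k (fcoef T (partial_sum a n) k) = \sum_(k <- sym_range m) F k (a k).
  apply: eq_big_seq => k; rewrite mem_sym_range => km.
  by rewrite fcoef_partial_sum (leq_trans km mn).
rewrite (E (fun _ z => absq z)) nsq_trig ?sym_range_uniq// mulrBr => <-.
congr fine; apply: eq_nsq => t _; congr (_ - _).
apply: eq_big_seq => k; rewrite mem_sym_range => km.
by rewrite fcoef_partial_sum (leq_trans km mn).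
Qed.

(** Each coefficient is continuous for the mean square distance, by Bessel's
    inequality for a single frequency. *)
Lemma fcoef_lim (F : nat -> R -> R[i]) f k : (forall n, sqint D (F n)) ->
  sqint D f ->
  (forall e : R, 0 < e -> exists N, forall n, (N <= n)%N ->
    (nsq D (fun t => F n t - f t)%R <= e%:E)%E) ->
  forall e : R, 0 < e -> exists N, forall n, (N <= n)%N ->
    absq (fcoef T (F n) k - fcoef T f k) <= e.
Proof.
move=> sF sf Ff e e0; have [N NP] := Ff _ (mulr_gt0 T0 e0).
exists N => n Nn; have sFf : sqint D (fun t => F n t - f t) by exact: sqintB.
rewrite -fcoefB// -(ler_pM2l T0) -lee_fin.
apply: le_trans (NP n Nn); rewrite [leRHS]sqint_fineK// lee_fin.
exact: absq_fcoef_le.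
Qed.

(** By orthogonality the squared distance between two partial sums is [T] times
    the sum of the [absq (a k)] over the frequencies in between, so that the
    partial sums form a Cauchy sequence. *)
Theorem riesz_fischer (a : int -> R[i]) (B : R) :
  (forall s, uniq s -> \sum_(k <- s) absq (a k) <= B) ->
  exists2 f, sqint D f /\ (forall k, fcoef T f k = a k) &
    forall e : R, 0 < e -> exists N, forall n, (N <= n)%N ->
      (nsq D (fun t => partial_sum a n t - f t)%R <= e%:E)%E.
Proof.
move=> aB; pose S n := \sum_(k <- sym_range n) absq (a k).
have S_nd : nondecreasing_seq S.
  move=> m n mn; rewrite -subr_ge0 -(pmulr_rge0 _ T0) -lee_fin.
  by rewrite -nsq_partial_sumB// nsq_ge0.
have S_cvg : cvgn S.
  apply: nondecreasing_is_cvgn => //; exists B => _ [n _ <-].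
  by apply: aB; exact: sym_range_uniq.
have S_le n : S n <= limn S by exact: nondecreasing_cvgn_le.
have [f sf fP] : exists2 f, sqint D f & forall e : R, 0 < e ->
    exists N, forall n, (N <= n)%N ->
      (nsq D (fun t => partial_sum a n t - f t)%R <= e%:E)%E.
  apply: L2_complete => //; first by move=> n; exact: sqint_partial_sum.
  move=> e e0; have eT : 0 < e / T by rewrite divr_gt0.
  move/cvgrPdist_le: S_cvg => /(_ _ eT)[N _ NP]; exists N.
  have H n m : (N <= m)%N -> (m <= n)%N ->
      (nsq D (fun t => partial_sum a n t - partial_sum a m t)%R <= e%:E)%E.
    move=> Nm mn; rewrite nsq_partial_sumB// lee_fin -ler_pdivlMl// mulrC.
    have := NP m Nm; rewrite /= ger0_norm ?subr_ge0//.
    by apply: le_trans; rewrite lerD2r; exact: S_le.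
  move=> n m Nn Nm; have [mn|/ltnW mn] := leqP m n; first exact: H.
  rewrite -nsqN (@eq_nsq _ _ _ (fun t => partial_sum a m t - partial_sum a n t)).
    exact: H.
  by move=> t _; rewrite opprB.
exists f => //; split => // k; apply/eqP; rewrite eq_sym -subr_eq0; apply/eqP.
apply: absq_eq0; apply/eqP; rewrite eq_le absq_ge0 andbT.
apply/ler_addgt0Pr => e e0; rewrite add0r.
have [N NP] := fcoef_lim k (sqint_partial_sum a) sf fP e0.
have := NP _ (leq_maxl N (absz k)).
by rewrite fcoef_partial_sum leq_maxr.
Qed.

(** The partial sums converge to some function with the same coefficients as
    [f], which is [f] by uniqueness. *)
Theorem fourier_series_cvg f : sqint D f ->
  forall e : R, 0 < e -> exists N, forall n, (N <= n)%N ->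
    (nsq D (fun t => partial_sum (fcoef T f) n t - f t)%R <= e%:E)%E.
Proof.
move=> sf; have fB s : uniq s ->
    \sum_(k <- s) absq (fcoef T f k) <= fine (nsq D f) / T.
  by move=> us; rewrite ler_pdivlMr// mulrC; exact: bessel.
have [g [sg gf] gP] := riesz_fischer fB.
have fg : {ae mu, forall t, D t -> f t - g t = 0}.
  apply: (fourier_uniqueness T0); first exact: sqintB.
  by move=> k; rewrite fcoefB// gf subrr.
move=> e e0; have [N NP] := gP e e0; exists N => n /NP; apply: le_trans.
have sP := sqint_partial_sum (fcoef T f) n.
rewrite le_eqVlt; apply/orP; left; apply/eqP; apply: ge0_ae_eq_integral => //.
- by apply: measurable_Eabsq; have [] := sqintB (measurable_itv _) sP sf.
- by apply: measurable_Eabsq; have [] := sqintB (measurable_itv _) sP sg.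
- by move=> t _; rewrite lee_fin absq_ge0.
- by move=> t _; rewrite lee_fin absq_ge0.
by apply: aeS fg => t + Dt => /(_ Dt)/eqP; rewrite subr_eq0 => /eqP ->.
Qed.

End riesz_fischer.

(** * Translations and multiplications over one period *)

Section shifts.
Variable R : realType.
Local Notation mu := (@lebesgue_measure R).
Implicit Types (f g v : R -> R[i]).

(** Typed so that measures can be pushed forward along it. *)
Definition transl (c : R) : measurableTypeR R -> measurableTypeR R :=
  fun t => t + c.

Lemma measurable_transl (c : R) : measurable_fun setT (transl c).
Proof. by apply: measurable_funD => //; exact: measurable_cst. Qed.

HB.instance Definition _ (c : R) :=
  isMeasurableFun.Build _ _ _ _ (transl c) (measurable_transl c).

(** Lebesgue measure is determined by the lengths of half-open intervals. *)
Lemma lebesgue_measure_transl (c : R) (A : set R) : measurable A ->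
  pushforward mu (transl c) A = mu A.
Proof.
move=> mA; apply/esym/lebesgue_measure_unique => //= _ [[a b]] _ <-.
rewrite /pushforward.
have -> : transl c @^-1` [set` `]a, b]] = `]a - c, b - c]%classic.
  by apply/seteqP; split => t /=; rewrite !in_itv/= /transl ltrBlDr lerBrDr.
rewrite !lebesgue_measure_itv/= !lte_fin ltrD2r; case: ifP => // _.
by rewrite -!EFinB; congr _%:E; ring.
Qed.

Lemma ge0_integral_transl (c : R) (A : set R) (F : R -> \bar R) :
  measurable A -> measurable_fun A F -> (forall t, A t -> 0 <= F t)%E ->
  (\int[mu]_(t in transl c @^-1` A) F (t + c)%R = \int[mu]_(t in A) F t)%E.
Proof.
move=> mA mF F0; transitivity (\int[pushforward mu (transl c)]_(t in A) F t)%E.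
  by rewrite ge0_integral_pushforward// => t; rewrite inE; exact: F0.
by apply: eq_measure_integral => B mB _; exact: lebesgue_measure_transl.
Qed.

Lemma nsq_transl (c : R) (A : set R) f : measurable A -> cmeas A f ->
  nsq (transl c @^-1` A) (fun t => f (t + c)) = nsq A f.
Proof.
move=> mA mf.
apply: (@ge0_integral_transl c A (fun t => (absq (f t))%:E)) => //.
  exact: measurable_Eabsq.
by move=> t _; rewrite lee_fin absq_ge0.
Qed.

Lemma cmeas_patch E v : measurable E -> cmeas E v ->
  cmeas setT (fun t => if t \in E then v t else 0).
Proof.
move=> mE [m1 m2]; split.
  rewrite (_ : (fun t => _) = ((fun t => Re (v t)) \_ E)).
    by apply/measurable_restrict => //; rewrite setTI.
  by apply/funext => t; rewrite patchE; case: ifP.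
rewrite (_ : (fun t => _) = ((fun t => Im (v t)) \_ E)).
  by apply/measurable_restrict => //; rewrite setTI.
by apply/funext => t; rewrite patchE; case: ifP.
Qed.

Lemma cmeas_if (b : R -> bool) f g : measurable_fun setT b ->
  cmeas setT f -> cmeas setT g -> cmeas setT (fun t => if b t then f t else g t).
Proof.
move=> mb [f1 f2] [g1 g2]; split.
  rewrite (_ : (fun t => _) = (fun t => if b t then Re (f t) else Re (g t))).
    exact: measurable_fun_ifT.
  by apply/funext => t; case: ifP.
rewrite (_ : (fun t => _) = (fun t => if b t then Im (f t) else Im (g t))).
  exact: measurable_fun_ifT.
by apply/funext => t; case: ifP.
Qed.

Lemma cmeas_shift f (c : R) : cmeas setT f -> cmeas setT (fun t => f (t + c)).
Proof.
by move=> [f1 f2]; split; [apply: (measurableT_comp f1)|apply: (measurableT_comp f2)];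
  exact: measurable_transl.
Qed.

Lemma nsq_setU (A B : set R) f : measurable A -> measurable B ->
  cmeas (A `|` B) f -> [disjoint A & B] ->
  nsq (A `|` B) f = (nsq A f + nsq B f)%E.
Proof.
move=> mA mB mf AB; rewrite /nsq ge0_integral_setU//.
  exact: measurable_Eabsq.
by move=> t _; rewrite lee_fin absq_ge0.
Qed.

Lemma nsq_itv_co (a b : R) f : cmeas `[a, b] f ->
  nsq `[a, b[ f = nsq `[a, b] f.
Proof.
move=> mf; rewrite /nsq integral_itv_bndo_bndc//.
apply: measurable_funS (measurable_Eabsq mf) => //.
by move=> t /=; rewrite !in_itv/= => /andP[-> /ltW].
Qed.

(** Translation by [s] of the [T]-periodic extension of [f], on one period. *)
Definition pshift (T s : R) f t : R[i] :=
  if t < s then f (t - s + T) else f (t - s).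

Variable T : R.
Hypothesis T0 : 0 < T.
Local Notation D := (`[0%R, T]%classic : set R).

Lemma cmeas_pshift s f : 0 < s < T -> cmeas D f -> cmeas D (pshift T s f).
Proof.
move=> /andP[s0 sT] mf; have mf' := cmeas_patch (measurable_itv _) mf.
set f' := (fun t => _) in mf'.
apply: (@cmeas_eq _ _ (fun t => if t < s then f' (t + (T - s)) else f' (t - s))).
  move=> t; rewrite inE/= in_itv/= => /andP[t0 tT]; rewrite /pshift /f'.
  case: ltP => ts; rewrite mem_set//= ?in_itv/=; try (apply/andP; split; lra).
  by congr f; ring.
apply: (@cmeasS _ setT) => //.
apply: cmeas_if; first exact: measurable_fun_ltr.
  exact: cmeas_shift.
exact: cmeas_shift.
Qed.

(** The period is cut into two intervals, which the shift exchanges; each of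
    them is translated. *)
Lemma nsq_pshift s f : 0 < s < T -> cmeas D f ->
  nsq D (pshift T s f) = nsq D f.
Proof.
move=> s0T mf; have /andP[s0 sT] := s0T.
have mp := cmeas_pshift s0T mf.
have sub (a b : R) : 0 <= a -> b <= T -> `[a, b[ `<=` D.
  by move=> a0 bT t /=; rewrite !in_itv/= => /andP[at_ tb]; lra.
have split_co a : 0 < a < T -> `[0, T[%classic = `[0, a[ `|` `[a, T[ :> set R.
  move=> /andP[a0 aT]; apply/seteqP; split => t /=; rewrite !in_itv/=.
    by move=> /andP[t0 tT]; case: (ltP t a) => ta; [left|right]; rewrite ?t0 ?ta.
  by move=> [|] /andP[? ?]; lra.
have disj a : [disjoint `[0%R, a[%classic & `[a, T[%classic : set R].
  apply/eqP; rewrite -subset0 => t [] /=; rewrite !in_itv/=.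
  by move=> /andP[_ ta] /andP[at_ _]; lra.
have mco g (a b : R) : cmeas D g -> 0 <= a -> b <= T -> cmeas `[a, b[ g.
  by move=> mg a0 bT; apply: cmeasS mg => //; exact: sub.
have nco g a : cmeas D g -> 0 < a < T ->
    nsq D g = (nsq `[0%R, a[ g + nsq `[a, T[ g)%E.
  move=> mg a0T; rewrite -nsq_itv_co// (split_co a)// nsq_setU//.
  by rewrite -split_co//; apply: mco.
rewrite (nco _ s)// [RHS](nco _ (T - s))//; last by lra.
rewrite addeC; congr (_ + _)%E.
  rewrite -(@nsq_transl (- s) `[0, T - s[)//; last by apply: mco => //; lra.
  rewrite (_ : _ @^-1` _ = `[s, T[%classic); last first.
    by apply/seteqP; split => t /=; rewrite !in_itv/= /transl => /andP[? ?]; lra.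
  apply: eq_nsq => t; rewrite inE/= in_itv/= /pshift => /andP[st _].
  by rewrite ltNge st.
rewrite -(@nsq_transl (T - s) `[T - s, T[)//; last by apply: mco => //; lra.
rewrite (_ : _ @^-1` _ = `[0, s[%classic); last first.
  by apply/seteqP; split => t /=; rewrite !in_itv/= /transl => /andP[? ?]; lra.
apply: eq_nsq => t; rewrite inE/= in_itv/= /pshift => /andP[_ ->].
by congr f; ring.
Qed.

Lemma sqint_pshift s f : 0 < s < T -> sqint D f -> sqint D (pshift T s f).
Proof. by move=> ? [? ?]; split; [exact: cmeas_pshift|rewrite nsq_pshift]. Qed.

Lemma pshift_partial_sum (a : int -> R[i]) n s t :
  pshift T s (partial_sum T a n) t =
  \sum_(k <- sym_range n) (a k * cis T (- k) s) * cis T k t.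
Proof.
have E k : cis T k (t - s) = cis T (- k) s * cis T k t.
  rewrite cis_shift mulrC; congr (_ * _); rewrite /cis; congr cexp.
  by apply: complex_eqP => //=; rewrite intrN; ring.
rewrite /pshift; case: ifP => _; apply: eq_bigr => k _.
  by rewrite cis_shift cisT// mulr1 E mulrA.
by rewrite E mulrA.
Qed.

(** Translation multiplies the coefficient at [l] by an exponential and
    multiplication is convolution of the coefficients. Both are immediate when
    [f] is replaced by a partial sum of its Fourier series; the general case
    follows because the translation is isometric and [g] is bounded. Frequencies
    carry a minus sign since sequences are indexed by opposite frequencies. *)
Lemma fcoef_mul_pshift_cvg f g (B : R) s k : 0 < s < T -> cmeas D g ->
  (forall t, D t -> absq (g t) <= B) -> sqint D f ->
  forall e : R, 0 < e -> exists N, forall n, (N <= n)%N ->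
    absq (\sum_(l <- sym_range n)
            cis T l s * fcoef T g (l - k) * fcoef T f (- l)
          - fcoef T (fun t => g t * pshift T s f t) (- k)) <= e.
Proof.
move=> s0T mg gB sf.
have B0 : 0 <= B.
  by apply: le_trans (gB 0 _); rewrite ?absq_ge0//= in_itv/= lexx ltW.
have sg : sqint D g.
  by apply: sqint_eq (sqintM _ mg gB (sqint_cst T0 1)) => // t _; rewrite mulr1.
pose F n t := g t * pshift T s (partial_sum T (fcoef T f) n) t.
have sF n : sqint D (F n).
  by apply: (sqintM _ mg gB) => //; apply: sqint_pshift => //; exact: sqint_partial_sum.
have sFf : sqint D (fun t => g t * pshift T s f t).
  by apply: (sqintM _ mg gB) => //; exact: sqint_pshift.
have FE n : fcoef T (F n) (- k) = \sum_(l <- sym_range n)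
    cis T l s * fcoef T g (l - k) * fcoef T f (- l).
  rewrite (_ : F n = fun t => \sum_(l <- sym_range n)
      (fcoef T f l * cis T (- l) s) * (cis T l t * g t)); last first.
    apply/funext => t; rewrite /F pshift_partial_sum mulr_sumr.
    by apply: eq_bigr => l _; ring.
  rewrite fcoef_sum//; last first.
    by move=> l _; apply: sqintZ => //; exact: sqintM_cis.
  (* Symmetric ranges are stable under the change of sign of the frequency. *)
  have P : perm_eq (sym_range n) [seq - l | l <- sym_range n].
    apply: uniq_perm => [||l]; first exact: sym_range_uniq.
      by rewrite (map_inj_uniq oppr_inj) sym_range_uniq.
    rewrite -[in RHS](opprK l) (mem_map oppr_inj).
    by rewrite !mem_sym_range abszN.
  rewrite [LHS](perm_big _ P) big_map; apply: eq_bigr => l _.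
  rewrite opprK fcoefZ//; last exact: sqintM_cis.
  rewrite [X in _ * X](_ : _ = fcoef T g (l - k)); first ring.
  congr (_ * _); apply: eq_cintegral => t _; rewrite mulrA -cisD.
  by congr (cis T _ t * _); ring.
have Fcvg e : 0 < e -> exists N, forall n, (N <= n)%N ->
    (nsq D (fun t => F n t - g t * pshift T s f t)%R <= e%:E)%E.
  move=> e0; have eB : 0 < e / (B + 1) by rewrite divr_gt0// ltr_wpDl.
  have [N NP] := fourier_series_cvg T0 sf eB; exists N => n /NP {}NP.
  have sd : sqint D (fun t => partial_sum T (fcoef T f) n t - f t).
    by apply: sqintB => //; exact: sqint_partial_sum.
  rewrite (@eq_nsq _ _ _ (fun t => g t *
      pshift T s (fun t => partial_sum T (fcoef T f) n t - f t) t)); last first.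
    by move=> t _; rewrite -mulrBr; congr (_ * _); rewrite /pshift; case: ifP.
  have mps := cmeas_pshift s0T sd.1.
  apply: le_trans (nsqM_le (measurable_itv _) mps mg B0 gB) _.
  rewrite nsq_pshift//; last by case: sd.
  apply: le_trans (lee_wpmul2l _ NP) _; first by rewrite lee_fin.
  rewrite -EFinM lee_fin mulrA ler_pdivrMr ?ltr_wpDl// mulrC ler_pM2l//.
  by rewrite lerDl.
move=> e e0; have [N NP] := fcoef_lim T0 (- k) sF sFf Fcvg e0.
by exists N => n /NP; rewrite FE.
Qed.

End shifts.

(** * Hermitian norms *)

Section hermitian_norm.
Variable R : realType.

(** Jensen's inequality for the square: the discriminant of the nonnegative
    polynomial [\sum_i a i * (c i / a i - x) ^+ 2] in [x]. It takes the place
    of the triangle inequality, with weights adapted to each use. *)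
Lemma sqr_sum_weight (I : finType) (a c : I -> R) : (forall i, 0 < a i) ->
  (\sum_i c i) ^+ 2 <= (\sum_i a i) * \sum_i c i ^+ 2 / a i.
Proof.
move=> a0; set S := \sum_i c i; set q := \sum_i a i; set Q := \sum_i _.
have q0 : 0 <= q by apply: sumr_ge0 => i _; exact: ltW.
have E (x : R) : 0 <= Q - 2 * x * S + x ^+ 2 * q.
  have -> : Q - 2 * x * S + x ^+ 2 * q = \sum_i a i * (c i / a i - x) ^+ 2.
    rewrite /Q /S /q !mulr_sumr -sumrB -big_split /=; apply: eq_bigr => i _.
    by field; rewrite gt_eqF.
  by apply: sumr_ge0 => i _; rewrite mulr_ge0 ?sqr_ge0// ltW.
move: q0; rewrite le_eqVlt => /predU1P[q0|q0].
  have S0 : S = 0.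
    rewrite /S big1// => i _; exfalso.
    move: q0; rewrite /q (bigD1 i)//= => /eqP; rewrite eq_sym gt_eqF//.
    by rewrite ltr_pwDl// sumr_ge0// => j _; exact: ltW.
  by rewrite S0 expr0n /= -q0 mul0r.
have := E (S / q); have -> : Q - 2 * (S / q) * S + (S / q) ^+ 2 * q =
    (q * Q - S ^+ 2) / q by field; rewrite gt_eqF.
by rewrite pmulr_lge0 ?invr_gt0// subr_ge0.
Qed.

Lemma absq_sum_weight (I : finType) (a : I -> R) (z : I -> R[i]) :
  (forall i, 0 < a i) ->
  absq (\sum_i z i) <= (\sum_i a i) * \sum_i absq (z i) / a i.
Proof.
move=> a0; rewrite /absq Re_sum Im_sum.
under [X in _ <= _ * X]eq_bigr do rewrite mulrDl.
rewrite big_split mulrDr /=; apply: lerD; exact: sqr_sum_weight.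
Qed.

Variable d : nat.
Implicit Types (x y : 'cV[R[i]]_d) (A : 'M[R[i]]_d).

Definition vsq x : R := \sum_i absq (x i 0).

Lemma vnormE x : vnorm x = Num.sqrt (vsq x). Proof. by []. Qed.

Lemma vsq_ge0 x : 0 <= vsq x.
Proof. by apply: sumr_ge0 => i _; exact: absq_ge0. Qed.
Hint Resolve vsq_ge0 : core.

Lemma vnorm_sqr x : vnorm x ^+ 2 = vsq x.
Proof. by rewrite vnormE sqr_sqrtr. Qed.

Lemma vsqN x : vsq (- x) = vsq x.
Proof. by apply: eq_bigr => i _; rewrite mxE absqN. Qed.

Lemma vsqZ (z : R[i]) x : vsq (z *: x) = absq z * vsq x.
Proof. by rewrite /vsq mulr_sumr; apply: eq_bigr => i _; rewrite mxE absqM. Qed.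

Lemma vsqD_le x y : vsq (x + y) <= 2 * vsq x + 2 * vsq y.
Proof.
rewrite /vsq !mulr_sumr -big_split; apply: ler_sum => i _; rewrite mxE.
exact: absqD.
Qed.

Lemma vsq_eq0 x : vsq x = 0 -> x = 0.
Proof.
move=> /eqP; rewrite psumr_eq0; last by move=> i _; exact: absq_ge0.
move=> /allP x0; apply/matrixP => i j; rewrite ord1 mxE.
by apply: absq_eq0; apply/eqP/x0; rewrite mem_index_enum.
Qed.

Lemma absq_le_vsq x i : absq (x i 0) <= vsq x.
Proof.
by rewrite /vsq (bigD1 i)//= lerDl sumr_ge0// => j _; exact: absq_ge0.
Qed.

Lemma vsq_sum_weight (I : finType) (a : I -> R) (x : I -> 'cV[R[i]]_d) :
  (forall i, 0 < a i) ->
  vsq (\sum_i x i) <= (\sum_i a i) * \sum_i vsq (x i) / a i.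
Proof.
move=> a0; rewrite /vsq; under [X in _ <= _ * X]eq_bigr do rewrite mulr_suml.
rewrite exchange_big /= mulr_sumr; apply: ler_sum => k _.
by rewrite summxE; exact: absq_sum_weight.
Qed.

Definition frobenius_sq A : R := \sum_i \sum_j absq (A i j).

(** A crude bound, by which [mxnorm] is the supremum of a bounded set. *)
Lemma vsqM_frobenius A x : vsq (A *m x) <= d%:R * frobenius_sq A * vsq x.
Proof.
rewrite /frobenius_sq [X in X * _]mulr_sumr mulr_suml; apply: ler_sum => i _. rewrite mxE.
apply: le_trans (absq_sum_weight (a := fun=> 1) _ _) _ => //.
rewrite sumr_const card_ord -[leRHS]mulrA ler_wpM2l//.
rewrite mulr_suml; apply: ler_sum => j _; rewrite divr1 absqM.
by rewrite ler_wpM2l ?absq_ge0// absq_le_vsq.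
Qed.

Let mxnorm_set A :=
  [set vnorm (A *m x) | x in [set x : 'cV[R[i]]_d | vnorm x <= 1]].

Lemma mxnorm_ub A : ubound (mxnorm_set A) (Num.sqrt (d%:R * frobenius_sq A)).
Proof.
move=> _ [x /= x1 <-]; rewrite vnormE ler_wsqrtr//.
apply: le_trans (vsqM_frobenius A x) _; rewrite ler_piMr//.
  by rewrite mulr_ge0// sumr_ge0// => i _; rewrite sumr_ge0// => j _; exact: absq_ge0.
by rewrite -vnorm_sqr exprn_ile1// sqrtr_ge0.
Qed.

Lemma mxnorm_le_frobenius A : mxnorm A <= Num.sqrt (d%:R * frobenius_sq A).
Proof.
apply: ge_sup; last exact: mxnorm_ub.
exists (vnorm (A *m 0)); exists 0 => //=.
by rewrite vnormE /vsq big1 ?sqrtr0// => i _; rewrite mxE absq0.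
Qed.

Lemma vnormM_le1 A x : vnorm x <= 1 -> vnorm (A *m x) <= mxnorm A.
Proof.
move=> x1; apply: ub_le_sup; last by exists x.
by exists (Num.sqrt (d%:R * frobenius_sq A)); exact: mxnorm_ub.
Qed.

Lemma mxnorm_ge0 A : 0 <= mxnorm A.
Proof.
apply: le_trans (vnormM_le1 A (x := 0) _); first exact: sqrtr_ge0.
by rewrite vnormE /vsq big1 ?sqrtr0// => i _; rewrite mxE absq0.
Qed.

Lemma vsqM_mxnorm A x : vsq (A *m x) <= mxnorm A ^+ 2 * vsq x.
Proof.
have [x0|x0] := eqVneq (vsq x) 0.
  rewrite (vsq_eq0 x0) mulmx0 /vsq big1 => [|i _]; last by rewrite mxE absq0.
  by rewrite mulr_ge0 ?sqr_ge0// sumr_ge0// => i _; exact: absq_ge0.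
have nx0 : 0 < vnorm x by rewrite vnormE sqrtr_gt0 lt_neqAle eq_sym x0 vsq_ge0.
have i0 : 0 <= (vnorm x)^-1 by rewrite invr_ge0 ltW.
have := vnormM_le1 A (x := (vnorm x)^-1%:C *: x).
have absqr (r : R) : absq r%:C = r ^+ 2 by rewrite /absq /= expr0n /= addr0.
rewrite vnormE vsqZ absqr -vnorm_sqr -exprMn mulVf ?gt_eqF// expr1n sqrtr1.
move=> /(_ (lexx _)); rewrite -scalemxAr vnormE vsqZ absqr => H.
have : (vnorm x)^-1 ^+ 2 * vsq (A *m x) <= mxnorm A ^+ 2.
  rewrite -[leLHS]sqr_sqrtr ?mulr_ge0 ?sqr_ge0//.
  by rewrite ler_pXn2r// nnegrE ?sqrtr_ge0// mxnorm_ge0.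
by rewrite mulrC exprVn ler_pdivrMr ?exprn_gt0.
Qed.

End hermitian_norm.
#[global] Hint Resolve vsq_ge0 : core.

(** * Square integrable vector functions *)

Section vector_L2.
Variable R : realType.
Variable d : nat.
Local Notation mu := (@lebesgue_measure R).
Implicit Types (v w : R -> 'cV[R[i]]_d) (E : set R).

Definition vmeas E v := forall i, cmeas E (fun t => v t i 0).

Lemma vmeas_eq E v w : {in E, v =1 w} -> vmeas E v -> vmeas E w.
Proof. by move=> vw mv i; apply: cmeas_eq (mv i) => t tE; rewrite vw. Qed.

Lemma vmeasD E v w : vmeas E v -> vmeas E w -> vmeas E (fun t => v t + w t).
Proof.
by move=> mv mw i; under eq_fun do rewrite mxE; exact: cmeasD.
Qed.

Lemma vmeasZ E (g : R -> R[i]) v : cmeas E g -> vmeas E v ->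
  vmeas E (fun t => g t *: v t).
Proof.
by move=> mg mv i; under eq_fun do rewrite mxE; exact: cmeasM.
Qed.

Lemma vmeasN E v : vmeas E v -> vmeas E (fun t => - v t).
Proof.
by move=> mv i; under eq_fun do rewrite mxE; exact: cmeasN.
Qed.

Lemma vmeasB E v w : vmeas E v -> vmeas E w -> vmeas E (fun t => v t - w t).
Proof. by move=> mv mw; apply: vmeasD => //; exact: vmeasN. Qed.

Lemma vmeas_sum E (I : Type) (r : seq I) (P : pred I)
    (F : I -> R -> 'cV[R[i]]_d) :
  (forall i, P i -> vmeas E (F i)) ->
  vmeas E (fun t => \sum_(i <- r | P i) F i t).
Proof.
move=> mF k; under eq_fun do rewrite summxE.
by apply: cmeas_sum => i Pi; exact: mF.
Qed.

Definition mxmeas E (A : R -> 'M[R[i]]_d) :=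
  forall i j, cmeas E (fun t => A t i j).

Lemma vmeasM E (A : R -> 'M[R[i]]_d) v : mxmeas E A -> vmeas E v ->
  vmeas E (fun t => A t *m v t).
Proof.
move=> mA mv i; under eq_fun do rewrite mxE.
by apply: cmeas_sum => j _; apply: cmeasM.
Qed.

Lemma vmeasS E F v : measurable E -> F `<=` E -> vmeas E v -> vmeas F v.
Proof. by move=> mE FE mv i; exact: cmeasS (mv i). Qed.

Lemma measurable_vsq E v : vmeas E v -> measurable_fun E (fun t => vsq (v t)).
Proof.
move=> mv; rewrite /vsq.
by apply: measurable_sum => i; exact: measurable_absq (mv i).
Qed.

Lemma measurable_Evsq E v : vmeas E v ->
  measurable_fun E (fun t => (vsq (v t))%:E).
Proof. by move=> mv; apply/measurable_EFinP; exact: measurable_vsq. Qed.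

Definition vnsq E v : \bar R := (\int[mu]_(t in E) (vsq (v t))%:E)%E.

Lemma vnsq_ge0 E v : (0 <= vnsq E v)%E.
Proof. by apply: integral_ge0 => t _; rewrite lee_fin vsq_ge0. Qed.
Hint Resolve vnsq_ge0 : core.

Lemma vnsqE E v : measurable E -> vmeas E v ->
  vnsq E v = (\sum_i nsq E (fun t => v t i 0)%R)%E.
Proof.
move=> mE mv; rewrite /vnsq /nsq -ge0_integral_sum//.
- by apply: eq_integral => t _; rewrite /vsq sumEFin.
- by move=> i; exact: measurable_Eabsq (mv i).
- by move=> i t _; rewrite lee_fin absq_ge0.
Qed.

Lemma eq_vnsq E v w : {in E, v =1 w} -> vnsq E v = vnsq E w.
Proof. by move=> vw; apply: eq_integral => t tE; rewrite vw. Qed.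

Lemma vnsqN E v : vnsq E (fun t => - v t) = vnsq E v.
Proof. by apply: eq_integral => t _; rewrite vsqN. Qed.

Lemma vnsqD_le E v w : measurable E -> vmeas E v -> vmeas E w ->
  (vnsq E (fun t => v t + w t)%R <= 2%:E * vnsq E v + 2%:E * vnsq E w)%E.
Proof.
move=> mE mv mw; have m2 u : vmeas E u ->
    measurable_fun E (fun t => (2%:E * (vsq (u t))%:E)%E).
  by move=> mu_; apply/measurable_EFinP/measurable_funM => //;
    exact: measurable_vsq.
have p2 u t : E t -> (0 <= 2%:E * (vsq (u t))%:E)%E.
  by rewrite lee_fin mulr_ge0 ?vsq_ge0.
rewrite /vnsq -!ge0_integralZl_EFin//;
  do ?[exact: measurable_Evsq | by move=> t _; rewrite lee_fin vsq_ge0].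
rewrite -ge0_integralD//; do ?[exact: m2|exact: p2].
apply: ge0_le_integral => //.
- by move=> t _; rewrite lee_fin vsq_ge0.
- by apply: measurable_Evsq; exact: vmeasD.
- by apply: emeasurable_funD; exact: m2.
- by move=> t Et; rewrite lee_fin vsqD_le.
Qed.

Lemma vnsq0_ae E v : measurable E -> vmeas E v -> vnsq E v = 0%E ->
  {ae mu, forall t, E t -> v t = 0}.
Proof.
move=> mE mv v0; have H i : {ae mu, forall t, E t -> v t i 0 = 0}.
  apply: nsq0_ae => //; apply/eqP; rewrite eq_le nsq_ge0 andbT -v0 vnsqE//.
  by rewrite (bigD1 i)//= leeDl//; apply: sume_ge0 => j _; exact: nsq_ge0.
apply: aeS (ae_forall H) => t vt Et; apply/matrixP => i j; rewrite ord1 mxE.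
exact: vt.
Qed.

Lemma L2normE a b v : L2norm a b v = (vnsq `[a, b] v `^ 2^-1)%E.
Proof.
by rewrite /L2norm /vnsq; under eq_integral do rewrite vnorm_sqr.
Qed.

Lemma L2norm_sqr a b v : (L2norm a b v `^ 2)%E = vnsq `[a, b] v.
Proof.
by rewrite L2normE -poweRrM mulVf ?poweRe1// pnatr_eq0.
Qed.

(** This reduces operator norm estimates to squared norms. *)
Lemma L2norm_leP a b v w (e : R) : 0 <= e ->
  (L2norm a b v <= e%:E * L2norm a b w)%E <->
  (vnsq `[a, b] v <= (e ^+ 2)%:E * vnsq `[a, b] w)%E.
Proof.
move=> e0; have eE : ((e ^+ 2)%:E = e%:E `^ 2)%E.
  by rewrite poweR_EFin powR_mulrn.
have L0 u : (0 <= L2norm a b u)%E by exact: poweR_ge0.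
have I0 (x : \bar R) : (0 <= x)%E -> x \in `[0%E, +oo%E].
  by move=> x0; rewrite in_itv/= x0 leey.
rewrite -!L2norm_sqr eE -poweRM//; split => H.
  apply: gt0_ler_poweR => //; rewrite I0// mule_ge0//.
have r0 : (0 : R) <= 2^-1 by rewrite invr_ge0.
have := gt0_ler_poweR r0 (I0 _ (poweR_ge0 _ _)) (I0 _ (poweR_ge0 _ _)) H.
have K (x : \bar R) : (0 <= x)%E -> ((x `^ 2) `^ 2^-1)%E = x.
  by move=> x0; rewrite -poweRrM mulfV ?pnatr_eq0// poweRe1.
by rewrite !K// mule_ge0// lee_fin.
Qed.

Lemma inL2P a b v : inL2 a b v <-> vmeas `[a, b] v /\ (vnsq `[a, b] v < +oo)%E.
Proof.
split=> [[mv nv]|[mv nv]].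
  split; first by move=> i; have [] := mv i.
  by rewrite -L2norm_sqr; exact: poweR_lty.
split; first by move=> i; have [] := mv i.
by rewrite L2normE; exact: poweR_lty.
Qed.

Lemma inL2_sqint a b v : inL2 a b v <->
  forall i, sqint `[a, b] (fun t => v t i 0).
Proof.
rewrite inL2P; split=> [[mv nv] i|sv].
  split; first exact: mv.
  move: nv; rewrite vnsqE//; apply: le_lt_trans.
  by rewrite (bigD1 i)//= leeDl//; apply: sume_ge0 => j _; exact: nsq_ge0.
have mv : vmeas `[a, b] v by move=> i; have [] := sv i.
split => //; rewrite vnsqE//; apply: lte_sum_pinfty => i _.
by have [] := sv i.
Qed.

Lemma inL2B a b v w : inL2 a b v -> inL2 a b w -> inL2 a b (fun t => v t - w t).
Proof.
move=> /inL2_sqint sv /inL2_sqint sw; apply/inL2_sqint => i.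
by under [X in sqint _ X]eq_fun do rewrite !mxE; exact: sqintB.
Qed.

Lemma inL2_sum a b (I : Type) (r : seq I) (P : pred I)
    (F : I -> R -> 'cV[R[i]]_d) : (forall i, P i -> inL2 a b (F i)) ->
  inL2 a b (fun t => \sum_(i <- r | P i) F i t).
Proof.
move=> sF; apply/inL2_sqint => k; under [X in sqint _ X]eq_fun do rewrite summxE.
by apply: sqint_sum => // i /sF/inL2_sqint.
Qed.

End vector_L2.
#[global] Hint Resolve vnsq_ge0 : core.


(** * Fourier coefficients of vector functions *)

Section vector_fourier.
Variable R : realType.
Variable d : nat.
Variable T : R.
Hypothesis T0 : 0 < T.
Local Notation mu := (@lebesgue_measure R).
Local Notation D := (`[0%R, T]%classic : set R).
Implicit Types (v w : R -> 'cV[R[i]]_d) (x : int -> 'cV[R[i]]_d).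

Lemma inl2P x : inl2 x <->
  exists B, forall s, uniq s -> \sum_(k <- s) vsq (x k) <= B.
Proof.
rewrite /inl2; under eq_esum do rewrite vnorm_sqr.
set E := esum _ _; have E0 : (0 <= E)%E.
  by apply: esum_ge0 => k _; rewrite lee_fin vsq_ge0.
split=> [Ey|[B xB]].
  exists (fine E) => s us; rewrite -lee_fin fineK ?ge0_fin_numE// -sumEFin.
  rewrite fsbig_seq//; apply: ereal_sup_ubound; exists [set` s] => //.
  by split => //; exact: finite_seq.
apply: (@le_lt_trans _ _ B%:E); last exact: ltry.
apply: ge_ereal_sup => _ [A [finA _] <-].
by rewrite fsbig_finite//= sumEFin lee_fin xB// fset_uniq.
Qed.

Lemma L2_to_l2E v k i :
  L2_to_l2 T v k i 0 = fcoef T (fun t => v t i 0) (- k).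
Proof. by rewrite /L2_to_l2 /fourier !mxE fcoefE. Qed.

Lemma L2_to_l2_eqP v w : L2_to_l2 T v = L2_to_l2 T w <->
  forall i k, fcoef T (fun t => v t i 0) k = fcoef T (fun t => w t i 0) k.
Proof.
split=> [vw i k|vw].
  by rewrite -[k]opprK -!L2_to_l2E vw.
apply/funext => k; apply/matrixP => i j; rewrite ord1 !L2_to_l2E; exact: vw.
Qed.

Lemma inl2_fourier v : inL2 0 T v -> inl2 (L2_to_l2 T v).
Proof.
move=> /inL2_sqint sv; apply/inl2P.
exists (\sum_i fine (nsq D (fun t => v t i 0)) / T) => s us.
rewrite exchange_big /=; apply: ler_sum => i _; rewrite ler_pdivlMr// mulrC.
under eq_bigr do rewrite L2_to_l2E.
rewrite -(big_map _ xpredT (fun k => absq (fcoef T (fun t => v t i 0) k))).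
by apply: bessel => //; rewrite map_inj_uniq//; exact: oppr_inj.
Qed.

Theorem riesz_fischer_vector x : inl2 x ->
  exists2 v, inL2 0 T v & L2_to_l2 T v = x.
Proof.
move=> /inl2P[B xB].
have xiB i s : uniq s -> \sum_(k <- s) absq (x (- k) i 0) <= B.
  move=> us; rewrite -(big_map -%R xpredT (fun k => absq (x k i 0))).
  apply: le_trans (xB [seq - k | k <- s] _).
    by apply: ler_sum => k _; exact: absq_le_vsq.
  by rewrite map_inj_uniq//; exact: oppr_inj.
have /choice[f fP] : forall i, exists f, sqint D f /\
    forall k, fcoef T f k = x (- k) i 0.
  by move=> i; have [f fP _] := riesz_fischer T0 (@xiB i); exists f.
exists (fun t => \col_i f i t).
  apply/inL2_sqint => i; apply: sqint_eq (fP i).1 => t _; by rewrite mxE.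
apply/funext => k; apply/matrixP => i j; rewrite ord1 L2_to_l2E.
under [X in fcoef _ X]eq_fun do rewrite mxE.
by have [_ ->] := fP i; rewrite opprK.
Qed.

Lemma fourier_inj v w : inL2 0 T v -> inL2 0 T w ->
  L2_to_l2 T v = L2_to_l2 T w -> aeeq 0 T v w.
Proof.
move=> /inL2_sqint sv /inL2_sqint sw /L2_to_l2_eqP vw.
have H i : {ae mu, forall t, D t -> v t i 0 - w t i 0 = 0}.
  apply: (fourier_uniqueness T0); first exact: sqintB.
  by move=> k; rewrite fcoefB// vw subrr.
have := ae_forall H.
apply: aeS => t H0 tT; apply/matrixP => i j; rewrite ord1.
by apply/eqP; rewrite -subr_eq0; apply/eqP/H0; rewrite /= in_itv.
Qed.

Lemma aeeq_fourier v w : vmeas D v -> vmeas D w -> aeeq 0 T v w ->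
  L2_to_l2 T v = L2_to_l2 T w.
Proof.
move=> mv mw vw; apply/L2_to_l2_eqP => i k; apply: ae_eq_fcoef => //.
by apply: aeS vw => t + Dt => ->//; move: Dt; rewrite /= in_itv.
Qed.

Definition ccvg (u : nat -> R[i]) (l : R[i]) :=
  (fun n => Re (u n)) @ \oo --> Re l /\ (fun n => Im (u n)) @ \oo --> Im l.

Lemma ccvg_absq u l : (forall e : R, 0 < e -> exists N, forall n, (N <= n)%N ->
    absq (u n - l) <= e) -> ccvg u l.
Proof.
have sq (a e : R) : 0 < e -> a ^+ 2 <= e ^+ 2 -> `|a| <= e.
  by move=> e0; rewrite -[a ^+ 2]real_normK ?num_real// ler_pXn2r// nnegrE// ltW.
move=> ul; split; apply/cvgrPdist_le => e e0;
  have [N NP] := ul (e ^+ 2) (exprn_gt0 _ e0); exists N => // n /NP /= H;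
  rewrite distrC; apply: sq => //; apply: le_trans H.
  by apply: le_trans (Re_sqr_le _); rewrite cReD cReN.
by apply: le_trans (Im_sqr_le _); rewrite cImD cImN.
Qed.

Lemma ccvg_cst l : ccvg (fun=> l) l.
Proof. by split; exact: cvg_cst. Qed.

Lemma ccvgD u l u' l' : ccvg u l -> ccvg u' l' ->
  ccvg (fun n => u n + u' n) (l + l').
Proof.
move=> [a b] [a' b']; split.
  by rewrite cReD; under eq_fun do rewrite cReD; exact: cvgD.
by rewrite cImD; under eq_fun do rewrite cImD; exact: cvgD.
Qed.

Lemma ccvgZ z u l : ccvg u l -> ccvg (fun n => z * u n) (z * l).
Proof.
move=> [a b]; split.
  rewrite cReM; under eq_fun do rewrite cReM.
  by apply: cvgB; apply: cvgMr.
rewrite cImM; under eq_fun do rewrite cImM.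
by apply: cvgD; apply: cvgMr.
Qed.

Lemma ccvg_sum (I : Type) (r : seq I) (P : pred I) (u : I -> nat -> R[i]) l :
  (forall i, P i -> ccvg (u i) (l i)) ->
  ccvg (fun n => \sum_(i <- r | P i) u i n) (\sum_(i <- r | P i) l i).
Proof.
move=> ul; elim: r => [|i r IH].
  by rewrite big_nil; under eq_fun do rewrite big_nil; exact: ccvg_cst.
rewrite big_cons; under eq_fun do rewrite big_cons.
by case: (boolP (P i)) => Pi //; apply: ccvgD => //; exact: ul.
Qed.

Lemma vzsum_lim (u : int -> 'cV[R[i]]_d) (l : 'cV[R[i]]_d) :
  (forall i, ccvg (fun n => \sum_(k <- sym_range n) u k i 0) (l i 0)) ->
  vzsum u = l.
Proof.
move=> ul; apply/matrixP => i j; rewrite ord1 mxE; have [uR uI] := ul i.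
apply: complex_eqP; rewrite /= /zsum; apply: cvg_lim => //.
  apply: cvg_trans uR; apply: near_eq_cvg; apply: nearW => n.
  by rewrite big_sym_range Re_sum.
apply: cvg_trans uI; apply: near_eq_cvg; apply: nearW => n.
by rewrite big_sym_range Im_sum.
Qed.

End vector_fourier.

(** * The periodic operator in Fourier coordinates *)

Section periodic_operator.
Variable R : realType.
Variables d N : nat.
Variable T : R.
Variable tau : 'I_N.+1 -> R.
Variable D : 'I_N.+1 -> R -> 'M[R[i]]_d.
Variable p : R[i].
Local Notation mu := (@lebesgue_measure R).
Local Notation I := (`[0%R, T]%classic : set R).
Implicit Types (v w : R -> 'cV[R[i]]_d) (x : int -> 'cV[R[i]]_d).

Definition vpshift s v t : 'cV[R[i]]_d :=
  if t < s then v (t - s + T) else v (t - s).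

Lemma vpshiftE s v t i : vpshift s v t i 0 = pshift T s (fun u => v u i 0) t.
Proof. by rewrite /vpshift /pshift; case: ifP. Qed.

(** The delayed part of the system for the functions [v] such that
    [e ^ (p t) v(t)] is a solution with [v] periodic. *)
Definition Mop v t : 'cV[R[i]]_d :=
  \sum_j cexp (- (p * (tau j)%:C)) *: (D j t *m vpshift (tau j) v t).

Definition Sop v t := v t - Mop v t.

Lemma MopB v w t : Mop (fun u => v u - w u) t = Mop v t - Mop w t.
Proof.
rewrite /Mop -sumrB; apply: eq_bigr => j _; rewrite -scalerBr -mulmxBr.
by congr (_ *: (_ *m _)); rewrite /vpshift; case: ifP.
Qed.

Hypothesis T0 : 0 < T.
Hypothesis tau_itv : forall j, 0 < tau j < T.
Hypothesis D_meas : forall j, mxmeas I (D j).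

Lemma vmeas_vpshift s v : 0 < s < T -> vmeas I v -> vmeas I (vpshift s v).
Proof.
move=> s0T mv i; apply: cmeas_eq (cmeas_pshift s0T (mv i)) => t _.
by rewrite vpshiftE.
Qed.

Lemma vnsq_vpshift s v : 0 < s < T -> vmeas I v ->
  vnsq I (vpshift s v) = vnsq I v.
Proof.
move=> s0T mv; rewrite !vnsqE//; last exact: vmeas_vpshift.
apply: eq_bigr => i _; rewrite -(nsq_pshift s0T (mv i)).
by apply: eq_nsq => t _; rewrite vpshiftE.
Qed.

Lemma vmeas_Mop v : vmeas I v -> vmeas I (Mop v).
Proof.
move=> mv; apply: vmeas_sum => j _; apply: vmeasZ; first exact: cmeas_cst.
by apply: vmeasM => //; exact: vmeas_vpshift.
Qed.

Section fourier_side.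
Variable B : R.
Hypothesis D_bound : forall j t i k, absq (D j t i k) <= B.

Lemma Rblock_coef k l x i : (Rblock T tau D p k l *m x l) i 0 =
  \sum_j cexp (- (p * (tau j)%:C)) * \sum_m
    (cis T l (tau j) * fcoef T (fun t => D j t i m) (l - k) * x l m 0).
Proof.
rewrite mxE /Rblock; under eq_bigr do rewrite summxE mulr_suml.
rewrite exchange_big /=; apply: eq_bigr => j _; rewrite mulr_sumr.
apply: eq_bigr => m _.
have -> : cexp (- ((p - (0 +i* (l%:~R * omega T))) * (tau j)%:C)) =
    cexp (- (p * (tau j)%:C)) * cis T l (tau j).
  rewrite /cis -cexpD; congr cexp; case: (p) => b c.
  by apply: complex_eqP => /=; ring.
rewrite !mxE -fcoefE; move: (cexp _) (cis _ _ _) (fcoef _ _ _) => b c e.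
by rewrite !mulrA.
Qed.

(** The block of index [(k, l)] collects what the Fourier coefficient of [v] at
    [- l] contributes to that of the image at [- k]: the shift by [tau j] gives
    the exponential and the multiplication by [D j] the coefficient at
    [l - k]. *)
Theorem Rop_fourier v : inL2 0 T v ->
  Rop T tau D p (L2_to_l2 T v) = L2_to_l2 T (Sop v).
Proof.
move=> /inL2_sqint sv; apply/funext => k; rewrite /Rop.
have mv : vmeas I v by move=> i; case: (sv i).
have sDv j i m : sqint I (fun t => D j t i m * pshift T (tau j) (fun u => v u m 0) t).
  apply: (@sqintM _ _ _ _ B) => //; first exact: D_meas.
  by apply: sqint_pshift.
have sM i : sqint I (fun t => \sum_j cexp (- (p * (tau j)%:C)) *
    \sum_m D j t i m * pshift T (tau j) (fun u => v u m 0) t).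
  by apply: sqint_sum => // j _; apply: sqintZ => //; exact: sqint_sum.
have ME i : (fun t => Mop v t i 0) = (fun t => \sum_j cexp (- (p * (tau j)%:C)) *
    \sum_m D j t i m * pshift T (tau j) (fun u => v u m 0) t).
  apply/funext => t; rewrite summxE; apply: eq_bigr => j _; rewrite !mxE.
  by congr (_ * _); apply: eq_bigr => m _; rewrite vpshiftE.
have -> : L2_to_l2 T (Sop v) k = L2_to_l2 T v k - L2_to_l2 T (Mop v) k.
  apply/matrixP => i j; rewrite ord1 !mxE -/(fourier _ _ _) -!fcoefE.
  rewrite -fcoefB//; last by rewrite ME.
  by congr fcoef; apply/funext => t; rewrite !mxE.
congr (_ - _); apply: vzsum_lim => i; rewrite L2_to_l2E ME.
rewrite fcoef_sum//; last first.
  by move=> j _; apply: sqintZ => //; exact: sqint_sum.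
rewrite (eq_bigr (fun j => cexp (- (p * (tau j)%:C)) * \sum_m
    fcoef T (fun t => D j t i m * pshift T (tau j) (fun u => v u m 0) t) (- k)));
  last first.
  move=> j _; rewrite fcoefZ//; last exact: sqint_sum.
  by rewrite fcoef_sum.
rewrite [X in ccvg X](_ : _ = fun n => \sum_j cexp (- (p * (tau j)%:C)) *
  \sum_m \sum_(l <- sym_range n) cis T l (tau j) *
     fcoef T (fun t => D j t i m) (l - k) * fcoef T (fun t => v t m 0) (- l)).
  apply: ccvg_sum => j _; apply: ccvgZ; apply: ccvg_sum => m _.
  apply: ccvg_absq; apply: (fcoef_mul_pshift_cvg T0 _ (B := B)) => //.
  exact: D_meas.
apply/funext => n; under eq_bigr do rewrite Rblock_coef.
rewrite exchange_big /=; apply: eq_bigr => j _; rewrite -mulr_sumr.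
congr (_ * _); rewrite exchange_big /=; apply: eq_bigr => m _.
by apply: eq_bigr => l _; rewrite L2_to_l2E.
Qed.

End fourier_side.

Section contraction.
Variable a : 'I_N.+1 -> R.
Hypothesis a_gt0 : forall j, 0 < a j.
Hypothesis a_lt1 : \sum_j a j < 1.
Hypothesis a_bound : forall j t y,
  vsq (cexp (- (p * (tau j)%:C)) *: (D j t *m y)) <= a j ^+ 2 * vsq y.

Let q := \sum_j a j.
Let q_ge0 : 0 <= q. Proof. by apply: sumr_ge0 => j _; exact: ltW. Qed.

(** Positive weights, instead of the norms that they bound, keep the quotients
    in Jensen's inequality meaningful when some coefficient vanishes. *)
Lemma vsq_weighted_sum_le (x : 'I_N.+1 -> 'cV[R[i]]_d) t :
  vsq (\sum_j cexp (- (p * (tau j)%:C)) *: (D j t *m x j)) <=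
  q * \sum_j a j * vsq (x j).
Proof.
apply: le_trans (vsq_sum_weight _ a_gt0) _; apply: ler_wpM2l => //.
apply: ler_sum => j _; rewrite ler_pdivrMr//.
by apply: le_trans (a_bound j t _) _; rewrite expr2 mulrAC.
Qed.

Definition shift_energy v t := \sum_j a j * vsq (vpshift (tau j) v t).

Lemma shift_energy_ge0 v t : 0 <= shift_energy v t.
Proof. by apply: sumr_ge0 => j _; rewrite mulr_ge0 ?vsq_ge0// ltW. Qed.

Lemma measurable_shift_energy v : vmeas I v -> measurable_fun I (shift_energy v).
Proof.
move=> mv; apply: measurable_sum => j; apply: measurable_funM => //.
exact: measurable_vsq (vmeas_vpshift (tau_itv j) mv).
Qed.

Lemma integral_shift_energy v : vmeas I v ->
  (\int[mu]_(t in I) (q * shift_energy v t)%:E = (q ^+ 2)%:E * vnsq I v)%E.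
Proof.
move=> mv; have mvp j := measurable_vsq (vmeas_vpshift (tau_itv j) mv).
under eq_integral do rewrite EFinM.
rewrite ge0_integralZl_EFin//; last 2 first.
- by move=> t _; rewrite lee_fin shift_energy_ge0.
- by apply/measurable_EFinP; exact: measurable_shift_energy.
under eq_integral do rewrite /shift_energy -sumEFin.
rewrite ge0_integral_sum//; last 2 first.
- move=> j; apply/measurable_EFinP.
  exact: (measurable_funM (measurable_cst (a j)) (mvp j)).
- by move=> j t _; rewrite lee_fin mulr_ge0 ?vsq_ge0// ltW.
rewrite (eq_bigr (fun j => (a j)%:E * vnsq I v)%E); last first.
  move=> j _; rewrite -(vnsq_vpshift (tau_itv j) mv) /vnsq.
  under eq_integral do rewrite EFinM.
  apply: ge0_integralZl_EFin => //.
  - by move=> t _; rewrite lee_fin vsq_ge0.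
  - by apply/measurable_EFinP; exact: (mvp j).
  - by rewrite ltW.
rewrite -ge0_sume_distrl; last by move=> j _; rewrite lee_fin ltW.
by rewrite sumEFin muleA -EFinM expr2.
Qed.

(** Shifts are isometric over one period, so the delayed part multiplies norms
    by at most [q]. *)
Lemma vnsq_Mop_le v : vmeas I v -> (vnsq I (Mop v) <= (q ^+ 2)%:E * vnsq I v)%E.
Proof.
move=> mv; rewrite -integral_shift_energy//; apply: ge0_le_integral => //.
- by move=> t _; rewrite lee_fin vsq_ge0.
- exact: measurable_Evsq (vmeas_Mop mv).
- apply/measurable_EFinP; apply: measurable_funM => //.
  exact: measurable_shift_energy.
- by move=> t _; rewrite lee_fin; exact: vsq_weighted_sum_le.
Qed.

(** The difference [u] of two functions with the same image is a fixed point of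
    the strict contraction [Mop]. *)
Theorem Sop_inj v w : inL2 0 T v -> inL2 0 T w -> aeeq 0 T (Sop v) (Sop w) ->
  aeeq 0 T v w.
Proof.
move=> sv sw vw; pose u t := v t - w t.
have /inL2P[mu_ nu] : inL2 0 T u by exact: inL2B.
have nuM : vnsq I u = vnsq I (Mop u).
  apply: ge0_ae_eq_integral => //.
  - exact: measurable_Evsq.
  - by apply: measurable_Evsq; exact: vmeas_Mop.
  - by move=> t _; rewrite lee_fin vsq_ge0.
  - by move=> t _; rewrite lee_fin vsq_ge0.
  apply: aeS vw => t + It; move: It; rewrite /= in_itv/= => It /(_ It) H.
  rewrite MopB /u; congr (vsq _)%:E; move: H; rewrite /Sop.
  move=> /(canRL (subrK _)) ->; apply/eqP; rewrite subr_eq.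
  by rewrite -[X in X == _]addrA addrC [- _ + _]addrC.
have : vnsq I u = 0%E.
  have := vnsq_Mop_le mu_; rewrite -nuM.
  have ufin : vnsq I u \is a fin_num by rewrite ge0_fin_numE ?vnsq_ge0.
  rewrite -(fineK ufin) -EFinM lee_fin => H; congr _%:E.
  have := vnsq_ge0 I u; rewrite -(fineK ufin) lee_fin => u0.
  have q2 : q ^+ 2 < 1 by rewrite exprn_ilt1.
  apply/eqP; rewrite eq_le u0 andbT leNgt; apply/negP => u1.
  by move: H; apply/negP; rewrite -ltNge -[ltRHS]mul1r ltr_pM2r.
move=> u0E; apply: aeS (vnsq0_ae (measurable_itv _) mu_ u0E) => t ut It.
by apply/eqP; rewrite -subr_eq0; apply/eqP/ut; rewrite /= in_itv.
Qed.

End contraction.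
End periodic_operator.

(** * Recursion for the coefficients of the fundamental solution *)

Section delay_recursion.
Variable R : realType.
Variables d N : nat.
Variable T : R.
Variable tau : 'I_N.+1 -> R.
Variable D : 'I_N.+1 -> R -> 'M[R[i]]_d.
Hypothesis tau_gt0 : forall j, 0 < tau j.
Local Notation F := (delay_sums tau).

Lemma delay_sums_ge0 f : F f -> 0 <= f.
Proof.
by move=> [n ->]; apply: sumr_ge0 => l _; rewrite mulr_ge0// ltW.
Qed.

Lemma delay_sums0 : F 0.
Proof. by exists (fun=> 0%N); rewrite big1// => l _; rewrite mul0r. Qed.

Lemma delay_sumsD f j : F f -> F (f + tau j).
Proof.
move=> [n ->]; exists (fun l => (n l + (l == j))%N).
under [RHS]eq_bigr do rewrite natrD mulrDl.
rewrite big_split /=; congr (_ + _).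
rewrite (bigD1 j)//= eqxx mul1r big1 ?addr0// => l /negPf ->.
by rewrite mul0r.
Qed.

(** A delay sum at most [x] uses the delay [tau l] at most [x / tau l] times. *)
Lemma finite_delay_sums x : finite_set (F `&` [set f | f <= x]).
Proof.
pose B l := Num.bound `|x / tau l|.
pose M := \max_l B l.
have MP l : x < M%:R * tau l.
  rewrite -ltr_pdivrMr//; apply: le_lt_trans (ler_norm _) _.
  apply: lt_le_trans (archi_boundP (normr_ge0 _)) _.
  by rewrite ler_nat; exact: leq_bigmax.
apply: (@sub_finite_set _ _ [set \sum_l (g l)%:R * tau l |
    g in [set: {ffun 'I_N.+1 -> 'I_M.+1}]]); last exact/finite_image/finite_finset.
move=> _ [[n ->] /= nx].
have nM l : (n l < M.+1)%N.
  rewrite ltnS -(ler_nat R) -(ler_pM2r (tau_gt0 l)) ltW//.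
  apply: le_lt_trans (MP l); apply: le_trans nx.
  by rewrite (bigD1 l)//= lerDl sumr_ge0// => i _; rewrite mulr_ge0// ltW.
by exists [ffun l => Ordinal (nM l)] => //; apply: eq_bigr => l _; rewrite ffunE.
Qed.

Lemma finite_delay_sumsI (P : set R) x : (forall f, P f -> f <= x) ->
  finite_set (F `&` P).
Proof.
by move=> Px; apply: sub_finite_set (finite_delay_sums x) => f [Ff /Px].
Qed.

(** Sums over the delay sums up to [f] and up to [x] differ by the term at [f]
    only, which isolates a coefficient in an identity between such sums. *)
Lemma delay_sums_gap f : F f -> 0 < f -> exists2 x, 0 <= x &
  F `&` `[0, f] = (F `&` `[0, x]) `|` [set f] /\ x < f.
Proof.
move=> Ff f0; pose A := F `&` [set g | g < f].
have finA : finite_set A by apply: (@finite_delay_sumsI _ f) => g /ltW.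
pose x := \big[Num.max/0]_(g <- fset_set A) g.
have x0 : 0 <= x by apply: bigmax_ge_id.
have xf : x < f.
  rewrite /x big_seq; apply: (big_ind (fun y => y < f)) => //.
    by move=> u v uf vf; rewrite gt_max uf.
  by move=> g; rewrite in_fset_set// => /set_mem[_].
exists x => //; split => //; apply/seteqP; split => g /=.
  rewrite !in_itv/= => -[Fg /andP[g0 gf]].
  have [->|/eqP gNf] := eqVneq g f; [by right|left; split => //].
  rewrite g0 /x; apply: le_bigmax_seq => //.
  rewrite in_fset_set//; apply/mem_set; split => //=.
  by rewrite lt_neqAle gf andbT; apply/eqP.
rewrite !in_itv/= => -[[Fg /andP[g0 gx]]|->].
  by split => //; rewrite g0 (le_trans gx)// ltW.
by split => //; rewrite ltW//=.
Qed.

Lemma fsum_shift (V : nmodType) (G : R -> V) (P : set R) j :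
  \sum_(f \in F `&` P) (if f - tau j \in F then G (f - tau j) else 0) =
  \sum_(g \in F `&` [set g | P (g + tau j)]) G g.
Proof.
pose A := F `&` [set g | P (g + tau j)].
have -> : \sum_(g \in A) G g =
    \sum_(f \in [set g + tau j | g in A]) G (f - tau j).
  rewrite fsbig_image; last by move=> u v _ _ /addIr.
  by apply: eq_fsbigr => g _; rewrite addrK.
transitivity (\sum_(f \in F `&` P)
    (if f \in [set f | F (f - tau j)] then G (f - tau j) else 0)).
  apply: eq_fsbigr => f _;
    case: (boolP (f - tau j \in F)) => [/set_mem Fj|/negP Fj].
    by rewrite mem_set.
  by rewrite memNset// => /= Fj'; apply: Fj; rewrite mem_set.
rewrite -fsbig_mkcondr; apply: eq_fsbigl; apply/seteqP; split => f /=.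
  by move=> [[Ff Pf] Ffj]; exists (f - tau j); rewrite ?subrK//; split => //=;
    rewrite subrK.
move=> [g [Fg Pg] <-]; split; last by rewrite addrK.
by split => //; exact: delay_sumsD.
Qed.

Variables (delta : R) (X C : R -> R -> 'M[R[i]]_d).
Hypothesis X_fund : fundamental_solution tau D X.
Hypothesis C_coefs : fundamental_coefs T tau delta X C.

Definition coef_rhs f t : 'M[R[i]]_d :=
  \sum_j D j t *m (if f - tau j \in F then C (f - tau j) (t - tau j) else 0)
  - (if f == 0 then 1%:M else 0).

(** The equation of the fundamental solution at [(t, t - x)], with both sides
    expanded. *)
Lemma sum_coef_eq x t : 0 <= x ->
  \sum_(f \in F `&` `[0, x]) C f t = \sum_(f \in F `&` `[0, x]) coef_rhs f t.
Proof.
move=> x0; have fin y : finite_set (F `&` `[0, y]).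
  by apply: (@finite_delay_sumsI _ y) => f; rewrite /= in_itv/= => /andP[].
have [_ XC] := C_coefs; have XE := XC t (t - x).
have E : t - (t - x) = x by ring.
rewrite E in XE; rewrite -[LHS]opprK -XE; last by lra.
have [_ XR] := X_fund t (t - x); rewrite XR; last by lra.
have Xj j : X (t - tau j) (t - x) = - \sum_(f \in F `&` `[0, x])
    (if f - tau j \in F then C (f - tau j) (t - tau j) else 0).
  rewrite (fsum_shift (fun g => C g (t - tau j))) (_ : _ `&` _ = F `&` `[0, x - tau j]); last first.
    apply/seteqP; split => g /= [Fg]; rewrite !in_itv/= => /andP[? ?];
      split => //; rewrite ?in_itv/=; have := delay_sums_ge0 Fg;
      have := tau_gt0 j; lra.
  have [xj|xj] := leP (tau j) x.
    rewrite XC; last by lra.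
    by have -> : t - tau j - (t - x) = x - tau j by ring.
  have [XZ _] := X_fund (t - tau j) (t - x); rewrite XZ; last by lra.
  rewrite (_ : _ `&` _ = set0) ?fsbig_set0 ?oppr0//.
  by rewrite -subset0 => g /= [_]; rewrite in_itv/=; lra.
rewrite [RHS]fsbig_finite//= /coef_rhs sumrB exchange_big /= opprD addrC.
congr (_ - _); last first.
  rewrite -big_mkcond /= -big_filter filter_pred1_uniq ?fset_uniq//.
    by rewrite big_seq1.
  rewrite in_fset_set//; apply/mem_set; split; first exact: delay_sums0.
  by rewrite /= in_itv/= lexx.
rewrite -sumrN; apply: eq_bigr => j _; rewrite Xj mulmxN opprK.
by rewrite fsbig_finite//= mulmx_sumr.
Qed.

(** The increment of both sides of [sum_coef_eq] across the gap below [f]. *)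
Lemma coef_recursion f t : F f -> C f t = coef_rhs f t.
Proof.
move=> Ff; have := delay_sums_ge0 Ff; rewrite le_eqVlt => /predU1P[<-|f0].
  have := sum_coef_eq t (lexx 0); rewrite (_ : F `&` `[0, 0] = [set 0]).
    by rewrite !fsbig_set1.
  apply/seteqP; split => g /=; first by case=> _; rewrite in_itv/= -eq_le => /eqP.
  by move=> ->; rewrite in_itv/= lexx; split => //; exact: delay_sums0.
have [x x0 [E xf]] := delay_sums_gap Ff f0.
have fin : finite_set (F `&` `[0, x]).
  by apply: (@finite_delay_sumsI _ x) => g; rewrite /= in_itv/= => /andP[].
have disj : (F `&` `[0, x]) `&` [set f] `<=` set0.
  move=> g /= [[_ gx] gf]; move: gx.
  by rewrite gf in_itv/= (leNgt f) xf andbF.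
have := sum_coef_eq t (ltW f0); rewrite E !fsbigU0//.
by rewrite !fsbig_set1 (sum_coef_eq t x0) => /addrI.
Qed.

(** The operators [Hop C k] give the restrictions to the successive periods of
    this single function: [Hop C k v t] is its value at [k%:R * T + t]. *)
Definition causal_sum (v : R -> 'cV[R[i]]_d) (s : R) : 'cV[R[i]]_d :=
  - \sum_(f \in F `&` [set f | 0 <= s - f < T]) C f s *m v (s - f).

Lemma causal_sum_lt0 v s : s < 0 -> causal_sum v s = 0.
Proof.
move=> s0; rewrite /causal_sum (_ : _ `&` _ = set0) ?fsbig_set0 ?oppr0//.
rewrite -subset0 => f /= [/delay_sums_ge0 f0 /andP[sf _]]; lra.
Qed.

(** Applying [coef_recursion] to each term splits one delay off the delay sum;
    the exceptional term at the delay sum [0] is the source. *)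
Lemma causal_sum_recursion v s : causal_sum v s =
  (if 0 <= s < T then v s else 0) +
  \sum_j D j s *m causal_sum v (s - tau j).
Proof.
have fin u : finite_set (F `&` [set f | 0 <= u - f < T]).
  by apply: (@finite_delay_sumsI _ u) => f /=; rewrite subr_ge0 => /andP[].
rewrite {1}/causal_sum (eq_fsbigr (fun f =>
    \sum_j D j s *m ((if f - tau j \in F then C (f - tau j) (s - tau j) else 0)
                     *m v (s - f)) - (if f == 0 then v (s - f) else 0))); last first.
  move=> f /set_mem[Ff _]; rewrite coef_recursion// /coef_rhs mulmxBl mulmx_suml.
  congr (_ - _); last by case: ifP; rewrite ?mul1mx ?mul0mx.
  by apply: eq_bigr => j _; rewrite mulmxA.
rewrite fsbig_finite//= sumrB opprB; congr (_ + _).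
  rewrite -big_mkcond /=; case: ifPn => sT.
    rewrite -big_filter filter_pred1_uniq ?fset_uniq//.
      by rewrite big_seq1 subr0.
    rewrite in_fset_set//; apply/mem_set; split; first exact: delay_sums0.
    by rewrite /= subr0.
  rewrite big_seq_cond big_pred0// => f; apply/negP => /andP[].
  rewrite in_fset_set// => /set_mem[_ /= sfT] /eqP f0.
  by move: sfT; rewrite f0 subr0; apply/negP.
rewrite exchange_big /= -sumrN; apply: eq_bigr => j _.
rewrite -mulmx_sumr /causal_sum mulmxN; congr (- (_ *m _)).
pose G g := C g (s - tau j) *m v (s - tau j - g).
transitivity (\sum_(f \in F `&` [set f | 0 <= s - f < T])
    (if f - tau j \in F then G (f - tau j) else 0)).
  rewrite [RHS]fsbig_finite//=; apply: eq_bigr => f _; case: ifP => _.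
    by congr (_ *m v _); ring.
  by rewrite mul0mx.
rewrite fsum_shift; apply: eq_fsbigl; apply/seteqP; split => g /= [Fg];
  by rewrite (_ : s - (g + tau j) = s - tau j - g)//; ring.
Qed.

End delay_recursion.

(** * Exponential decay of causal solutions *)

Section causal_energy.
Variable R : realType.
Variables d N : nat.
Variable T : R.
Variable tau : 'I_N.+1 -> R.
Variable D : 'I_N.+1 -> R -> 'M[R[i]]_d.
Variable p : R[i].
Local Notation mu := (@lebesgue_measure R).
Hypothesis T0 : 0 < T.
Hypothesis tau0_gt0 : 0 < tau ord0.
Hypothesis tau0_le : forall j, tau ord0 <= tau j.
Hypothesis D_meas : forall j, mxmeas setT (D j).
Variables (phi z : R -> 'cV[R[i]]_d).
Hypothesis phi_meas : vmeas `[0, T] phi.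
Hypothesis z_lt0 : forall s, s < 0 -> z s = 0.
Let src s := if 0 <= s < T then phi s else 0.
Hypothesis z_recursion : forall s, z s =
  src s + \sum_j cexp (- (p * (tau j)%:C)) *: (D j s *m z (s - tau j)).

Let half (x : R) : set R := [set s | s < x].

Let mhalf x : measurable (half x).
Proof.
have -> : half x = `]-oo, x[%classic.
  by apply/seteqP; split => s; rewrite /= in_itv.
exact: measurable_itv.
Qed.
#[local] Hint Extern 0 (measurable (half _)) => solve [exact: mhalf] : core.

Lemma vmeas_if (b : R -> bool) (v w : R -> 'cV[R[i]]_d) :
  measurable_fun setT b -> vmeas setT v -> vmeas setT w ->
  vmeas setT (fun s => if b s then v s else w s).
Proof.
move=> mb mv mw i; rewrite (_ : (fun s => _) =
  fun s => if b s then v s i 0 else w s i 0); first exact: cmeas_if.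
by apply/funext => s; case: ifP.
Qed.

Lemma vmeas_cst E (x : 'cV[R[i]]_d) : vmeas E (fun=> x).
Proof. by move=> i; exact: cmeas_cst. Qed.

Lemma vmeas_src : vmeas setT src.
Proof.
move=> i; have := cmeas_patch (measurable_itv _) (phi_meas i).
set f := (fun t => _) => mf.
apply: (@cmeas_eq _ _ (fun s => if s < T then f s else 0)).
  move=> s _; rewrite /src /f; case: ltP => sT; last by rewrite andbF mxE.
  rewrite andbT; case: ifPn => [/set_mem/=|/negP]; first by rewrite in_itv/= => /andP[->].
  move=> H; case: ifPn => s0; last by rewrite mxE.
  by exfalso; apply: H; apply/mem_set; rewrite /= in_itv/= s0 ltW.
by apply: cmeas_if => //; exact: measurable_fun_ltr.
Qed.

(** By induction over the half-lines below [n%:R * tau ord0]: there the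
    recursion expresses [z] by its values below [(n - 1)%:R * tau ord0]. *)
Lemma vmeas_causal : vmeas setT z.
Proof.
have step n : vmeas setT (fun s => if s < n%:R * tau ord0 then z s else 0).
  elim: n => [|n IH].
    apply: (@vmeas_eq _ _ _ (fun=> 0)); last exact: vmeas_cst.
    by move=> s _; rewrite mul0r; case: ltP => // /z_lt0.
  apply: (@vmeas_eq _ _ _ (fun s => if s < n.+1%:R * tau ord0 then
      src s + \sum_j cexp (- (p * (tau j)%:C)) *: (D j s *m
        (if s - tau j < n%:R * tau ord0 then z (s - tau j) else 0)) else 0)).
    move=> s _; case: ifP => // sn; rewrite [in RHS]z_recursion; congr (_ + _).
    apply: eq_bigr => j _; rewrite ifT// ltrBlDr; apply: lt_le_trans sn _.
    by rewrite -natr1 mulrDl mul1r lerD2l.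
  apply: vmeas_if; [exact: measurable_fun_ltr| |exact: vmeas_cst].
  apply: vmeasD; first exact: vmeas_src.
  apply: vmeas_sum => j _; apply: vmeasZ; first exact: cmeas_cst.
  apply: vmeasM => // i.
  exact: (@cmeas_shift _ _ (- tau j) (IH i)).
move=> i.
have -> : [set: R] = \bigcup_n [set s | s < n%:R * tau ord0].
  apply/seteqP; split => // s _; exists (Num.bound `|s / tau ord0|) => //=.
  rewrite -ltr_pdivrMr//; apply: le_lt_trans (ler_norm _) _.
  exact: archi_boundP.
have mA n : measurable [set s | s < n%:R * tau ord0] by exact: mhalf.
have H n : cmeas [set s | s < n%:R * tau ord0] (fun s => z s i 0).
  apply: cmeas_eq (cmeasS (E := [set s | s < n%:R * tau ord0]) measurableT _ (step n i)) => //.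
  by move=> s /set_mem /= ->.
by split; apply/measurable_fun_bigcup => // n; have [] := H n.
Qed.

Variable a : 'I_N.+1 -> R.
Hypothesis a_gt0 : forall j, 0 < a j.
Hypothesis a_bound : forall j t y,
  vsq (cexp (- (p * (tau j)%:C)) *: (D j t *m y)) <= a j ^+ 2 * vsq y.
Variable beta : R.
Hypothesis beta_gt0 : 0 < beta.
(* The weight [expR (2 * beta * s)] of the energy turns [a j ^+ 2] into
   [b j ^+ 2], one factor of which cancels in Jensen's inequality. *)
Let b j := a j * expR (beta * tau j).
Let q := \sum_j b j.
Hypothesis q_lt1 : q < 1.

Let b_gt0 j : 0 < b j. Proof. by rewrite mulr_gt0// expR_gt0. Qed.
Let q_gt0 : 0 < q.
Proof.
rewrite /q (bigD1 ord0)//= ltr_pwDl// sumr_ge0// => j _; exact: ltW.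
Qed.

Let g s := expR (2 * beta * s) * vsq (z s).

Let g_ge0 s : 0 <= g s. Proof. by rewrite mulr_ge0 ?expR_ge0 ?vsq_ge0. Qed.

Let gE_ge0 s : (0 <= (g s)%:E)%E. Proof. by rewrite lee_fin. Qed.
#[local] Hint Resolve gE_ge0 : core.

Lemma vsqD_weight (x y : 'cV[R[i]]_d) : vsq (x + y) <= vsq x / (1 - q) + vsq y / q.
Proof.
have q1 : 0 < 1 - q by rewrite subr_gt0.
have := @vsq_sum_weight _ _ bool (fun c => if c then 1 - q else q)
  (fun c => if c then x else y).
rewrite !big_bool /= subrK mul1r; apply.
by case.
Qed.

(** Convexity of the square with the weight [1 - q] for the source and the
    weights [b j] for the delayed terms, of total [1]. *)
Lemma energy_recursion s : g s <=
  expR (2 * beta * T) / (1 - q) * vsq (src s) + \sum_j b j * g (s - tau j).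
Proof.
have q1 : 0 < 1 - q by rewrite subr_gt0.
rewrite /g {1}z_recursion.
apply: le_trans (ler_wpM2l (expR_ge0 _) (vsqD_weight _ _)) _.
rewrite mulrDr; apply: lerD.
  rewrite mulrA [leRHS]mulrAC; apply: ler_wpM2r; first by rewrite invr_ge0 ltW.
  rewrite /src; case: ifPn => [/andP[s0 sT]|_].
    by rewrite ler_wpM2r ?vsq_ge0// ler_expR ler_wpM2l ?mulr_ge0 ?ltW.
  by rewrite (_ : vsq 0 = 0) ?mulr0// /vsq big1// => i _; rewrite mxE absq0.
rewrite mulrA ler_pdivrMr// [leRHS]mulrC.
apply: (@le_trans _ _ (q * (expR (2 * beta * s) * \sum_j
    vsq (cexp (- (p * (tau j)%:C)) *: (D j s *m z (s - tau j))) / b j))).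
  rewrite [leRHS]mulrCA; apply: ler_wpM2l; first exact: expR_ge0.
  exact: vsq_sum_weight.
apply: ler_wpM2l; first exact: ltW.
rewrite mulr_sumr; apply: ler_sum => j _.
rewrite mulrA ler_pdivrMr//; apply: le_trans (ler_wpM2l (expR_ge0 _) (a_bound _ _ _)) _.
rewrite /b; have -> : 2 * beta * s = 2 * beta * (s - tau j) + beta * tau j + beta * tau j.
  by ring.
rewrite !expRD le_eqVlt; apply/orP; left; apply/eqP; ring.
Qed.

Let mg E : measurable E -> measurable_fun E g.
Proof.
move=> mE; apply: measurable_funM.
  apply: measurable_funTS; apply: continuous_measurable_fun => s.
  apply: continuous_comp; last exact: continuous_expR.
  exact: mulrl_continuous.
by apply: measurable_vsq; apply: vmeasS vmeas_causal.
Qed.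

Let c := expR (2 * beta * T) / (1 - q).
Let c_ge0 : 0 <= c.
Proof. by rewrite divr_ge0 ?expR_ge0// subr_ge0 ltW. Qed.

Lemma integral_half_src x :
  (\int[mu]_(s in half x) (vsq (src s))%:E <= vnsq `[0%R, T] phi)%E.
Proof.
apply: (@le_trans _ _ (\int[mu]_s (vsq (src s))%:E)%E).
  apply: ge0_subset_integral => //; first exact: measurable_Evsq vmeas_src.
  by move=> s _; rewrite lee_fin vsq_ge0.
rewrite /vnsq [leRHS]integral_mkcond; apply: ge0_le_integral => //.
- by move=> s _; rewrite lee_fin vsq_ge0.
- exact: measurable_Evsq vmeas_src.
- apply/measurable_restrict => //; rewrite setTI; exact: measurable_Evsq.
move=> s _; rewrite patchE /src; case: ifPn => [sT|_]; last first.
  rewrite (_ : vsq 0 = 0); last by rewrite /vsq big1// => i _; rewrite mxE absq0.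
  by case: ifP => // _; rewrite lee_fin vsq_ge0.
rewrite mem_set//= in_itv/=; have /andP[-> sT'] := sT.
exact: ltW.
Qed.

(** All delays are at least [tau ord0], so a translation by [tau j] maps the
    half-line below [n.+1%:R * tau ord0] into the one below
    [n%:R * tau ord0]. *)
Lemma integral_half_energy_step n :
  (\int[mu]_(s in half (n.+1%:R * tau ord0)) (g s)%:E <=
   c%:E * vnsq `[0%R, T] phi +
   q%:E * \int[mu]_(s in half (n%:R * tau ord0)) (g s)%:E)%E.
Proof.
set x := n.+1%:R * tau ord0.
have mgE (E : set R) : measurable E -> measurable_fun E (fun s => (g s)%:E).
  by move=> mE; apply/measurable_EFinP; exact: mg.
have mgr j (E : set R) : measurable E -> measurable_fun E (fun s => g (s - tau j)).
  move=> mE; apply: measurable_funTS.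
  exact: (measurableT_comp (mg measurableT) (measurable_transl (- tau j))).
have mgj j (E : set R) : measurable E -> measurable_fun E (fun s => (g (s - tau j))%:E).
  by move=> mE; apply/measurable_EFinP; exact: mgr.
have mbj j : measurable_fun (half x) (fun s => (b j * g (s - tau j))%:E).
  apply/measurable_EFinP; apply: measurable_funM => //.
  by apply: mgr.
have mcs : measurable_fun (half x) (fun s => (c * vsq (src s))%:E).
  apply/measurable_EFinP; apply: measurable_funM => //.
  by apply: measurable_funTS; exact: measurable_vsq vmeas_src.
have gE j : (\int[mu]_(s in half x) (b j * g (s - tau j))%:E <=
    (b j)%:E * \int[mu]_(s in half (n%:R * tau ord0)) (g s)%:E)%E.
  under eq_integral do rewrite EFinM.
  rewrite ge0_integralZl_EFin//; last 2 first.
  - by apply: mgj.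
  - by rewrite ltW.
  apply: lee_wpmul2l; first by rewrite lee_fin ltW.
  have -> : half x = transl (- tau j) @^-1` half (x - tau j).
    by apply/seteqP; split => s; rewrite /= /half/= /transl ltrD2r.
  rewrite (@ge0_integral_transl R _ _ (fun s => (g s)%:E))//; last by apply: mgE.
  apply: ge0_subset_integral => //; first by apply: mgE.
  move=> s; rewrite /half/= => sx; apply: lt_le_trans sx _.
  by rewrite /x -natr1 mulrDl mul1r lerBlDr lerD2l.
apply: (@le_trans _ _ (\int[mu]_(s in half x) ((c * vsq (src s))%:E +
    \sum_j (b j * g (s - tau j))%:E))%E).
  apply: ge0_le_integral => //.
  - by apply: mgE.
  - apply: emeasurable_funD => //; exact: emeasurable_sum.
  - by move=> s _; rewrite sumEFin -EFinD lee_fin; exact: energy_recursion.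
rewrite ge0_integralD//; last 3 first.
- by move=> s _; rewrite lee_fin mulr_ge0 ?vsq_ge0.
- by move=> s _; apply: sume_ge0 => j _; rewrite lee_fin mulr_ge0// ltW.
- exact: emeasurable_sum.
apply: leeD.
  under eq_integral do rewrite EFinM.
  rewrite ge0_integralZl_EFin//; last 2 first.
  - by move=> s _; rewrite lee_fin vsq_ge0.
  - by apply: measurable_funTS; exact: measurable_Evsq vmeas_src.
  by apply: lee_wpmul2l; [rewrite lee_fin|exact: integral_half_src].
rewrite ge0_integral_sum//; last first.
  by move=> j s _; rewrite lee_fin mulr_ge0// ltW.
rewrite /q -sumEFin ge0_sume_distrl; last by move=> j _; rewrite lee_fin ltW.
by apply: lee_sum => j _; exact: gE.
Qed.

(** The bound is the fixed point of the affine map in the preceding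
    inequality. The induction starts where [z] vanishes, so that the finiteness
    of the energy is a result and not an assumption. *)
Lemma integral_half_energy n :
  (\int[mu]_(s in half (n%:R * tau ord0)) (g s)%:E <=
   (c / (1 - q))%:E * vnsq `[0%R, T] phi)%E.
Proof.
have q1 : 0 < 1 - q by rewrite subr_gt0.
have V0 := vnsq_ge0 `[0, T] phi.
elim: n => [|n IH].
  rewrite integral0_eq; first by rewrite mule_ge0// lee_fin divr_ge0// ltW.
  move=> s; rewrite /half/= mul0r => /z_lt0; rewrite /g => ->.
  by rewrite (_ : vsq 0 = 0) ?mulr0// /vsq big1// => i _; rewrite mxE absq0.
apply: le_trans (integral_half_energy_step n) _.
apply: (@le_trans _ _ (c%:E * vnsq `[0%R, T] phi + q%:E *
    ((c / (1 - q))%:E * vnsq `[0%R, T] phi))%E).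
  by apply: leeD => //; apply: lee_wpmul2l => //; rewrite lee_fin ltW.
have q0 : 0 <= q by exact: ltW.
have cq : 0 <= c / (1 - q) by rewrite divr_ge0// ltW.
rewrite muleA -EFinM -ge0_muleDl ?lee_fin ?(mulr_ge0 q0 cq)// -EFinD.
have -> // : c + q * (c / (1 - q)) = c / (1 - q).
by field; rewrite gt_eqF.
Qed.

(** On the [k]-th period the weight of the energy is at least
    [expR (2 * beta * (k%:R * T))]. *)
Theorem energy_decay k :
  (vnsq `[0%R, T] (fun t => z (k%:R * T + t)%R) <=
   (c / (1 - q) * expR (- (2 * beta * T)) ^+ k)%:E * vnsq `[0%R, T] phi)%E.
Proof.
set V := vnsq _ phi.
have -> : vnsq `[0%R, T] (fun t => z (k%:R * T + t)%R) = vnsq `[k%:R * T, k%:R * T + T] z.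
  have -> : `[0, T]%classic = transl (k%:R * T) @^-1` `[k%:R * T, k%:R * T + T].
    by apply/seteqP; split => s /=; rewrite !in_itv/= /transl => /andP[? ?]; lra.
  rewrite /vnsq -[RHS](@ge0_integral_transl _ (k%:R * T))//.
  - by under [RHS]eq_integral do rewrite addrC.
  - by apply: measurable_Evsq; apply: vmeasS vmeas_causal.
  - by move=> s _; rewrite lee_fin vsq_ge0.
have [n nP] : exists n : nat, k%:R * T + T < n%:R * tau ord0.
  exists (Num.bound `|(k%:R * T + T) / tau ord0|).
  rewrite -ltr_pdivrMr//; apply: le_lt_trans (ler_norm _) _.
  exact: archi_boundP.
have mz : vmeas `[k%:R * T, k%:R * T + T] z by apply: vmeasS vmeas_causal.
set e := expR (- (2 * beta * T)) ^+ k; have e0 : 0 <= e by rewrite exprn_ge0 ?expR_ge0.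
apply: (@le_trans _ _ (e%:E * \int[mu]_(s in half (n%:R * tau ord0)) (g s)%:E)%E); last first.
  have -> : c / (1 - q) * e = e * (c / (1 - q)) by rewrite mulrC.
  rewrite [leRHS](_ : _ = e%:E * ((c / (1 - q))%:E * V))%E; last by rewrite EFinM muleA.
  by apply: lee_wpmul2l; [rewrite lee_fin|exact: integral_half_energy].
apply: (@le_trans _ _ (e%:E * \int[mu]_(s in `[(k%:R * T)%R, (k%:R * T + T)%R]) (g s)%:E)%E); last first.
  apply: lee_wpmul2l; first by rewrite lee_fin.
  apply: ge0_subset_integral => //; first by apply/measurable_EFinP; apply: mg.
  by move=> s; rewrite /half/= in_itv/= => /andP[_ sk]; apply: le_lt_trans nP.
rewrite -ge0_integralZl_EFin//; last by apply/measurable_EFinP; apply: mg.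
apply: ge0_le_integral => //.
- by move=> s _; rewrite lee_fin vsq_ge0.
- exact: measurable_Evsq.
- apply/measurable_EFinP; apply: measurable_funM => //; apply: mg => //.
move=> s /=; rewrite in_itv/= => /andP[ks _]; rewrite lee_fin /g mulrA.
rewrite -[leLHS]mul1r ler_wpM2r ?vsq_ge0// /e -expRM_natl -expRD -[leLHS]expR0 ler_expR.
by have := ler_wpM2l (ltW beta_gt0) ks; lra.
Qed.

End causal_energy.

(** * Geometrically convergent series of operators *)

Section operator_series.
Variable R : realType.
Variable d : nat.
Variable T : R.
Local Notation mu := (@lebesgue_measure R).
Local Notation I := (`[0%R, T]%classic : set R).

Lemma vL2_complete (f : nat -> R -> 'cV[R[i]]_d) : (forall n, inL2 0 T (f n)) ->
  (forall e : R, 0 < e -> exists N, forall n m, (N <= n)%N -> (N <= m)%N ->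
    (vnsq I (fun t => f n t - f m t)%R <= e%:E)%E) ->
  exists2 g, inL2 0 T g & forall e : R, 0 < e -> exists N, forall n, (N <= n)%N ->
    (vnsq I (fun t => f n t - g t)%R <= e%:E)%E.
Proof.
move=> sf cf.
have mf n : vmeas I (f n) by have /inL2P[] := sf n.
have comp i (u w : R -> 'cV[R[i]]_d) : (fun t => (u t - w t) i 0) =
    (fun t => u t i 0 - w t i 0).
  by apply/funext => t; rewrite !mxE.
have /choice[g gP] : forall i, exists g, sqint I g /\
    forall e : R, 0 < e -> exists N, forall n, (N <= n)%N ->
    (nsq I (fun t => f n t i 0 - g t)%R <= e%:E)%E.
  move=> i; have sfi n : sqint I (fun t => f n t i 0).
    by have /inL2_sqint := sf n.
  have cfi (e : R) : 0 < e -> exists N, forall n m, (N <= n)%N -> (N <= m)%N ->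
      (nsq I (fun t => f n t i 0 - f m t i 0)%R <= e%:E)%E.
    move=> /cf[N NP]; exists N => n m Nn Nm; apply: le_trans (NP _ _ Nn Nm).
    rewrite vnsqE//; last exact: vmeasB.
    by rewrite (bigD1 i)//= comp leeDl//; apply: sume_ge0 => j _; exact: nsq_ge0.
  by have [g sg gP] := L2_complete (measurable_itv _) sfi cfi; exists g.
pose G t := \col_i g i t : 'cV[R[i]]_d.
have GE i t : G t i 0 = g i t by rewrite mxE.
have sG : inL2 0 T G.
  by apply/inL2_sqint => i; apply: sqint_eq (gP i).1 => t _; rewrite GE.
have mG : vmeas I G by have /inL2P[] := sG.
exists G => // e e0; have ed : 0 < e / d.+1%:R by rewrite divr_gt0.
have /choice[Nf NfP] : forall i, exists N, forall n, (N <= n)%N ->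
    (nsq I (fun t => f n t i 0 - g i t)%R <= (e / d.+1%:R)%:E)%E.
  by move=> i; have [_] := gP i; apply.
exists (\max_i Nf i)%N => n Nn; rewrite vnsqE//; last exact: vmeasB.
apply: (@le_trans _ _ (\sum_(i < d) (e / d.+1%:R)%:E)%E).
  apply: lee_sum => i _; rewrite comp (_ : (fun t => _) = fun t => f n t i 0 - g i t).
    by apply: NfP; apply: leq_trans Nn; exact: leq_bigmax.
  by apply/funext => t; rewrite GE.
rewrite sumEFin lee_fin sumr_const card_ord -[leLHS]mulr_natr mulrAC.
by rewrite ler_pdivrMr// ler_pM2l// ler_nat.
Qed.

Variable A : nat -> operL2 R d.
Variables M rho : R.
Hypothesis M_ge0 : 0 <= M.
Hypothesis rho_gt0 : 0 < rho.
Hypothesis rho_lt1 : rho < 1.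
Hypothesis A_L2 : forall k v, inL2 0 T v -> inL2 0 T (A k v).
Hypothesis A_le : forall k v, inL2 0 T v ->
  (vnsq I (A k v) <= (M * rho ^+ k)%:E * vnsq I v)%E.

(* Any ratio strictly between [rho] and [1]: both the series of the weights
   [theta ^+ k] and that of the [(rho / theta) ^+ k] converge. *)
Let theta := (1 + rho) / 2.

Let B := (1 - theta)^-1 * (M * (1 - rho / theta)^-1).

Lemma geometric_sum_le (x : R) n : 0 < x -> x < 1 ->
  \sum_(i < n) x ^+ i <= (1 - x)^-1.
Proof.
move=> x0 x1; have x1' : 0 < 1 - x by rewrite subr_gt0.
rewrite -[leRHS]mul1r ler_pdivlMr//.
have -> : (\sum_(i < n) x ^+ i) * (1 - x) = 1 - x ^+ n.
  by rewrite -[RHS]opprB subrX1; ring.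
by rewrite gerBl exprn_ge0// ltW.
Qed.

Lemma tail_le v n m : inL2 0 T v ->
  (vnsq I (fun t => \sum_(k < m) A (n + k)%N v t)%R <=
   (B * rho ^+ n)%:E * vnsq I v)%E.
Proof.
move=> sv; have th0 : 0 < theta by rewrite divr_gt0// addr_gt0.
have th1 : theta < 1 by rewrite /theta ltr_pdivrMr//; move: rho_lt1; lra.
have rt : rho < theta by rewrite /theta ltr_pdivlMr//; move: rho_lt1; lra.
have rth : rho / theta < 1 by rewrite ltr_pdivrMr// mul1r.
have rth0 : 0 < rho / theta by rewrite divr_gt0.
have mA k : vmeas I (A k v) by have /inL2P[] := A_L2 k sv.
have mvA k : measurable_fun I (fun t => vsq (A k v t)) by exact: measurable_vsq.
have mdiv k c : measurable_fun I (fun t => (vsq (A k v t) / c)%:E).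
  by apply/measurable_EFinP; apply: measurable_funM.
have th k : 0 < theta ^+ k by rewrite exprn_gt0.
have pos k t : (0 <= (vsq (A (n + k)%N v t) / theta ^+ k)%:E)%E.
  by rewrite lee_fin divr_ge0 ?vsq_ge0// ltW.
pose W t := \sum_(k < m) vsq (A (n + k)%N v t) / theta ^+ k.
have mW : measurable_fun I W.
  by apply: measurable_sum => k; apply: measurable_funM.
have W0 t : 0 <= W t.
  by apply: sumr_ge0 => k _; rewrite divr_ge0 ?vsq_ge0// ltW.
have th1' : 0 < 1 - theta by rewrite subr_gt0.
apply: (@le_trans _ _ (\int[mu]_(t in I) ((1 - theta)^-1 * W t)%:E)%E).
  apply: ge0_le_integral => //.
  - by move=> t _; rewrite lee_fin vsq_ge0.
  - by apply: measurable_Evsq; exact: vmeas_sum.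
  - by apply/measurable_EFinP; apply: measurable_funM.
  move=> t _; rewrite lee_fin.
  apply: le_trans (vsq_sum_weight (a := fun k : 'I_m => theta ^+ k) _ _) _ => //.
  by apply: (ler_wpM2r (W0 t)); exact: geometric_sum_le.
under eq_integral do rewrite EFinM.
rewrite ge0_integralZl_EFin//; last 3 first.
- by move=> t _; rewrite lee_fin.
- exact/measurable_EFinP.
- by rewrite invr_ge0 ltW.
rewrite /B -mulrA EFinM -muleA; apply: lee_wpmul2l.
  by rewrite lee_fin invr_ge0 ltW.
under eq_integral do rewrite /W -sumEFin.
rewrite ge0_integral_sum//; last by move=> k; exact: mdiv.
have V0 := vnsq_ge0 I v.
apply: (@le_trans _ _ (\sum_(k < m) (M * rho ^+ n * (rho / theta) ^+ k)%:E * vnsq I v)%E).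
  apply: lee_sum => k _; under eq_integral do rewrite mulrC EFinM.
  rewrite ge0_integralZl_EFin//; last 3 first.
  - by move=> t _; rewrite lee_fin vsq_ge0.
  - by apply/measurable_EFinP; exact: mvA.
  - by rewrite invr_ge0 ltW.
  apply: le_trans (lee_wpmul2l _ (A_le _ sv)) _; first by rewrite lee_fin invr_ge0 ltW.
  rewrite muleA -EFinM (_ : _ * (M * _) = M * rho ^+ n * (rho / theta) ^+ k)//.
  by rewrite [(rho / theta) ^+ k]expr_div_n exprD; move: (theta ^+ k) => x; ring.
rewrite -ge0_sume_distrl; last first.
  by move=> k _; rewrite lee_fin !mulr_ge0// exprn_ge0// ltW.
apply: lee_wpmul2r => //; rewrite sumEFin lee_fin -mulr_sumr.
rewrite [leRHS]mulrAC; apply: ler_wpM2l; last exact: geometric_sum_le.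
by rewrite mulr_ge0// exprn_ge0// ltW.
Qed.

Let partial n : operL2 R d := fun v t => \sum_(k < n) A k v t.

Lemma inL2_partial n v : inL2 0 T v -> inL2 0 T (partial n v).
Proof. by move=> sv; apply: inL2_sum => k _; exact: A_L2. Qed.

Lemma partialB_le n m v : (n <= m)%N -> inL2 0 T v ->
  (vnsq I (fun t => partial m v t - partial n v t)%R <=
   (B * rho ^+ n)%:E * vnsq I v)%E.
Proof.
move=> nm sv; apply: le_trans (tail_le n (m - n) sv).
rewrite le_eqVlt; apply/orP; left; apply/eqP; apply: eq_vnsq => t _.
rewrite /partial -(big_mkord xpredT (fun k => A k v t)).
rewrite (@big_cat_nat _ _ _ n)//= big_mkord addrAC subrr add0r.
rewrite -{1}[n]add0n big_addn big_mkord.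
by apply: eq_bigr => k _; rewrite addnC.
Qed.

Let B_ge0 : 0 <= B.
Proof.
have th0 : 0 < theta by rewrite divr_gt0// addr_gt0.
have th1 : theta < 1 by rewrite /theta ltr_pdivrMr//; move: rho_lt1; lra.
have rt : rho < theta by rewrite /theta ltr_pdivlMr//; move: rho_lt1; lra.
have rth : rho / theta < 1 by rewrite ltr_pdivrMr// mul1r.
by rewrite !mulr_ge0// invr_ge0 subr_ge0 ltW.
Qed.

Lemma geometric_eventually_le (c e : R) : 0 <= c -> 0 < e ->
  exists N, forall n, (N <= n)%N -> c * rho ^+ n <= e.
Proof.
move=> c0 e0; have : (fun n => c * rho ^+ n) @ \oo --> c * 0.
  by apply: cvgMr; apply: cvg_expr; rewrite ger0_norm// ltW.
rewrite mulr0 => /cvgrPdist_le/(_ _ e0)[N _ NP]; exists N => n /NP /=.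
by rewrite sub0r normrN ger0_norm// mulr_ge0// exprn_ge0// ltW.
Qed.

(** The limit is chosen separately for each [v]. The tail bound does not depend
    on the number of terms, so it passes to this limit and gives convergence
    uniformly in [v]; the factor [2] comes from [vnsqD_le]. *)
Theorem operator_series_cvg : exists L, opnorm_cvg 0 T partial L.
Proof.
have limv v : exists g, inL2 0 T v -> inL2 0 T g /\
    forall n, (vnsq I (fun t => partial n v t - g t)%R <=
      (2 * B * rho ^+ n)%:E * vnsq I v)%E.
  have [sv|] := pselect (inL2 0 T v); last by move=> nsv; exists (fun=> 0).
  have vfin : vnsq I v \is a fin_num.
    by have /inL2P[_ vy] := sv; rewrite ge0_fin_numE// vnsq_ge0.
  set V := fine (vnsq I v); have V0 : 0 <= V by rewrite fine_ge0// vnsq_ge0.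
  have VE : vnsq I v = V%:E by rewrite fineK.
  have sP n := inL2_partial n sv.
  have mP n : vmeas I (partial n v) by have /inL2P[] := sP n.
  have cP (e : R) : 0 < e -> exists N, forall n m, (N <= n)%N -> (N <= m)%N ->
      (vnsq I (fun t => partial n v t - partial m v t)%R <= e%:E)%E.
    move=> e0; have [N NP] := geometric_eventually_le (mulr_ge0 B_ge0 V0) e0; exists N.
    have H n m : (N <= n)%N -> (n <= m)%N ->
        (vnsq I (fun t => partial m v t - partial n v t)%R <= e%:E)%E.
      move=> Nn nm; apply: le_trans (partialB_le nm sv) _.
      by rewrite VE -EFinM lee_fin mulrAC; exact: NP.
    move=> n m Nn Nm; have [nm|/ltnW mn] := leqP n m; last exact: H.
    rewrite -vnsqN (@eq_vnsq _ _ _ _ (fun t => partial m v t - partial n v t)).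
      exact: H.
    by move=> t _; rewrite opprB.
  have [g sg gP] := vL2_complete sP cP; exists g => _; split => // n.
  have mg : vmeas I g by have /inL2P[] := sg.
  rewrite VE -EFinM; apply/lee_addgt0Pr => e e0.
  have e2 : 0 < e / 2 by rewrite divr_gt0.
  have [N NP] := gP _ e2; pose m := maxn N n.
  rewrite (@eq_vnsq _ _ _ _ (fun t => (partial n v t - partial m v t) +
      (partial m v t - g t))); last by move=> t _; rewrite addrA subrK.
  apply: le_trans (vnsqD_le (measurable_itv _) (vmeasB (mP n) (mP m)) (vmeasB (mP m) mg)) _.
  apply: leeD.
    rewrite (_ : (2 * B * rho ^+ n * V)%:E = 2%:E * ((B * rho ^+ n)%:E * vnsq I v))%E; last first.
      by rewrite VE -!EFinM !mulrA.
    apply: lee_wpmul2l => //; apply: le_trans (partialB_le (leq_maxr N n) sv).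
    rewrite -vnsqN; rewrite le_eqVlt; apply/orP; left; apply/eqP.
    by apply: eq_vnsq => t _; rewrite opprB.
  apply: (@le_trans _ _ (2%:E * (e / 2)%:E)%E).
    by apply: lee_wpmul2l => //; apply: NP; exact: leq_maxl.
  by rewrite -EFinM lee_fin; lra.
have [L LP] := choice limv.
exists L; split; first by move=> n v; exact: inL2_partial.
split; first by move=> v sv; have [] := LP v sv.
move=> e e0; have B2 : 0 <= 2 * B by rewrite mulr_ge0.
have [N NP] := geometric_eventually_le B2 (exprn_gt0 2 e0); exists N => // n /= Nn v sv.
apply/L2norm_leP; first exact: ltW.
have [_ /(_ n) H] := LP v sv; apply: le_trans H _.
by apply: lee_wpmul2r; [exact: vnsq_ge0|rewrite lee_fin NP].
Qed.

End operator_series.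

(** * The Laplace series of the kernels *)

Section laplace_operator.
Variable R : realType.
Variables d N : nat.
Variables T delta : R.
Variable tau : 'I_N.+1 -> R.
Variable D : 'I_N.+1 -> R -> 'M[R[i]]_d.
Variables X C : R -> R -> 'M[R[i]]_d.
Variable p : R[i].
Local Notation mu := (@lebesgue_measure R).
Local Notation I := (`[0%R, T]%classic : set R).
Implicit Types (v w phi : R -> 'cV[R[i]]_d).
Hypothesis tau_itv : forall j, 0 < tau j < T.
Hypothesis tau0_le : forall j, tau ord0 <= tau j.
Hypothesis D_meas : forall j, mxmeas setT (D j).
Hypothesis D_periodic : forall j, Tperiodic T (D j).
Hypothesis X_fund : fundamental_solution tau D X.
Hypothesis C_coefs : fundamental_coefs T tau delta X C.
Hypothesis p_ge0 : 0 <= Re p.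
Variable a : 'I_N.+1 -> R.
Variable beta : R.
Hypothesis a_gt0 : forall j, 0 < a j.
Hypothesis a_bound : forall j t y,
  vsq (cexp (- (p * (tau j)%:C)) *: (D j t *m y)) <= a j ^+ 2 * vsq y.
Hypothesis beta_gt0 : 0 < beta.
Hypothesis q_lt1 : \sum_j a j * expR (beta * tau j) < 1.

Let tau_gt0 j : 0 < tau j. Proof. by have /andP[] := tau_itv j. Qed.
Let T0 : 0 < T. Proof. by have /andP[t0 tT] := tau_itv ord0; exact: lt_trans tT. Qed.

Let a_lt1 : \sum_j a j < 1.
Proof.
apply: le_lt_trans q_lt1; apply: ler_sum => j _.
rewrite -[leLHS]mulr1; apply: ler_wpM2l; first exact: ltW.
by rewrite -expR0 ler_expR mulr_ge0// ltW.
Qed.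

Lemma cmeas_cexp E (c : R[i]) : cmeas E (fun t => cexp (c * t%:C)).
Proof.
have E1 t : cexp (c * t%:C) = (expR (Re c * t))%:C *
    (cos (Im c * t) +i* sin (Im c * t)).
  by rewrite /cexp cReM cImM /= !mulr0 subr0 add0r.
have ce k : continuous (fun t : R => k * t) by exact: mulrl_continuous.
have m1 : measurable_fun E (fun t : R => expR (Re c * t)).
  apply: measurable_funTS; apply: continuous_measurable_fun => t.
  by apply: continuous_comp; [exact: ce|exact: continuous_expR].
have m2 : measurable_fun E (fun t : R => cos (Im c * t)).
  apply: measurable_funTS; apply: continuous_measurable_fun => t.
  by apply: continuous_comp; [exact: ce|exact: continuous_cos].
have m3 : measurable_fun E (fun t : R => sin (Im c * t)).
  apply: measurable_funTS; apply: continuous_measurable_fun => t.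
  by apply: continuous_comp; [exact: ce|exact: continuous_sin].
apply: (@cmeas_eq _ _ (fun t => (expR (Re c * t))%:C *
    (cos (Im c * t) +i* sin (Im c * t)))); first by move=> t _.
apply: cmeasM; split => //; exact: measurable_cst.
Qed.

Lemma vmeas_Emul E c v : vmeas E v -> vmeas E (Emul c v).
Proof. by move=> mv; apply: vmeasZ => //; exact: cmeas_cexp. Qed.

Lemma EmulK c (v : R -> 'cV[R[i]]_d) : Emul (- c) (Emul c v) = v.
Proof.
apply/funext => t; rewrite /Emul scalerA mulrC mulNr cexpN scale1r//.
Qed.

Lemma vsq_Emul c v t : vsq (Emul c v t) = expR (2 * (Re c * t)) * vsq (v t).
Proof. by rewrite /Emul vsqZ absq_cexp cReM /= mulr0 subr0. Qed.

Lemma vnsq_scale_le (f v : R -> 'cV[R[i]]_d) (B : R) : 0 <= B ->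
  vmeas I f -> vmeas I v -> (forall t, I t -> vsq (f t) <= B * vsq (v t)) ->
  (vnsq I f <= B%:E * vnsq I v)%E.
Proof.
move=> B0 mf mv fv; rewrite /vnsq -ge0_integralZl_EFin//; last 2 first.
- by move=> t _; rewrite lee_fin vsq_ge0.
- exact: measurable_Evsq.
apply: ge0_le_integral => //.
- by move=> t _; rewrite lee_fin vsq_ge0.
- exact: measurable_Evsq.
- by apply/measurable_EFinP; apply: measurable_funM => //; exact: measurable_vsq.
Qed.

Lemma vnsq_EmulN_le v : vmeas I v -> (vnsq I (Emul (- p)%R v) <= vnsq I v)%E.
Proof.
move=> mv; rewrite -[leRHS]mul1e; apply: vnsq_scale_le => //.
  exact: vmeas_Emul.
move=> t; rewrite /= in_itv/= => /andP[t0 _]; rewrite vsq_Emul ler_wpM2r ?vsq_ge0//.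
by rewrite -[leRHS]expR0 ler_expR cReN; have := mulr_ge0 p_ge0 t0; lra.
Qed.

Lemma vnsq_Emul_le v : vmeas I v ->
  (vnsq I (Emul p v) <= (expR (2 * (Re p * T)))%:E * vnsq I v)%E.
Proof.
move=> mv; apply: vnsq_scale_le => //; first exact: vmeas_Emul.
move=> t; rewrite /= in_itv/= => /andP[_ tT]; rewrite vsq_Emul ler_wpM2r ?vsq_ge0//.
by rewrite ler_expR; have := ler_wpM2l p_ge0 tT; lra.
Qed.

Lemma inL2_Emulp v : inL2 0 T v -> inL2 0 T (Emul p v).
Proof.
move=> /inL2P[mv nv]; apply/inL2P; split; first exact: vmeas_Emul.
by apply: le_lt_trans (vnsq_Emul_le mv) _; rewrite lte_mul_pinfty// lee_fin expR_ge0.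
Qed.

Lemma inL2_EmulNp v : inL2 0 T v -> inL2 0 T (Emul (- p) v).
Proof.
move=> /inL2P[mv nv]; apply/inL2P; split; first exact: vmeas_Emul.
exact: le_lt_trans (vnsq_EmulN_le mv) nv.
Qed.

Local Notation h := (causal_sum T tau C).

(** Up to multiplication by [e ^ (p t)], the restriction of this function to
    the [k]-th period is the [k]-th term of the Laplace series, see
    [laplace_termE]. *)
Definition damped v : R -> 'cV[R[i]]_d := Emul (- p) (h v).

Lemma damped_lt0 v s : s < 0 -> damped v s = 0.
Proof. by move=> s0; rewrite /damped /Emul causal_sum_lt0// scaler0. Qed.

Lemma damped_recursion v s : damped v s =
  (if 0 <= s < T then Emul (- p) v s else 0) +
  \sum_j cexp (- (p * (tau j)%:C)) *: (D j s *m damped v (s - tau j)).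
Proof.
rewrite {1}/damped {1}/Emul (causal_sum_recursion tau_gt0 X_fund C_coefs) scalerDr.
congr (_ + _); first by case: ifP; rewrite ?scaler0.
rewrite scaler_sumr; apply: eq_bigr => j _.
rewrite /damped /Emul -scalemxAr scalerA -cexpD; congr (cexp _ *: _).
by rewrite rmorphB /=; ring.
Qed.

Let Cst := expR (2 * beta * T) / (1 - \sum_j a j * expR (beta * tau j)) /
  (1 - \sum_j a j * expR (beta * tau j)).
Let rho := expR (- (2 * beta * T)).

Lemma damped_decay k v : vmeas I v ->
  (vnsq I (fun t => damped v (k%:R * T + t)%R) <=
   (Cst * rho ^+ k)%:E * vnsq I (Emul (- p)%R v))%E.
Proof.
move=> mv; apply: (energy_decay (tau_gt0 ord0) tau0_le D_meas
  (vmeas_Emul (- p) mv) (damped_lt0 v) (damped_recursion v) a_gt0 a_bound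
  beta_gt0 q_lt1).
Qed.

Lemma vmeas_damped v E : vmeas I v -> measurable E -> vmeas E (damped v).
Proof.
move=> mv mE; apply: (@vmeasS _ _ setT) => //.
exact: (vmeas_causal (tau_gt0 ord0) tau0_le D_meas (vmeas_Emul (- p) mv)
  (damped_lt0 v) (damped_recursion v)).
Qed.

Lemma vmeas_damped_shift v k : vmeas I v ->
  vmeas I (fun t => damped v (k%:R * T + t)).
Proof.
move=> mv i; apply: (@cmeasS _ setT) => //.
under eq_fun do rewrite addrC.
exact: cmeas_shift (vmeas_damped mv measurableT i).
Qed.

Definition laplace_term k : operL2 R d :=
  fun v t => (cexp (p * T%:C)) ^- k *: Hop T tau C k v t.

Lemma laplace_termE k v t :
  laplace_term k v t = Emul p (fun t => damped v (k%:R * T + t)) t.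
Proof.
rewrite /laplace_term /Emul /damped /Emul scalerA; congr (_ *: _).
have e0 x : cexp x != 0 :> R[i].
  apply/eqP => x0; have := cexpN x; rewrite x0 mul0r => /esym/eqP.
  by rewrite oner_eq0.
rewrite cexpX -cexpD; apply: (mulfI (e0 (k%:R * (p * T%:C)))).
rewrite mulfV// -cexpD -[LHS](cexp0 R); congr cexp.
by rewrite rmorphD rmorphM rmorph_nat /=; ring.
Qed.

Let Cst_ge0 : 0 <= Cst.
Proof. by rewrite !divr_ge0 ?expR_ge0// subr_ge0 ltW. Qed.

Let rho_gt0 : 0 < rho. Proof. exact: expR_gt0. Qed.

Let rho_lt1 : rho < 1.
Proof. by rewrite /rho expR_lt1 oppr_lt0 !mulr_gt0. Qed.

Lemma laplace_term_le k v : inL2 0 T v ->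
  (vnsq I (laplace_term k v) <=
   (expR (2 * (Re p * T)) * Cst * rho ^+ k)%:E * vnsq I v)%E.
Proof.
move=> /inL2P[mv _]; have mz := vmeas_damped_shift k mv.
rewrite (eq_vnsq (w := Emul p (fun t => damped v (k%:R * T + t)))); last first.
  by move=> t _; exact: laplace_termE.
apply: le_trans (vnsq_Emul_le mz) _; rewrite -mulrA EFinM -muleA.
apply: lee_wpmul2l; first by rewrite lee_fin expR_ge0.
apply: le_trans (damped_decay k mv) _; apply: lee_wpmul2l; last exact: vnsq_EmulN_le.
by rewrite lee_fin; apply: mulr_ge0 => //; exact/exprn_ge0/ltW.
Qed.

Lemma inL2_laplace_term k v : inL2 0 T v -> inL2 0 T (laplace_term k v).
Proof.
move=> sv; have /inL2P[mv nv] := sv; apply/inL2P; split.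
  apply: (@vmeas_eq _ _ _ (Emul p (fun t => damped v (k%:R * T + t)))).
    by move=> t _; rewrite laplace_termE.
  by apply: vmeas_Emul; exact: vmeas_damped_shift.
apply: le_lt_trans (laplace_term_le k sv) _; rewrite lte_mul_pinfty//.
rewrite lee_fin; apply: mulr_ge0; last exact/exprn_ge0/ltW.
by apply: mulr_ge0 => //; exact: expR_ge0.
Qed.

Theorem laplace_cvg :
  exists L, opnorm_cvg 0 T (laplace_partial T tau C (cexp (p * T%:C))) L.
Proof.
apply: (operator_series_cvg _ rho_gt0 rho_lt1 inL2_laplace_term laplace_term_le).
by apply: mulr_ge0 => //; exact: expR_ge0.
Qed.

Lemma laplaceP : opnorm_cvg 0 T (laplace_partial T tau C (cexp (p * T%:C)))
  (laplace T tau C (cexp (p * T%:C))).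
Proof.
rewrite /laplace; case: xgetP => [L _ //|no].
by have [L HL] := laplace_cvg; case: (no L).
Qed.

Let Y v n t := \sum_(k < n) damped v (k%:R * T + t).

Lemma laplace_partialE v n t :
  laplace_partial T tau C (cexp (p * T%:C)) n v t = Emul p (Y v n) t.
Proof.
rewrite /laplace_partial /Emul /Y scaler_sumr; apply: eq_bigr => k _.
exact: laplace_termE.
Qed.

Lemma D_periodic_nat j k t : D j (k%:R * T + t) = D j t.
Proof.
elim: k => [|k IH]; first by rewrite mul0r add0r.
rewrite -IH -[RHS]D_periodic; congr (D j _); rewrite -natr1; ring.
Qed.

(** The delayed value of the [k]-th period is found in the period [k - 1] when
    [t < tau j], so the sum of the first periods satisfies the periodic equation
    except that the last period does not yet flow into its successor. *)
Lemma periods_sum_recursion v n t : 0 <= t < T -> Y v n.+1 t = Emul (- p) v t +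
  (Mop T tau D p (Y v n.+1) t - \sum_j cexp (- (p * (tau j)%:C)) *:
    (D j t *m (if t < tau j then damped v (n%:R * T + (t - tau j + T)) else 0))).
Proof.
move=> /andP[t0 tT]; rewrite {1}/Y.
rewrite (eq_bigr (fun k : 'I_n.+1 =>
    (if k == ord0 then Emul (- p) v t else 0) +
    \sum_j cexp (- (p * (tau j)%:C)) *: (D j t *m damped v (k%:R * T + t - tau j)))); last first.
  move=> k _; rewrite damped_recursion; congr (_ + _); last first.
    by apply: eq_bigr => j _; rewrite D_periodic_nat.
  have [->|k0] := eqVneq k ord0; first by rewrite /= mul0r add0r t0 tT.
  rewrite ifF//; apply/negP => /andP[_].
  have k1 : (1 : R) <= k%:R by rewrite ler1n lt0n.
  have := ler_wpM2r (ltW T0) k1; rewrite mul1r ltNge => kT.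
  by apply/negP; rewrite negbK; lra.
rewrite big_split /= -big_mkcond big_pred1_eq; congr (_ + _).
rewrite exchange_big /= /Mop -sumrB; apply: eq_bigr => j _.
rewrite -scaler_sumr -mulmx_sumr -scalerBr -mulmxBr; congr (_ *: (_ *m _)).
rewrite /vpshift; case: ifPn => tj; last first.
  by rewrite subr0; apply: eq_bigr => k _; rewrite addrA.
rewrite big_ord_recl /= mul0r add0r damped_lt0 ?subr_lt0// add0r.
rewrite /Y big_ord_recr /= addrK; apply: eq_bigr => k _; congr (damped v _).
by rewrite /bump /= add1n -natr1; ring.
Qed.

(** The defect [G] of the limit is at most a multiple of the distance [dl]
    between the limit and the partial sums, plus a multiple of the last period
    [zeta]. Both tend to [0] while [G] does not depend on the rank. *)
Theorem Sop_Lambda phi : inL2 0 T phi ->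
  inL2 0 T (Lambda T tau C p phi) /\
  aeeq 0 T (Sop T tau D p (Lambda T tau C p phi)) phi.
Proof.
move=> sphi; pose v := Emul p phi.
have vphi : Emul (- p) v = phi by exact: EmulK.
have sv : inL2 0 T v by exact: inL2_Emulp.
have [sP [sL cL]] := laplaceP.
set psi := Lambda T tau C p phi.
have psiE : psi = Emul (- p) (laplace T tau C (cexp (p * T%:C)) v) by [].
have spsi : inL2 0 T psi by rewrite psiE; apply: inL2_EmulNp; exact: sL.
split => //.
have [mphi nphi] := (inL2P 0 T phi).1 sphi.
have [mv nv] := (inL2P 0 T v).1 sv.
have [mpsi _] := (inL2P 0 T psi).1 spsi.
have DmI j : mxmeas I (D j).
  by move=> i k; apply: cmeasS (D_meas j i k).
pose dl n t := psi t - Y v n t.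
have dlE n : dl n = Emul (- p) (fun t => laplace T tau C (cexp (p * T%:C)) v t -
    laplace_partial T tau C (cexp (p * T%:C)) n v t).
  apply/funext => t; rewrite /dl psiE /Emul scalerBr laplace_partialE.
  by congr (_ - _); have := congr1 (@^~ t) (EmulK p (Y v n)).
have mdl n : vmeas I (dl n).
  rewrite dlE; apply: vmeas_Emul; apply: vmeasB.
    by have /inL2P[] := sL v sv.
  by have /inL2P[] := sP n v sv.
pose G t := Sop T tau D p psi t - phi t.
have mG : vmeas I G.
  by apply: vmeasB => //; apply: vmeasB => //; exact: vmeas_Mop.
set q := \sum_j a j.
have q0 : 0 <= q by apply: sumr_ge0 => j _; exact: ltW.
pose zeta n t := damped v (n%:R * T + t).
have mzeta n : vmeas I (zeta n) by exact: vmeas_damped_shift.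
have G_le n t : 0 <= t < T -> vsq (G t) <= 2 * vsq (dl n.+1 t) +
    (4 * vsq (Mop T tau D p (dl n.+1) t) + 4 * (q * shift_energy T tau a (zeta n) t)).
  move=> tI; have tI' := tI; move: tI' => /andP[t0 tT].
  set Em := \sum_j cexp (- (p * (tau j)%:C)) *:
    (D j t *m (if t < tau j then damped v (n%:R * T + (t - tau j + T)) else 0)).
  have -> : G t = dl n.+1 t - (Mop T tau D p (dl n.+1) t + Em).
    rewrite /G /Sop /dl MopB (periods_sum_recursion v n tI) vphi -/Em.
    by apply/matrixP => i j; rewrite !mxE; ring.
  have Em_le : vsq Em <= q * shift_energy T tau a (zeta n) t.
    apply: le_trans (vsq_weighted_sum_le a_gt0 a_bound _ _) _.
    apply: ler_wpM2l => //; apply: ler_sum => j _; apply: ler_wpM2l; first exact: ltW.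
    rewrite /vpshift /zeta; case: ifP => // _.
    by rewrite [X in X <= _](_ : _ = 0) ?vsq_ge0// /vsq big1// => i _; rewrite mxE absq0.
  apply: le_trans (vsqD_le _ _) _; rewrite vsqN; apply: lerD => //.
  have := vsqD_le (Mop T tau D p (dl n.+1) t) Em; lra.
have q2 x : (0 <= x)%E -> ((q ^+ 2)%:E * x <= x)%E.
  move=> x0; rewrite -[leRHS]mul1e; apply: lee_wpmul2r => //.
  by rewrite lee_fin exprn_ile1// ltW.
have G_int n : (vnsq I G <= 2%:E * vnsq I (dl n.+1) +
    (4%:E * vnsq I (dl n.+1) + 4%:E * vnsq I (zeta n)))%E.
  have mM : vmeas I (Mop T tau D p (dl n.+1)) by exact: vmeas_Mop.
  have mS : measurable_fun I (fun t => q * shift_energy T tau a (zeta n) t).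
    by apply: measurable_funM => //; exact: measurable_shift_energy.
  have S0 t : 0 <= q * shift_energy T tau a (zeta n) t.
    by rewrite mulr_ge0// shift_energy_ge0.
  have cE (c : R) (u : R -> R) : measurable_fun I u ->
      measurable_fun I (fun t => (c%:E * (u t)%:E)%E).
    by move=> mu_; apply/measurable_EFinP; apply: measurable_funM.
  have mE1 := measurable_vsq (mdl n.+1); have mE2 := measurable_vsq mM.
  have p2 (c x : R) : 0 <= c -> 0 <= x -> (0 <= c%:E * x%:E)%E.
    by move=> c0 x0; rewrite -EFinM lee_fin mulr_ge0.
  apply: (@le_trans _ _ (\int[mu]_(t in I) (2%:E * (vsq (dl n.+1 t))%:E +
     (4%:E * (vsq (Mop T tau D p (dl n.+1) t))%:E +
      4%:E * (q * shift_energy T tau a (zeta n) t)%:E)))%E).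
    apply: ae_ge0_le_integral => //.
    - by move=> t _; rewrite lee_fin vsq_ge0.
    - exact: measurable_Evsq.
    - move=> t _; rewrite adde_ge0 ?adde_ge0//; apply: p2 => //; exact: vsq_ge0.
    - apply: emeasurable_funD; first exact: cE.
      by apply: emeasurable_funD; exact: cE.
    (* [periods_sum_recursion] holds on [0, T[ only. *)
    apply: aeS (ae_neq T) => t tT /=; rewrite in_itv/= => /andP[t0 tT'].
    rewrite -!EFinM -!EFinD lee_fin; apply: G_le; rewrite t0/= lt_neqAle tT' andbT.
    exact/eqP.
  have pv (u : R -> 'cV[R[i]]_d) t : (0 <= (vsq (u t))%:E)%E.
    by rewrite lee_fin vsq_ge0.
  rewrite ge0_integralD//; last 4 first.
  - by move=> t _; apply: p2 => //; exact: vsq_ge0.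
  - exact: cE.
  - by move=> t _; rewrite adde_ge0//; apply: p2 => //; exact: vsq_ge0.
  - by apply: emeasurable_funD; exact: cE.
  rewrite ge0_integralD//; last 4 first.
  - by move=> t _; apply: p2 => //; exact: vsq_ge0.
  - exact: cE.
  - by move=> t _; apply: p2.
  - exact: cE.
  rewrite !ge0_integralZl_EFin//;
    do ?[by apply/measurable_EFinP | by move=> t _; rewrite lee_fin].
  apply: leeD => //; apply: leeD; apply: lee_wpmul2l => //.
    apply: le_trans (vnsq_Mop_le tau_itv DmI a_gt0 a_bound (mdl n.+1)) _.
    exact: q2.
  by rewrite integral_shift_energy//; exact: q2.
have G0 : vnsq I G = 0%E.
  apply/eqP; rewrite eq_le vnsq_ge0 andbT.
  apply/lee_addgt0Pr => e e0; rewrite add0e.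
  have [V0 VE] : 0 <= fine (vnsq I v) /\ vnsq I v = (fine (vnsq I v))%:E.
    rewrite fine_ge0 ?vnsq_ge0// fineK// ge0_fin_numE// vnsq_ge0//.
  set V := fine (vnsq I v) in V0 VE.
  pose eta := Num.sqrt (e / 12 / (V + 1)).
  have V1 : 0 < V + 1 by rewrite ltr_wpDl.
  have eta0 : 0 < eta by rewrite sqrtr_gt0 !divr_gt0.
  have eta2 : eta ^+ 2 * V <= e / 12.
    rewrite sqr_sqrtr; last by rewrite ltW// !divr_gt0.
    rewrite mulrAC ler_pdivrMr// ler_pM2l ?divr_gt0// lerDl//.
  have [N1 _ N1P] := cL _ eta0.
  have CV : 0 <= Cst * V by rewrite mulr_ge0.
  have [N2 N2P] := geometric_eventually_le rho_gt0 rho_lt1 CV (divr_gt0 e0 (ltr0n R 8)).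
  pose n := maxn N1 N2.
  have D1 : (vnsq I (dl n.+1) <= (e / 12)%:E)%E.
    have := N1P n.+1 (leq_trans (leq_maxl N1 N2) (leqnSn n)) v sv.
    move/(L2norm_leP _ _ _ _ (ltW eta0)); rewrite VE -EFinM => H.
    rewrite dlE; apply: le_trans (vnsq_EmulN_le _) _.
      by apply: vmeasB; [have /inL2P[] := sL v sv|have /inL2P[] := sP n.+1 v sv].
    rewrite -vnsqN (eq_vnsq (w := fun t => laplace_partial T tau C (cexp (p * T%:C)) n.+1 v t
      - laplace T tau C (cexp (p * T%:C)) v t)); last by move=> t _; rewrite opprB.
    by apply: le_trans H _; rewrite lee_fin.
  have D2 : (vnsq I (zeta n) <= (e / 8)%:E)%E.
    apply: le_trans (damped_decay n mv) _.
    apply: (@le_trans _ _ ((Cst * rho ^+ n)%:E * vnsq I v)%E).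
      apply: lee_wpmul2l; last exact: vnsq_EmulN_le.
      by rewrite lee_fin; apply: mulr_ge0 => //; exact/exprn_ge0/ltW.
    by rewrite VE -EFinM lee_fin mulrAC; apply: N2P; exact: leq_maxr.
  apply: le_trans (G_int n) _.
  apply: (@le_trans _ _ (2%:E * (e / 12)%:E + (4%:E * (e / 12)%:E + 4%:E * (e / 8)%:E))%E).
    by apply: leeD; [|apply: leeD]; apply: lee_wpmul2l.
  by rewrite -!EFinM -!EFinD lee_fin; lra.
apply: aeS (vnsq0_ae (measurable_itv _) mG G0) => t Gt tI.
by apply/eqP; rewrite -subr_eq0; apply/eqP/Gt; rewrite /= in_itv.
Qed.

End laplace_operator.

(** * Inversion of the periodic operator *)

Section inverse_of_R.
Variable R : realType.
Variables d N : nat.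
Variables T delta : R.
Variable tau : 'I_N.+1 -> R.
Variable D : 'I_N.+1 -> R -> 'M[R[i]]_d.
Variables X C : R -> R -> 'M[R[i]]_d.
Variable p : R[i].
Local Notation mu := (@lebesgue_measure R).
Local Notation I := (`[0%R, T]%classic : set R).
Implicit Types (v w phi : R -> 'cV[R[i]]_d) (x : int -> 'cV[R[i]]_d).
Hypothesis tau_itv : forall j, 0 < tau j < T.
Hypothesis tau0_le : forall j, tau ord0 <= tau j.
Hypothesis D_meas : forall j, mxmeas setT (D j).
Variable B : R.
Hypothesis D_bound : forall j t i k, absq (D j t i k) <= B.
Hypothesis D_periodic : forall j, Tperiodic T (D j).
Hypothesis X_fund : fundamental_solution tau D X.
Hypothesis C_coefs : fundamental_coefs T tau delta X C.
Hypothesis p_ge0 : 0 <= Re p.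
Variable a : 'I_N.+1 -> R.
Variable beta : R.
Hypothesis a_gt0 : forall j, 0 < a j.
Hypothesis a_bound : forall j t y,
  vsq (cexp (- (p * (tau j)%:C)) *: (D j t *m y)) <= a j ^+ 2 * vsq y.
Hypothesis beta_gt0 : 0 < beta.
Hypothesis q_lt1 : \sum_j a j * expR (beta * tau j) < 1.

Let T0 : 0 < T.
Proof. by have /andP[t0 tT] := tau_itv ord0; exact: lt_trans tT. Qed.

Let a_lt1 : \sum_j a j < 1.
Proof.
apply: le_lt_trans q_lt1; apply: ler_sum => j _.
rewrite -[leLHS]mulr1; apply: ler_wpM2l; first exact: ltW.
by rewrite -expR0 ler_expR mulr_ge0// ltW//; have /andP[] := tau_itv j.
Qed.

Let DmI j : mxmeas I (D j).
Proof. by move=> i k; apply: cmeasS (D_meas j i k). Qed.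

Local Notation S := (Sop T tau D p).
Local Notation Rp := (Rop T tau D p).
Local Notation hat := (L2_to_l2 T).

Lemma inL2_Sop v : inL2 0 T v -> inL2 0 T (S v).
Proof.
move=> sv; apply: inL2B => //; have [mv nv] := (inL2P 0 T v).1 sv.
apply/inL2P; split; first exact: vmeas_Mop.
apply: le_lt_trans (vnsq_Mop_le tau_itv DmI a_gt0 a_bound mv) _.
by rewrite lte_mul_pinfty// lee_fin sqr_ge0.
Qed.

Lemma vmeas_inL2 v : inL2 0 T v -> vmeas I v.
Proof. by move=> /inL2P[]. Qed.

Lemma Rop_Lambda phi : inL2 0 T phi -> Rp (hat (Lambda T tau C p phi)) = hat phi.
Proof.
move=> sphi; have [spsi Spsi] := Sop_Lambda tau_itv tau0_le D_meas D_periodic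
  X_fund C_coefs p_ge0 a_gt0 a_bound beta_gt0 q_lt1 sphi.
rewrite (Rop_fourier _ T0 tau_itv DmI D_bound spsi).
exact: (aeeq_fourier (vmeas_inL2 (inL2_Sop spsi)) (vmeas_inL2 sphi) Spsi).
Qed.

Lemma inL2_Lambda phi : inL2 0 T phi -> inL2 0 T (Lambda T tau C p phi).
Proof.
by move=> sphi; have [] := Sop_Lambda tau_itv tau0_le D_meas D_periodic
  X_fund C_coefs p_ge0 a_gt0 a_bound beta_gt0 q_lt1 sphi.
Qed.

(** Sequences are determined exactly although functions are known almost
    everywhere only, because Fourier coefficients ignore null sets. *)
Lemma Rop_inj x (x' : int -> 'cV[R[i]]_d) :
  inl2 x -> inl2 x' -> Rp x = Rp x' -> x = x'.
Proof.
move=> /(riesz_fischer_vector T0)[v sv <-] /(riesz_fischer_vector T0)[w sw <-].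
rewrite (Rop_fourier _ T0 tau_itv DmI D_bound sv).
rewrite (Rop_fourier _ T0 tau_itv DmI D_bound sw) => SvSw.
have SvSw' : aeeq 0 T (S v) (S w).
  exact: (fourier_inj T0 (inL2_Sop sv) (inL2_Sop sw) SvSw).
have vw := Sop_inj tau_itv DmI a_gt0 a_lt1 a_bound sv sw SvSw'.
exact: (aeeq_fourier (vmeas_inL2 sv) (vmeas_inL2 sw) vw).
Qed.

Lemma Rop_surj x : inl2 x -> exists2 y, inl2 y & Rp y = x.
Proof.
move=> /(riesz_fischer_vector T0)[phi sphi <-].
exists (hat (Lambda T tau C p phi)); last exact: Rop_Lambda.
by apply: (inl2_fourier T0); exact: inL2_Lambda.
Qed.

Lemma inl2_Rop x : inl2 x -> inl2 (Rp x).
Proof.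
move=> /(riesz_fischer_vector T0)[v sv <-].
rewrite (Rop_fourier _ T0 tau_itv DmI D_bound sv).
by apply: (inl2_fourier T0); exact: inL2_Sop.
Qed.

Lemma Rop_invertible : exists A, l2_inverse Rp A.
Proof.
have inv x : exists y, inl2 x -> inl2 y /\ Rp y = x.
  have [/Rop_surj[y sy <-]|nx] := pselect (inl2 x); first by exists y.
  by exists x.
have [A AP] := choice inv; exists A => x sx.
have [sAx RA] := AP x sx; have sRx := inl2_Rop sx.
have [sARx RARx] := AP _ sRx; split => //.
exact: Rop_inj.
Qed.

(** The sequence of [Lambda phi] is mapped by [R(p)] to that of [phi], hence it
    is the image of the latter by the inverse. *)
Theorem Lambda_eq_Rinv phi : inL2 0 T phi ->
  aeeq 0 T (Lambda T tau C p phi) (Rinv_L2 T tau D p phi).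
Proof.
move=> sphi; set psi := Lambda T tau C p phi.
have spsi : inL2 0 T psi by exact: inL2_Lambda.
have RinvP : l2_inverse Rp (Rinv T tau D p).
  rewrite /Rinv; case: xgetP => [A _ //|no].
  by have [A AP] := Rop_invertible; case: (no A).
have hatE : Rinv T tau D p (hat phi) = hat psi.
  rewrite -Rop_Lambda//; have [_ _ _ ->//] := RinvP (hat psi) (inl2_fourier T0 spsi).
rewrite /Rinv_L2 hatE /l2_to_L2; case: xgetP => [w _ [sw hw]|no].
  by apply: (fourier_inj T0) => //; rewrite hw.
by case: (no psi).
Qed.

End inverse_of_R.

(** * Bounds on periodic coefficients *)

Section periodic_bounds.
Variable R : realType.
Variable T : R.
Hypothesis T0 : 0 < T.

Lemma periodic_natmul (V : Type) (g : R -> V) (n : nat) t :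
  Tperiodic T g -> g (t + n%:R * T) = g t.
Proof.
move=> gT; elim: n => [|n IH]; first by rewrite mul0r addr0.
by rewrite -natr1 mulrDl mul1r addrA gT.
Qed.

Lemma periodic_reduce (V : Type) (g : R -> V) t : Tperiodic T g ->
  exists2 s, 0 <= s <= T & g t = g s.
Proof.
move=> gT; have := floor_itv (t / T); set m := Num.floor _.
rewrite ler_pdivlMr// ltr_pdivrMr// intrD mulrDl mul1r => /andP[m1 m2].
exists (t - m%:~R * T); first by apply/andP; split; lra.
case: m m1 m2 => n _ _.
  by rewrite -[in LHS](subrK (n%:~R * T) t) -pmulrn periodic_natmul.
rewrite NegzE intrN mulNr opprK -pmulrn periodic_natmul//.
Qed.

Lemma periodic_bounded (u : R -> R) : continuous u -> Tperiodic T u ->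
  exists M, forall t, `|u t| <= M.
Proof.
move=> cu uT; have [c cT cM] : exists2 c, c \in `[0, T] &
    forall t, t \in `[0, T] -> `|u t| <= `|u c|.
  apply: (@EVT_max _ (fun t => `|u t|)); first exact: ltW.
  apply: continuous_subspaceT => t; apply: continuous_comp; first exact: cu.
  exact: norm_continuous.
exists `|u c| => t; have [s sT ->] := periodic_reduce t uT.
by apply: cM; rewrite in_itv.
Qed.

Variables (d : nat) (delta : R) (g : R -> 'M[R[i]]_d).
Hypothesis g_C1 : C1holder delta g.
Hypothesis gT : Tperiodic T g.

Lemma C1holder_continuous i j :
  continuous (fun t => Re (g t i j)) /\ continuous (fun t => Im (g t i j)).
Proof.
have [gd _] := g_C1; split => t; have [g1 g2] := gd i j t.
  by apply: differentiable_continuous; apply/derivable1_diffP.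
by apply: differentiable_continuous; apply/derivable1_diffP.
Qed.

Lemma C1holder_mxmeas : mxmeas setT g.
Proof.
move=> i j; have [c1 c2] := C1holder_continuous i j.
by split; exact: continuous_measurable_fun.
Qed.

Lemma C1holder_bounded : exists2 B, 0 <= B & forall t i j, absq (g t i j) <= B.
Proof.
have bd i j : exists M, forall t, absq (g t i j) <= M.
  have [c1 c2] := C1holder_continuous i j.
  have [|M1 M1P] := periodic_bounded c1; first by move=> t; rewrite gT.
  have [|M2 M2P] := periodic_bounded c2; first by move=> t; rewrite gT.
  have sq (u M : R) : `|u| <= M -> u ^+ 2 <= M ^+ 2.
    by move=> uM; rewrite -real_normK ?num_real// ler_sqr// nnegrE (le_trans _ uM).
  by exists (M1 ^+ 2 + M2 ^+ 2) => t; apply: lerD; exact: sq.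
have /choice[M MP] : forall ij : 'I_d * 'I_d, exists M,
    forall t, absq (g t ij.1 ij.2) <= M by move=> [i j]; exact: bd.
exists (\sum_ij `|M ij|); first by apply: sumr_ge0.
move=> t i j; apply: le_trans (MP (i, j) t) _; apply: le_trans (ler_norm _) _.
by rewrite (bigD1 (i, j))//= lerDl sumr_ge0.
Qed.

Lemma mxnorm_le_sup t : mxnorm (g t) <= sup (range (fun t => mxnorm (g t))).
Proof.
have [B B0 gB] := C1holder_bounded; apply: ub_le_sup; last by exists t.
exists (Num.sqrt (d%:R * (d%:R * (d%:R * B)))) => _ [s _ <-].
apply: le_trans (mxnorm_le_frobenius _) _; rewrite ler_wsqrtr// ler_wpM2l// /frobenius_sq.
apply: (@le_trans _ _ (\sum_(i < d) \sum_(j < d) B)).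
  by apply: ler_sum => i _; apply: ler_sum => j _; exact: gB.
by rewrite !sumr_const card_ord !mulr_natl.
Qed.

End periodic_bounds.

(** * Weights for the contraction, and the inverse *)

Theorem lemma14 (R : realType) (d N : nat) (T delta : R)
    (tau : 'I_N.+1 -> R) (D : 'I_N.+1 -> R -> 'M[R[i]]_d.+1)
    (tau_gt0 : 0 < tau ord0)
    (tau_incr : forall i j : 'I_N.+1, (i < j)%N -> tau i < tau j)
    (tau_ltT : tau ord_max < T)
    (delta_gt0 : 0 < delta) (delta_lt1 : delta < 1)
    (D_C1holder : forall j, C1holder delta (D j))
    (D_periodic : forall j, Tperiodic T (D j))
    (D_stable : exp_stable tau D)
    (X C : R -> R -> 'M[R[i]]_d.+1)
    (X_fund : fundamental_solution tau D X)
    (C_coefs : fundamental_coefs T tau delta X C)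
    (K gamma : R) (K_ge0 : 0 <= K) (gamma_ge0 : 0 <= gamma)
    (C_bound : coefs_bound tau delta C K gamma)
    (p : R[i]) (p_gt : gamma2 tau D gamma < complex.Re p) :
  [/\ exists L, opnorm_cvg 0 T
        (laplace_partial T tau C (cexp (p * (real_complex R T)))) L,
      exists B, l2_inverse (Rop T tau D p) B &
      forall phi : R -> 'cV[R[i]]_d.+1, inL2 0 T phi ->
        aeeq 0 T (Lambda T tau C p phi) (Rinv_L2 T tau D p phi)].
Proof.
have tau0_le j : tau ord0 <= tau j.
  by have [->//|j0] := eqVneq j ord0; apply/ltW/tau_incr; rewrite lt0n.
have tau_itv j : 0 < tau j < T.
  rewrite (lt_le_trans tau_gt0 (tau0_le j))/=; apply: le_lt_trans tau_ltT.
  have [->//|jN] := eqVneq j ord_max; apply/ltW/tau_incr.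
  by rewrite ltn_neqAle -ltnS ltn_ord andbT.
have T0 : 0 < T by have /andP[t0] := tau_itv ord0; exact: lt_trans.
have D_meas j := C1holder_mxmeas (D_C1holder j).
have [B D_bound] : exists B, forall j t i k, absq (D j t i k) <= B.
  have /choice[B BP] : forall j, exists B, forall t i k, absq (D j t i k) <= B.
    by move=> j; have [B _ BP] := C1holder_bounded T0 (D_C1holder j) (D_periodic j); exists B.
  exists (\sum_j `|B j|) => j t i k; apply: le_trans (BP j t i k) _.
  by apply: le_trans (ler_norm _) _; rewrite (bigD1 j)//= lerDl sumr_ge0.
pose s j := sup (range (fun t => mxnorm (D j t))).
have Ds j t : mxnorm (D j t) <= s j := mxnorm_le_sup T0 (D_C1holder j) (D_periodic j) t.
have s0 j : 0 <= s j := le_trans (mxnorm_ge0 _) (Ds j 0).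
pose w := Re p; pose g2 := gamma2 tau D gamma.
have g20 : 0 <= g2 by rewrite /g2 /gamma2 le_max gamma_ge0.
have wg : g2 < w by [].
(* Half of the margin [w - g2] makes the delayed part contracting, the other
   half is the rate of decay. *)
pose beta := (w - g2) / 2; pose w' := w - beta.
have beta0 : 0 < beta by rewrite divr_gt0// subr_gt0.
have w'g : g2 < w' by rewrite /w' /beta; lra.
pose S := \sum_j s j; have S0 : 0 <= S by exact: sumr_ge0.
pose E := expR (w' * tau ord0).
have SE : S < E.
  have := S0; rewrite le_eqVlt => /predU1P[<-|Sgt0]; first exact: expR_gt0.
  rewrite -ltr_ln ?posrE ?expR_gt0// /E expRK mulrC -ltr_pdivrMl//.
  by apply: le_lt_trans w'g; rewrite /g2 /gamma2 le_max lexx orbT.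
(* [eps] makes all weights positive, yet their sum is only [(E + S) / 2]. *)
pose eps := (E - S) / (2 * N.+1%:R).
have eps0 : 0 < eps by rewrite divr_gt0 ?mulr_gt0 ?subr_gt0.
pose b j := s j + eps.
have b0 j : 0 < b j by rewrite ltr_wpDl.
have bE : \sum_j b j < E.
  rewrite /b big_split /= sumr_const card_ord -/S -mulr_natr /eps.
  rewrite (_ : _ / _ * _ = (E - S) / 2); last by field.
  by lra.
pose a j := b j * expR (- (w * tau j)).
have a0 j : 0 < a j by rewrite mulr_gt0// expR_gt0.
have a_bound j t y :
    vsq (cexp (- (p * (tau j)%:C)) *: (D j t *m y)) <= a j ^+ 2 * vsq y.
  rewrite vsqZ absq_cexp cReN cReM /= mulr0 subr0 -/w.
  apply: le_trans (ler_wpM2l (expR_ge0 _) (vsqM_mxnorm _ _)) _.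
  rewrite mulrA ler_wpM2r ?vsq_ge0// /a exprMn mulrC expRM_natl ler_wpM2r ?exprn_ge0 ?expR_ge0//.
  rewrite ler_sqr ?nnegrE ?mxnorm_ge0 ?(ltW (b0 j))//.
  by apply: le_trans (Ds j t) _; rewrite lerDl ltW.
have q1 : \sum_j a j * expR (beta * tau j) < 1.
  apply: (@le_lt_trans _ _ (\sum_j b j * E^-1)); last first.
    by rewrite -mulr_suml ltr_pdivrMr ?mul1r// expR_gt0.
  apply: ler_sum => j _; rewrite /a -mulrA -expRD; apply: ler_wpM2l; first exact: ltW.
  rewrite /E -expRN ler_expR.
  have := ler_wpM2l (le_trans g20 (ltW w'g)) (tau0_le j); rewrite /w'; lra.
have p0 : 0 <= Re p by exact: le_trans g20 (ltW wg).
split.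
- exact: (laplace_cvg tau_itv tau0_le D_meas X_fund C_coefs p0 a0 a_bound beta0 q1).
- exact: (Rop_invertible tau_itv tau0_le D_meas D_bound D_periodic X_fund C_coefs
    p0 a0 a_bound beta0 q1).
- exact: (Lambda_eq_Rinv tau_itv tau0_le D_meas D_bound D_periodic X_fund C_coefs
    p0 a0 a_bound beta0 q1).
Qed.
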